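(* Let $\Lambda$ be a free abelian group of finite rank. If $M$ is a subgroup of $\Lambda$ such that $2\Lambda\subset M$, if $\mathcal{B}$ is an associative $M$-torus with involution that is isograded isomorphic (as a graded algebra with involution) to $\mathcal{C}_*(2)\otimes\mathcal{P}(r)$ for some $r\ge0$, and if $k$ is a diagonal $\Lambda$-graded hermitian form over $\mathcal{B}$, then the structurable $\Lambda$-torus $\mathcal{A}(k)$ associated with $k$ is of class III(a). Moreover, any structurable $\Lambda$-torus of class III(a) is graded-isomorphic (as a $\Lambda$-graded algebra with involution) to a structurable $\Lambda$-torus $\mathcal{A}(k)$ obtained in this way.
   Context: $F$ is a field of characteristic $\ne 2,3$. ''Algebra'' means unital, not necessarily associative $F$-algebra; $[x,y]=xy-yx$, $L_xy=xy$, $R_xy=yx$; $\otimes=\otimes_F$. An algebra with involution is an algebra with an anti-automorphism $*$ of period 2; $\mathcal{A}_{\pm}=\{x: x^*=\pm x\}$. Gradings. A $\Lambda$-graded algebra with involution is $\mathcal{A}=\bigoplus_{\lambda\in\Lambda}\mathcal{A}^\lambda$ with $\mathcal{A}^\lambda\mathcal{A}^\mu\subset\mathcal{A}^{\lambda+\mu}$, $(\mathcal{A}^\lambda)^*=\mathcal{A}^\lambda$; $\operatorname{supp}(\mathcal{A})=\{\lambda:\mathcal{A}^\lambda\ne0\}$; finely graded means $\dim\mathcal{A}^\lambda=1$ for $\lambda$ in the support. For a subset $X\subset\Lambda$, $\mathcal{A}^X=\bigoplus_{\lambda\in X}\mathcal{A}^\lambda$. Isograded isomorphism: an isomorphism $\varphi$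 of algebras with involution with $\varphi(\mathcal{A}^\lambda)=\mathcal{A}'^{\theta(\lambda)}$ for some group isomorphism $\theta$ of the grading groups; graded isomorphism: $\theta=\mathrm{id}$. Tensor products are graded by the direct sum of the grading groups and have the tensor product involution. Structurable tori. A structurable algebra is an algebra with involution satisfying $\{xy\{zwq\}\}-\{zw\{xyq\}\}=\{\{xyz\}wq\}-\{z\{yxw\}q\}$, where $\{xyz\}=(xy^* )z+(zy^* )x-(zx^* )y$. In a finely graded structurable algebra, a homogeneous $x$ is invertible if there is $x^{-1}$ with $xx^{-1}=x^{-1}x=1$, $[L_x,L_{x^{-1}}]=[R_x,R_{x^{-1}}]=0$. A structurable $\Lambda$-torus is a $\Lambda$-graded structurable algebra which is finely graded, in which every nonzero homogeneous element is invertible, and whose support generates $\Lambda$. An associative $M$-torus with involution is a structurable $M$-torus that is associative. (Associative algebras with involution are structurable.) Classes. For a structurable $\Lambda$-torus $\mathcal{A}$ let $S=\operatorname{supp}(\mathcal{A})$, $S_\pm=S_\pm(\mathcal{A})=\operatorname{supp}(\mathcal{A}_\pm)$, $\Lambda_-=\langle S_-\rangle$ (subgroup generated), $\mathcal{E}=\mathcal{A}^{\Lambda_-}$, $\mathcal{W}=\mathcal{A}^{\Lambda\setminus\Lambda_-}$. $\mathcal{A}$ is of class III if $S_-\ne\emptyset$, $\mathcal{E}\ne\mathcal{A}$ and $\mathcal{W}\mathcal{W}\not\subset\mathcal{E}$. If $\mathcal{A}$ is of class III, write $w_1w_2=h(w_1,w_2)+w_1\diamond w_2$ with $h(w_1,w_2)\in\mathcal{E}$,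 $w_1\diamond w_2\in\mathcal{W}$ for $w_i\in\mathcal{W}$, and let $\bar\alpha=\alpha+\Lambda_-\in\Lambda/\Lambda_-$. The incidence geometry $\mathcal{I}$ of $\mathcal{A}$ has as points the $\bar\alpha$ with $\alpha\in S\setminus\Lambda_-$, and as lines the unordered triples $[\bar\alpha,\bar\beta,\bar\gamma]$ of points (repetition allowed) with $h(\mathcal{A}^\alpha,\mathcal{A}^\beta\diamond\mathcal{A}^\gamma)\neq0$ (this condition does not depend on the order or on the representatives). Points $\bar\alpha,\bar\beta$ are collinear if $[\bar\alpha,\bar\beta,\bar\gamma]$ is a line for some point $\bar\gamma$; $\bar\alpha$ is incident to each line of the form $[\bar\alpha,\bar\beta,\bar\gamma]$. $\mathcal{I}$ is a star with centre $\bar\alpha$ if $\bar\alpha$ is collinear with all points $\bar\beta\ne\bar\alpha$ and $\bar\alpha$ is incident to each line. $\mathcal{A}$ is of class III(a) if it is of class III and $\mathcal{I}$ is a star. The algebras $\mathcal{C}_*(2)$ and $\mathcal{P}(r)$. $\mathcal{P}(r)=F[t_1^{\pm1},\dots,t_r^{\pm1}]$ with trivial involution, $\mathbb{Z}^r$-graded with $\deg t_i$ the $i$-th standard basis vector. $\mathcal{C}_*(2)$ is the quaternion algebra over $F[t_1^{\pm1},t_2^{\pm1}]$ with generators $x_1,x_2$, relations $x_1^2=t_1$, $x_2^2=t_2$, $x_1x_2=-x_2x_1$, with basis $1,x_1,x_2,x_2x_1$ over $F[t_1^{\pm1},t_2^{\pm1}]$, with the involution fixing $x_1$ and $x_2$,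 and with the $\mathbb{Z}^2$-grading with $\deg x_1=(1,0)$, $\deg x_2=(0,1)$. The torus $\mathcal{A}(k)$. Let $M\supset 2\Lambda$ be a subgroup of $\Lambda$ and $\mathcal{B}$ an associative $M$-torus with involution $*$, regarded as $\Lambda$-graded with $\mathcal{B}^\lambda=0$ for $\lambda\notin M$. Let $m\ge1$; let $\rho_1,\dots,\rho_m\in\Lambda\setminus M$ satisfy $\Lambda=\langle M,\rho_1,\dots,\rho_m\rangle$, $\rho_i-\rho_j\notin M$ for $i\ne j$, and $2\rho_i\in S_+(\mathcal{B})$ for all $i$; let $0\ne b_i\in\mathcal{B}^{2\rho_i}$. Let $\mathcal{X}$ be the free left $\mathcal{B}$-module with basis $v_1,\dots,v_m$, $\Lambda$-graded so that $bv_i$ has degree $\sigma+\rho_i$ for $b\in\mathcal{B}^\sigma$, $\sigma\in M$, and let $k:\mathcal{X}\times\mathcal{X}\to\mathcal{B}$ be the hermitian form (i.e. biadditive with $k(au,v)=ak(u,v)$, $k(u,av)=k(u,v)a^*$, $k(v,u)=k(u,v)^*$) with $k(v_i,v_j)=\delta_{ij}b_i$. Any $k$ arising in this way (for some choice of $m$, $\rho_i$, $b_i$) is called a diagonal $\Lambda$-graded hermitian form over $\mathcal{B}$. Then $\mathcal{A}(k)=\mathcal{B}\oplus\mathcal{X}$ with product $(a,u)(b,v)=(ba+k(u,v),\,av+b^*u)$ (where $ba$ is the product in $\mathcal{B}$), involution $(a,u)^*=(a^*,u)$, and the $\Lambda$-grading extending those of $\mathcal{B}$ and $\mathcal{X}$,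 is known to be a structurable $\Lambda$-torus, called the structurable $\Lambda$-torus associated with $k$. *)

(* Defs.v *)
From HB Require Import structures.
From mathcomp Require Import all_boot all_order all_algebra.
From mathcomp Require Import finmap.
From mathcomp Require Import boolp classical_sets.
From mathcomp Require Import monalg ring.

Set Implicit Arguments.
Unset Strict Implicit.
Unset Printing Implicit Defensive.

Import GRing.Theory.
Local Open Scope ring_scope.

(* multinomials' {malg F[K]} only carries a ring structure for monoids K without
   nontrivial units, so the product of the group algebra F[G] is defined here. *)
Section GroupAlgebra.
Variables (F : fieldType) (G : zmodType).

Definition grpalg : Type := {malg F[G]}.
HB.instance Definition _ := GRing.Lmodule.copy grpalg {malg F[G]}.
Implicit Types (x y z : grpalg) (a b : G) (c d : F).

Definition lcoef x a : F := mcoeff a x.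
Definition lterm c a : grpalg := mkmalgU a c.
Definition lmul_def x y : grpalg :=
  \sum_(a <- msupp x) \sum_(b <- msupp y) lterm (lcoef x a * lcoef y b) (a + b).
Definition lmul := locked lmul_def.

Lemma lmul_unlock : lmul = lmul_def.
Proof. by rewrite /lmul -lock. Qed.

Lemma grpalgP x y : (forall a, lcoef x a = lcoef y a) -> x = y.
Proof. by move/malgP. Qed.

Lemma lcoef0 a : lcoef 0 a = 0. Proof. exact: mcoeff0. Qed.
Lemma lcoefD x y a : lcoef (x + y) a = lcoef x a + lcoef y a.
Proof. exact: mcoeffD. Qed.
Lemma lcoefZ c x a : lcoef (c *: x) a = c * lcoef x a.
Proof. exact: mcoeffZ. Qed.
Lemma lcoefU c a b : lcoef (lterm c a) b = c *+ (a == b).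
Proof. exact: mcoeffU. Qed.
Lemma lterm0 a : lterm 0 a = 0. Proof. exact: monalgU0. Qed.
Lemma ltermD c d a : lterm (c + d) a = lterm c a + lterm d a.
Proof. exact: monalgUD. Qed.

Lemma lcoef_sum (I : Type) (s : seq I) (f : I -> grpalg) a :
  lcoef (\sum_(i <- s) f i) a = \sum_(i <- s) lcoef (f i) a.
Proof. exact: (big_morph (lcoef^~ a) (fun u v => lcoefD u v a) (lcoef0 a)). Qed.

Lemma lscaleU c d a : c *: lterm d a = lterm (c * d) a.
Proof. by apply: grpalgP => b; rewrite lcoefZ !lcoefU mulrnAr. Qed.

Lemma grpalgE x : x = \sum_(a <- msupp x) lterm (lcoef x a) a.
Proof. exact: monalgE. Qed.

Lemma grpalg_ind (P : grpalg -> Prop) :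
    P 0 -> (forall x y, P x -> P y -> P (x + y)) ->
  (forall c a, P (lterm c a)) -> forall x, P x.
Proof. by move=> P0 PD PU x; rewrite (grpalgE x); apply: big_ind. Qed.

Lemma lmulw (d1 d2 : {fset G}) x y :
  (msupp x `<=` d1)%fset -> (msupp y `<=` d2)%fset ->
  lmul x y =
  \sum_(a <- d1) \sum_(b <- d2) lterm (lcoef x a * lcoef y b) (a + b).
Proof.
move=> le_d1 le_d2; rewrite lmul_unlock /lmul_def (big_fset_incl _ le_d1) /=.
  apply/eq_bigr=> k1 _; apply/big_fset_incl => // k _ /mcoeff_outdom.
  by rewrite -/(lcoef _ _) => ->; rewrite mulr0 lterm0.
move=> k _ /mcoeff_outdom; rewrite -/(lcoef _ _) => g1k.
by rewrite big1 => // k' _; rewrite g1k mul0r lterm0.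
Qed.

Lemma lmulC : commutative lmul.
Proof.
move=> x y; rewrite lmul_unlock /lmul_def exchange_big /=.
by apply: eq_bigr => a _; apply: eq_bigr => b _; rewrite mulrC addrC.
Qed.

Lemma lmulDl : left_distributive lmul +%R.
Proof.
move=> x y z.
rewrite (lmulw (msuppD_le x y) (fsubset_refl _)).
rewrite (lmulw (fsubsetUl (msupp x) (msupp y)) (fsubset_refl _)).
rewrite (lmulw (fsubsetUr (msupp x) (msupp y)) (fsubset_refl _)).
rewrite -big_split /=; apply/eq_bigr=> a _.
rewrite -big_split /=; apply/eq_bigr=> b _.
by rewrite lcoefD mulrDl ltermD.
Qed.

Lemma lmulDr : right_distributive lmul +%R.
Proof. by move=> x y z; rewrite lmulC lmulDl !(lmulC _ x). Qed.

Lemma lmul0 x : lmul 0 x = 0.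
Proof. by rewrite lmul_unlock /lmul_def msupp0 big_seq_fset0. Qed.

Lemma lmulUU c d a b :
  lmul (lterm c a) (lterm d b) = lterm (c * d) (a + b).
Proof.
by rewrite (lmulw msuppU_le msuppU_le) !big_seq_fset1 !lcoefU !eqxx.
Qed.

Lemma lmulA : associative lmul.
Proof.
have lmulx0 x : lmul x 0 = 0 by rewrite lmulC lmul0.
move=> x y z; elim/grpalg_ind: x => [|x x' IH IH'|c a]; first by rewrite !lmul0.
  by rewrite !lmulDl IH IH'.
elim/grpalg_ind: y => [|y y' IH IH'|d b]; first by rewrite lmulx0 lmul0 lmulx0.
  by rewrite lmulDr !lmulDl lmulDr IH IH'.
elim/grpalg_ind: z => [|z z' IH IH'|e f]; first by rewrite !lmulx0.
  by rewrite !lmulDr IH IH'.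
by rewrite !lmulUU mulrA addrA.
Qed.

Lemma lmul1 : left_id (lterm 1 0) lmul.
Proof.
move=> x; elim/grpalg_ind: x => [|x x' IH IH'|c a].
- by rewrite lmulC lmul0.
- by rewrite lmulDr IH IH'.
by rewrite lmulUU mul1r add0r.
Qed.

Lemma lone_neq0 : lterm 1 0 != 0.
Proof.
apply/eqP => /(congr1 (lcoef^~ 0)) /eqP.
by rewrite lcoefU lcoef0 eqxx oner_eq0.
Qed.

HB.instance Definition _ := GRing.Zmodule_isComNzRing.Build grpalg
  lmulA lmulC lmul1 lmulDl lone_neq0.

Lemma lmulE x y : x * y = lmul x y. Proof. by []. Qed.

Lemma lscaleAl c x y : c *: (x * y) = c *: x * y.
Proof.
elim/grpalg_ind: x => [|x x' IH IH'|d a]; first by rewrite !(scaler0, mul0r).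
  by rewrite mulrDl !scalerDr mulrDl IH IH'.
elim/grpalg_ind: y => [|y y' IH IH'|e b]; first by rewrite !mulr0 scaler0.
  by rewrite mulrDr scalerDr mulrDr IH IH'.
by rewrite lscaleU !lmulE !lmulUU lscaleU mulrA.
Qed.

HB.instance Definition _ := GRing.Lmodule_isLalgebra.Build F grpalg lscaleAl.
HB.instance Definition _ := GRing.Lalgebra_isComAlgebra.Build F grpalg.

Definition supported (P : set G) x := forall a, lcoef x a != 0 -> P a.

Lemma supported0 P : supported P 0.
Proof. by move=> a; rewrite lcoef0 eqxx. Qed.

Lemma supportedP P c x y :
  supported P x -> supported P y -> supported P (c *: x + y).
Proof.
move=> Px Py a; rewrite lcoefD lcoefZ => nz.
have [x0|/Px//] := eqVneq (lcoef x a) 0; apply: Py.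
by move: nz; rewrite x0 mulr0 add0r.
Qed.

Lemma supportedU (P : set G) c a : P a -> supported P (lterm c a).
Proof.
move=> Pa b; rewrite lcoefU; case: (eqVneq a b) => [<-//|_].
by rewrite mulr0n eqxx.
Qed.

Lemma supported_sum P (I : eqType) (s : seq I) (f : I -> grpalg) :
  (forall i, i \in s -> supported P (f i)) -> supported P (\sum_(i <- s) f i).
Proof.
move=> H; rewrite big_seq; apply: (big_ind (supported P)) => //.
- exact: supported0.
- by move=> x y Px Py; rewrite -[x]scale1r; apply: supportedP.
Qed.

Lemma supportedM P Q (S : set G) x y :
    (forall a b, P a -> Q b -> S (a + b)) ->
  supported P x -> supported Q y -> supported S (x * y).
Proof.
move=> PQS Px Qy; rewrite lmulE lmul_unlock.
apply: supported_sum => a xa; apply: supported_sum => b yb.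
by apply: supportedU; apply: PQS; [apply: Px|apply: Qy]; rewrite mcoeff_neq0.
Qed.
End GroupAlgebra.

Local Open Scope classical_set_scope.

Section Subgroups.
Variable L : zmodType.

Definition is_subgroup (H : set L) :=
  H 0 /\ forall x y, H x -> H y -> H (x - y).

Definition generated (X : set L) : set L := smallest is_subgroup X.

Definition free_abelian_of_finite_rank :=
  exists (n : nat) (f : {additive L -> 'rV[int]_n}), bijective f.

Variable M : zmodClosed L.

Definition subgrp := {x : L | x \in M}.
HB.instance Definition _ := SubChoice.on subgrp.
HB.instance Definition _ := [SubChoice_isSubZmodule of subgrp by <:].
End Subgroups.
Arguments free_abelian_of_finite_rank : clear implicits.

Record gradedInvAlg (F : fieldType) (L : zmodType) := GradedInvAlg {
  ga_car :> lmodType F;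
  ga_mul : ga_car -> ga_car -> ga_car;
  ga_one : ga_car;
  ga_star : ga_car -> ga_car;
  ga_gr : L -> set ga_car;
  ga_mul_linearl : forall y, linear (ga_mul^~ y);
  ga_mul_linearr : forall x, linear (ga_mul x);
  ga_mul1x : left_id ga_one ga_mul;
  ga_mulx1 : right_id ga_one ga_mul;
  ga_star_linear : linear ga_star;
  ga_starK : involutive ga_star;
  ga_starM : forall x y, ga_star (ga_mul x y) = ga_mul (ga_star y) (ga_star x);
  ga_gr0 : forall l, ga_gr l 0;
  ga_grP : forall l c x y, ga_gr l x -> ga_gr l y -> ga_gr l (c *: x + y);
  ga_gr_span : forall x, exists2 s : seq ga_car,
    forall y, y \in s -> exists l, ga_gr l y & x = \sum_(y <- s) y;
  ga_gr_indep : forall (s : seq L) (f : L -> ga_car), uniq s ->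
    (forall l, ga_gr l (f l)) -> \sum_(l <- s) f l = 0 ->
    forall l, l \in s -> f l = 0;
  ga_gr_mul : forall l m x y,
    ga_gr l x -> ga_gr m y -> ga_gr (l + m) (ga_mul x y);
  ga_gr_star : forall l x, ga_gr l x -> ga_gr l (ga_star x)
}.

Notation "x ** y" := (ga_mul x y) (at level 40, left associativity).
Notation star := (@ga_star _ _ _).
Notation one A := (@ga_one _ _ A).
Notation "A `_[ l ]" := (@ga_gr _ _ A l) (at level 2, format "A `_[ l ]").

Section Theory.
Variables (F : fieldType) (L : zmodType) (A : gradedInvAlg F L).
Implicit Types (x y z w : A) (l : L) (X : set L).

Lemma gmul0x x : 0 ** x = 0.
Proof.
by have := ga_mul_linearl x (-1) 0 0; rewrite scaler0 addr0 scaleN1r addNr.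
Qed.

Lemma gmulx0 x : x ** 0 = 0.
Proof.
by have := ga_mul_linearr x (-1) 0 0; rewrite scaler0 addr0 scaleN1r addNr.
Qed.

Lemma gstar0 : star 0 = 0 :> A.
Proof.
by have := ga_star_linear (-1 : F) (0 : A) 0; rewrite scaler0 addr0 scaleN1r addNr.
Qed.

Lemma gmulDl x y z : (x + y) ** z = x ** z + y ** z.
Proof. by have := ga_mul_linearl z 1 x y; rewrite !scale1r. Qed.

Lemma gmulDr x y z : z ** (x + y) = z ** x + z ** y.
Proof. by have := ga_mul_linearr z 1 x y; rewrite !scale1r. Qed.

Lemma gstarD x y : star (x + y) = star x + star y.
Proof. by have := ga_star_linear 1 x y; rewrite !scale1r. Qed.

Lemma gstar_sum (I : Type) (s : seq I) (f : I -> A) :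
  star (\sum_(i <- s) f i) = \sum_(i <- s) star (f i).
Proof. exact: (big_morph _ gstarD gstar0). Qed.

Lemma gstar1 : star (one A) = one A.
Proof. by rewrite -[LHS]ga_mul1x -[X in X ** _]ga_starK -ga_starM ga_mul1x ga_starK. Qed.

Lemma ggrD l x y : A`_[l] x -> A`_[l] y -> A`_[l] (x + y).
Proof. by rewrite -[x in x + y]scale1r; apply: ga_grP. Qed.

Lemma ggr_sum l (I : finType) (f : I -> A) :
  (forall i, A`_[l] (f i)) -> A`_[l] (\sum_i f i).
Proof.
move=> H; apply: (big_ind A`_[l]) => //; [exact: ga_gr0|exact: ggrD].
Qed.

Definition supp : set L := [set l | exists2 x, A`_[l] x & x <> 0].
Definition supp_plus : set L :=
  [set l | exists x, [/\ A`_[l] x, star x = x & x <> 0]].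
Definition supp_minus : set L :=
  [set l | exists x, [/\ A`_[l] x, star x = - x & x <> 0]].

Definition graded_part X : set A := [set x | exists2 s : seq A,
  forall y, y \in s -> exists2 l, X l & A`_[l] y & x = \sum_(y <- s) y].

Definition triple x y z : A :=
  (x ** star y) ** z + (z ** star y) ** x - (z ** star x) ** y.

Definition structurable := forall x y z w q : A,
  triple x y (triple z w q) - triple z w (triple x y q) =
  triple (triple x y z) w q - triple z (triple y x w) q.

(* $\dim A^l = 1$ for l in the support *)
Definition finely_graded := forall l, supp l ->
  exists2 x, A`_[l] x /\ x <> 0 &
    forall y, A`_[l] y -> exists c : F, y = c *: x.

Definition invertible x := exists y, [/\ x ** y = one A, y ** x = one A,
  forall z, x ** (y ** z) = y ** (x ** z) &
  forall z, (z ** y) ** x = (z ** x) ** y].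

Definition structurable_torus := [/\ structurable, finely_graded,
  forall l x, A`_[l] x -> x <> 0 -> invertible x & generated supp = setT].

Definition Lambda_minus : set L := generated supp_minus.
Definition partE : set A := graded_part Lambda_minus.
Definition partW : set A := graded_part (~` Lambda_minus).

Definition class_III := [/\ supp_minus !=set0, partE <> setT &
  exists w1 w2, [/\ partW w1, partW w2 & ~ partE (w1 ** w2)]].

(* [hdiam w1 w2 e w] says that $h(w_1,w_2) = e$ and $w_1 \diamond w_2 = w$. *)
Definition hdiam (w1 w2 e w : A) := [/\ partE e, partW w & w1 ** w2 = e + w].

(* $h(A^a, A^b \diamond A^c) \neq 0$ *)
Definition h_diam_neq0 (a b c : L) := exists x y z e w e' w',
  [/\ A`_[a] x, A`_[b] y & A`_[c] z] /\
  [/\ hdiam y z e w, hdiam x w e' w' & e' <> 0].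

(* Elements of $\Lambda/\Lambda_-$ are cosets, as subsets of $\Lambda$. *)
Definition coset (a : L) : set L := [set l | Lambda_minus (l - a)].

Definition point (p : set L) :=
  exists2 a, (supp `\` Lambda_minus) a & p = coset a.

(* The unordered triple [p, q, r] is a line: perm_eq lists it in some order. *)
Definition line (p q r : set L) := exists a b c,
  [/\ [/\ (supp `\` Lambda_minus) a, (supp `\` Lambda_minus) b &
          (supp `\` Lambda_minus) c],
      h_diam_neq0 a b c &
      perm_eq [:: p; q; r] [:: coset a; coset b; coset c]].

Definition collinear (p q : set L) := exists2 r, point r & line p q r.

Definition star_with_centre (p : set L) := [/\ point p,
  forall q, point q -> q <> p -> collinear p q &
  forall q r s, line q r s -> p \in [:: q; r; s]].

Definition class_IIIa := class_III /\ exists p, star_with_centre p.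
End Theory.

Section Isomorphisms.
Variable F : fieldType.

Definition inv_alg_iso (L L' : zmodType) (A : gradedInvAlg F L)
    (A' : gradedInvAlg F L') (phi : A -> A') :=
  [/\ linear phi, bijective phi, phi (one A) = one A',
      {morph phi : x y / x ** y} & {morph phi : x / star x}].

Definition isograded_isomorphic (L L' : zmodType) (A : gradedInvAlg F L)
    (A' : gradedInvAlg F L') := exists (phi : A -> A') (theta : {additive L -> L'}),
  [/\ inv_alg_iso phi, bijective theta &
      forall l, phi @` A`_[l] = A'`_[theta l]].

Definition graded_isomorphic (L : zmodType) (A A' : gradedInvAlg F L) :=
  exists2 phi : A -> A', inv_alg_iso phi & forall l, phi @` A`_[l] = A'`_[l].

Definition bilinear_map (U V W : lmodType F) (f : U -> V -> W) :=
  (forall v, linear (f^~ v)) /\ (forall u, linear (f u)).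

(* $W = U \otimes V$ with $t(u, v) = u \otimes v$ *)
Definition universal_bilinear (U V W : lmodType F) (t : U -> V -> W) :=
  bilinear_map t /\
  forall (Z : lmodType F) (f : U -> V -> Z), bilinear_map f ->
    exists! g : W -> Z, linear g /\ forall u v, g (t u v) = f u v.

Definition is_tensor_product (L1 L2 : zmodType) (A : gradedInvAlg F L1)
    (B : gradedInvAlg F L2) (T : gradedInvAlg F (L1 * L2)%type) :=
  exists t : A -> B -> T, [/\ universal_bilinear t,
    t (one A) (one B) = one T,
    forall a a' b b', t a b ** t a' b' = t (a ** a') (b ** b'),
    forall a b, star (t a b) = t (star a) (star b) &
    forall l m, T`_[(l, m)] = [set x | exists2 s : seq (A * B),
      forall p, p \in s -> A`_[l] p.1 /\ B`_[m] p.2 &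
      x = \sum_(p <- s) t p.1 p.2]].
End Isomorphisms.

Section HomogeneousSpan.
Variables (F : fieldType) (L : zmodType) (V : lmodType F) (gr : L -> set V).

Definition hspan x := exists2 s : seq V,
  forall y, y \in s -> exists l, gr l y & x = \sum_(y <- s) y.

Lemma hspan1 l x : gr l x -> hspan x.
Proof.
by exists [:: x]; [move=> y; rewrite inE => /eqP ->; exists l|rewrite big_seq1].
Qed.

Lemma hspan0 : hspan 0.
Proof. by exists [::]; rewrite ?big_nil. Qed.

Lemma hspanD x y : hspan x -> hspan y -> hspan (x + y).
Proof.
move=> [s Hs ->] [s' Hs' ->]; exists (s ++ s'); last by rewrite big_cat.
by move=> z; rewrite mem_cat => /orP[/Hs|/Hs'].
Qed.

Lemma hspan_sum (I : Type) (s : seq I) (f : I -> V) :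
  (forall i, hspan (f i)) -> hspan (\sum_(i <- s) f i).
Proof. by move=> H; apply: (big_ind hspan) => //; [exact: hspan0|exact: hspanD]. Qed.
End HomogeneousSpan.

Section GroupAlgebraGraded.
Variables (F : fieldType) (G : zmodType).

Lemma supported_indep (deg : G -> G) (s : seq G) (f : G -> grpalg F G) :
    uniq s -> (forall l, supported [set a | deg a = l] (f l)) ->
  \sum_(l <- s) f l = 0 -> forall l, l \in s -> f l = 0.
Proof.
move=> us Hf sum0 l ls; apply: grpalgP => a; rewrite lcoef0.
apply/eqP/negPn/negP => nz; have /= dl := Hf l a nz.
move: (congr1 (fun x => lcoef x a) sum0).
rewrite lcoef0 lcoef_sum (bigD1_seq l) //= big1 ?addr0; first exact/eqP.
move=> m ml; apply/eqP/negPn/negP => /Hf /= dm.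
by rewrite -dm dl eqxx in ml.
Qed.

Definition grpalg_gr (l : G) : set (grpalg F G) := supported [set l].

Fact grpalg_mul_linearl (y : grpalg F G) : linear ( *%R^~ y).
Proof. by move=> c x z; rewrite mulrDl scalerAl. Qed.
Fact grpalg_mul_linearr (y : grpalg F G) : linear ( *%R y).
Proof. by move=> c x z; rewrite mulrDr scalerAr. Qed.
Fact grpalg_star_linear : linear (@id (grpalg F G)). Proof. by []. Qed.
Fact grpalg_starM (x y : grpalg F G) : x * y = y * x.
Proof. exact: mulrC. Qed.
Fact grpalg_gr0 l : grpalg_gr l 0. Proof. exact: supported0. Qed.
Fact grpalg_grP l c x y :
  grpalg_gr l x -> grpalg_gr l y -> grpalg_gr l (c *: x + y).
Proof. exact: supportedP. Qed.
Fact grpalg_gr_span x : hspan grpalg_gr x.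
Proof.
elim/grpalg_ind: x => [|x y|c a]; [exact: hspan0|exact: hspanD|].
by apply: (@hspan1 _ _ _ _ a); apply: supportedU.
Qed.
Fact grpalg_gr_indep (s : seq G) (f : G -> grpalg F G) :
    uniq s -> (forall l, grpalg_gr l (f l)) ->
  \sum_(l <- s) f l = 0 -> forall l, l \in s -> f l = 0.
Proof. by move=> us Hf; apply: (supported_indep (deg := id)). Qed.
Fact grpalg_gr_mul l m x y :
  grpalg_gr l x -> grpalg_gr m y -> grpalg_gr (l + m) (x * y).
Proof. by apply: supportedM => a b /= -> ->. Qed.

Definition grpalg_graded : gradedInvAlg F G :=
  @GradedInvAlg F _ (grpalg F G) *%R 1 id grpalg_gr
    grpalg_mul_linearl grpalg_mul_linearr (@mul1r _) (@mulr1 _)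
    grpalg_star_linear (fun=> erefl) grpalg_starM
    grpalg_gr0 grpalg_grP grpalg_gr_span grpalg_gr_indep
    grpalg_gr_mul (fun _ _ => id).
End GroupAlgebraGraded.

Definition Palg (F : fieldType) (r : nat) : gradedInvAlg F 'rV[int]_r :=
  grpalg_graded F 'rV[int]_r.

(* (x0, x1, x2, x3) stands for $x_0 + x_1 g_1 + x_2 g_2 + x_3 g_2 g_1$, where the
   generators $g_1, g_2$ satisfy $g_1^2 = a$, $g_2^2 = b$, $g_1g_2 = -g_2g_1$ and
   are fixed by the involution, which therefore sends $g_2g_1$ to $-g_2g_1$. *)
Section Quaternion.
Variables (F : fieldType) (R : comAlgType F) (a b : R).

Definition quat : Type := (R * R * R * R)%type.
HB.instance Definition _ := GRing.Lmodule.copy quat (R * R * R * R)%type.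

Definition quat_mul (x y : quat) : quat :=
  let: (x0, x1, x2, x3) := x in let: (y0, y1, y2, y3) := y in
  (x0 * y0 + a * (x1 * y1) + b * (x2 * y2) - a * b * (x3 * y3),
   x0 * y1 + x1 * y0 + b * (x2 * y3 - x3 * y2),
   x0 * y2 + x2 * y0 + a * (x3 * y1 - x1 * y3),
   x0 * y3 + x3 * y0 + x2 * y1 - x1 * y2).
Definition quat_one : quat := (1, 0, 0, 0).
Definition quat_star (x : quat) : quat :=
  let: (x0, x1, x2, x3) := x in (x0, x1, x2, - x3).

Lemma quatP (c : F) (x0 x1 x2 x3 y0 y1 y2 y3 : R) :
  c *: ((x0, x1, x2, x3) : quat) + ((y0, y1, y2, y3) : quat) =
  (c%:A * x0 + y0, c%:A * x1 + y1, c%:A * x2 + y2, c%:A * x3 + y3).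
Proof. by rewrite !mulr_algl. Qed.

Fact quat_mul_linearl (y : quat) : linear (quat_mul^~ y).
Proof.
move: y => [[[y0 y1] y2] y3] c [[[x0 x1] x2] x3] [[[z0 z1] z2] z3].
by rewrite quatP /= quatP; congr (_, _, _, _); ring.
Qed.
Fact quat_mul_linearr (y : quat) : linear (quat_mul y).
Proof.
move: y => [[[y0 y1] y2] y3] c [[[x0 x1] x2] x3] [[[z0 z1] z2] z3].
by rewrite quatP /= quatP; congr (_, _, _, _); ring.
Qed.
Fact quat_mul1x : left_id quat_one quat_mul.
Proof. by move=> [[[x0 x1] x2] x3]; congr (_, _, _, _); ring. Qed.
Fact quat_mulx1 : right_id quat_one quat_mul.
Proof. by move=> [[[x0 x1] x2] x3]; congr (_, _, _, _); ring. Qed.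
Fact quat_star_linear : linear quat_star.
Proof.
move=> c [[[x0 x1] x2] x3] [[[z0 z1] z2] z3].
by rewrite quatP /= quatP; congr (_, _, _, _); ring.
Qed.
Fact quat_starK : involutive quat_star.
Proof. by move=> [[[x0 x1] x2] x3]; rewrite /= opprK. Qed.
Fact quat_starM x y :
  quat_star (quat_mul x y) = quat_mul (quat_star y) (quat_star x).
Proof.
move: x y => [[[x0 x1] x2] x3] [[[y0 y1] y2] y3].
by congr (_, _, _, _); ring.
Qed.
End Quaternion.

Section QuaternionGraded.
Variables (F : fieldType) (G : zmodType) (e1 e2 : G).
Local Notation R := (grpalg F G).
Local Notation Q := (quat R).
Local Notation t e := (lterm 1 e : R).

(* The generators of the quaternion algebra have degrees $e_1, e_2$, so that their
   squares $t^{e_1}, t^{e_2}$ have degrees $2e_1, 2e_2$ and $t^m$ has degree $2m$. *)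
Definition quat_gr (l : G) : set Q := [set x | let: (x0, x1, x2, x3) := x in
  [/\ supported [set m | m *+ 2 = l] x0,
      supported [set m | m *+ 2 + e1 = l] x1,
      supported [set m | m *+ 2 + e2 = l] x2 &
      supported [set m | m *+ 2 + (e1 + e2) = l] x3]].

Fact quat_gr0 l : quat_gr l 0.
Proof. by split; apply: supported0. Qed.
Fact quat_grP l c x y : quat_gr l x -> quat_gr l y -> quat_gr l (c *: x + y).
Proof.
move: x y => [[[x0 x1] x2] x3] [[[y0 y1] y2] y3] [? ? ? ?] [? ? ? ?].
by split; apply: supportedP.
Qed.
Fact quat_gr_span x : hspan quat_gr x.
Proof.
move: x => [[[x0 x1] x2] x3].
have -> : (x0, x1, x2, x3) = ((x0, 0, 0, 0) : Q) + ((0, x1, 0, 0) : Q) +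
                             ((0, 0, x2, 0) : Q) + ((0, 0, 0, x3) : Q).
  by congr (_, _, _, _); rewrite /= ?(addr0, add0r).
have s0 := @supported0 F G.
do 3?[apply: hspanD].
- elim/grpalg_ind: x0 => [|x y Hx Hy|c m]; first exact: hspan0.
    by have := hspanD Hx Hy; congr hspan; congr (_, _, _, _); rewrite /= ?addr0.
  by apply: (@hspan1 _ _ _ _ (m *+ 2)); split=> //; apply: supportedU.
- elim/grpalg_ind: x1 => [|x y Hx Hy|c m]; first exact: hspan0.
    by have := hspanD Hx Hy; congr hspan; congr (_, _, _, _); rewrite /= ?addr0.
  by apply: (@hspan1 _ _ _ _ (m *+ 2 + e1)); split=> //; apply: supportedU.
- elim/grpalg_ind: x2 => [|x y Hx Hy|c m]; first exact: hspan0.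
    by have := hspanD Hx Hy; congr hspan; congr (_, _, _, _); rewrite /= ?addr0.
  by apply: (@hspan1 _ _ _ _ (m *+ 2 + e2)); split=> //; apply: supportedU.
- elim/grpalg_ind: x3 => [|x y Hx Hy|c m]; first exact: hspan0.
    by have := hspanD Hx Hy; congr hspan; congr (_, _, _, _); rewrite /= ?addr0.
  by apply: (@hspan1 _ _ _ _ (m *+ 2 + (e1 + e2))); split=> //; apply: supportedU.
Qed.

Fact quat_gr_indep (s : seq G) (f : G -> Q) :
    uniq s -> (forall l, quat_gr l (f l)) ->
  \sum_(l <- s) f l = 0 -> forall l, l \in s -> f l = 0.
Proof.
move=> us Hf sum0 l ls.
pose p0 (x : Q) : R := x.1.1.1; pose p1 (x : Q) : R := x.1.1.2.
pose p2 (x : Q) : R := x.1.2; pose p3 (x : Q) : R := x.2.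
have H (p : Q -> R) (deg : G -> G) :
    (forall x y, p (x + y) = p x + p y) -> p 0 = 0 ->
    (forall m, supported [set a | deg a = m] (p (f m))) -> p (f l) = 0.
  move=> pD p00 Hp; apply: (supported_indep us Hp) => //.
  by rewrite -(big_morph p pD p00) sum0.
have h0 : p0 (f l) = 0.
  apply: (H _ (fun m => m *+ 2)) => // m.
  by have := Hf m; rewrite /quat_gr /p0 /=; case: (f m) => [[[? ?] ?] ?] [].
have h1 : p1 (f l) = 0.
  apply: (H _ (fun m => m *+ 2 + e1)) => // m.
  by have := Hf m; rewrite /quat_gr /p1 /=; case: (f m) => [[[? ?] ?] ?] [].
have h2 : p2 (f l) = 0.
  apply: (H _ (fun m => m *+ 2 + e2)) => // m.
  by have := Hf m; rewrite /quat_gr /p2 /=; case: (f m) => [[[? ?] ?] ?] [].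
have h3 : p3 (f l) = 0.
  apply: (H _ (fun m => m *+ 2 + (e1 + e2))) => // m.
  by have := Hf m; rewrite /quat_gr /p3 /=; case: (f m) => [[[? ?] ?] ?] [].
move: h0 h1 h2 h3; rewrite /p0 /p1 /p2 /p3.
by case: (f l) => [[[? ?] ?] ?] /= -> -> -> ->.
Qed.

Lemma supportedN (P : set G) (x : R) : supported P x -> supported P (- x).
Proof.
move=> Px; rewrite -[- x]addr0 -scaleN1r.
by apply: supportedP => //; apply: supported0.
Qed.

Lemma supportedD (P : set G) (x y : R) :
  supported P x -> supported P y -> supported P (x + y).
Proof. by move=> Px; rewrite -[x]scale1r; apply: supportedP. Qed.

Lemma supported_quatM l m d d' d'' (u v : R) : d + d' = d'' ->
    supported [set a | a *+ 2 + d = l] u ->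
    supported [set a | a *+ 2 + d' = m] v ->
  supported [set a | a *+ 2 + d'' = l + m] (u * v).
Proof.
move=> <- Hu Hv; apply: supportedM Hu Hv => a b /= <- <-.
by rewrite mulrnDl addrACA.
Qed.

Lemma supported_quatMM l m e d d' d'' (w u v : R) : d + d' = e *+ 2 + d'' ->
    supported [set e] w -> supported [set a | a *+ 2 + d = l] u ->
    supported [set a | a *+ 2 + d' = m] v ->
  supported [set a | a *+ 2 + d'' = l + m] (w * (u * v)).
Proof.
move=> ed Hw Hu Hv; apply: supportedM Hw (supported_quatM ed Hu Hv).
by move=> a b /= -> <-; rewrite mulrnDl [RHS]addrA [in RHS](addrC (b *+ 2)).
Qed.

Fact quat_gr_mul l m x y : quat_gr l x -> quat_gr m y ->
  quat_gr (l + m) (quat_mul (t e1) (t e2) x y).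
Proof.
move: x y => [[[x0 x1] x2] x3] [[[y0 y1] y2] y3] [X0 X1 X2 X3] [Y0 Y1 Y2 Y3].
have te e : supported [set e] (t e) by apply: supportedU.
have tt2 : supported [set e1 + e2] (t e1 * t e2).
  by apply: supportedM (te e1) (te e2) => ? ? -> ->.
have add0 n (x : R) : supported [set a | a *+ 2 = n] x <->
    supported [set a | a *+ 2 + 0 = n] x.
  by split=> H a /H /=; rewrite addr0.
move/add0: X0 => X0; move/add0: Y0 => Y0.
have S12 : e1 + (e1 + e2) = e1 *+ 2 + e2 by rewrite addrA.
have S21 : e2 + (e1 + e2) = e2 *+ 2 + e1 by rewrite addrC -addrA addrC.
have T12 : e1 + e2 + e1 = e1 *+ 2 + e2 by rewrite addrC S12.
have T21 : e1 + e2 + e2 = e2 *+ 2 + e1 by rewrite addrC S21.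
split; [apply/add0|rewrite mulrBr..|].
- apply: supportedD; last apply: supportedN.
    apply: supportedD; last by apply: supported_quatMM (te e2) X2 Y2; rewrite addr0.
    apply: supportedD; first by apply: supported_quatM X0 Y0; rewrite addr0.
    by apply: supported_quatMM (te e1) X1 Y1; rewrite addr0.
  by apply: supported_quatMM tt2 X3 Y3; rewrite addr0.
- apply: supportedD; last apply: supportedD; last apply: supportedN.
  + apply: supportedD; first by apply: supported_quatM X0 Y1; rewrite add0r.
    by apply: supported_quatM X1 Y0; rewrite addr0.
  + exact: supported_quatMM S21 (te e2) X2 Y3.
  + exact: supported_quatMM T21 (te e2) X3 Y2.
- apply: supportedD; last apply: supportedD; last apply: supportedN.
  + apply: supportedD; first by apply: supported_quatM X0 Y2; rewrite add0r.
    by apply: supported_quatM X2 Y0; rewrite addr0.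
  + exact: supported_quatMM T12 (te e1) X3 Y1.
  + exact: supported_quatMM S12 (te e1) X1 Y3.
- apply: supportedD; last apply: supportedN.
    apply: supportedD; last by apply: supported_quatM X2 Y1; rewrite addrC.
    apply: supportedD; first by apply: supported_quatM X0 Y3; rewrite add0r.
    by apply: supported_quatM X3 Y0; rewrite addr0.
  exact: supported_quatM X1 Y2.
Qed.

Fact quat_gr_star l x : quat_gr l x -> quat_gr l (quat_star x).
Proof.
by move: x => [[[x0 x1] x2] x3] [? ? ? ?]; split=> //; apply: supportedN.
Qed.

Definition quat_graded : gradedInvAlg F G :=
  @GradedInvAlg F _ Q (quat_mul (t e1) (t e2)) (quat_one R)
    (@quat_star F R) quat_gr
    (quat_mul_linearl _ _) (quat_mul_linearr _ _)
    (quat_mul1x _ _) (quat_mulx1 _ _) (@quat_star_linear _ _) (@quat_starK _ _)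
    (quat_starM _ _) quat_gr0 quat_grP quat_gr_span quat_gr_indep
    quat_gr_mul quat_gr_star.
End QuaternionGraded.

Definition C2alg (F : fieldType) : gradedInvAlg F 'rV[int]_2 :=
  quat_graded F (delta_mx 0 0) (delta_mx 0 1).

Section Extension.
Variables (F : fieldType) (L : zmodType) (M : zmodClosed L).
Variable B : gradedInvAlg F (subgrp M).

(* B regarded as graded by the group L containing M. *)
Definition extend_gr (l : L) : set B :=
  oapp (@ga_gr F _ B) [set 0] (insub l : option (subgrp M)).

Lemma extend_gr_val (s : subgrp M) : extend_gr (val s) = B`_[s].
Proof. by rewrite /extend_gr valK. Qed.

Lemma extend_gr_out l : l \notin M -> extend_gr l = [set 0].
Proof. by move=> lM; rewrite /extend_gr insubN. Qed.

Variant extend_spec (l : L) : set B -> Type :=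
| ExtendIn (s : subgrp M) of l = val s : extend_spec l B`_[s]
| ExtendOut of l \notin M : extend_spec l [set 0].

Lemma extendP l : extend_spec l (extend_gr l).
Proof.
case: (boolP (l \in M)) => lM; last by rewrite extend_gr_out //; constructor.
by rewrite /extend_gr insubT; apply: ExtendIn; rewrite SubK.
Qed.

Fact extend_gr0 l : extend_gr l 0.
Proof. by case: extendP => [s _|_] //; apply: ga_gr0. Qed.
Fact extend_grP l c x y :
  extend_gr l x -> extend_gr l y -> extend_gr l (c *: x + y).
Proof.
case: extendP => [s _|_]; first exact: ga_grP.
by move=> /= -> ->; rewrite scaler0 addr0.
Qed.
Fact extend_gr_span x : hspan extend_gr x.
Proof.
have [s Hs ->] := ga_gr_span x; exists s => // y /Hs [l Hl].
by exists (val l); rewrite extend_gr_val.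
Qed.
Fact extend_gr_indep (s : seq L) (f : L -> B) :
    uniq s -> (forall l, extend_gr l (f l)) ->
  \sum_(l <- s) f l = 0 -> forall l, l \in s -> f l = 0.
Proof.
move=> us Hf sum0 l ls; have := Hf l; case: extendP => [u lE _|_ //].
rewrite lE in ls *.
apply: (@ga_gr_indep F _ B (pmap insub s) (f \o val)).
- exact: pmap_sub_uniq.
- by move=> v /=; rewrite -extend_gr_val.
- rewrite -[RHS]sum0; elim: (s) => [|a s' IH]; first by rewrite !big_nil.
  rewrite big_cons /=; case: insubP => [v _ va|aM] /=.
    by rewrite big_cons IH /= va.
  by rewrite IH; have := Hf a; rewrite extend_gr_out // => /= ->; rewrite add0r.
- by rewrite mem_pmap_sub.
Qed.
Fact extend_gr_mul l m x y :
  extend_gr l x -> extend_gr m y -> extend_gr (l + m) (x ** y).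
Proof.
case: (extendP l) => [s ->|_]; last by move=> -> _; rewrite gmul0x; apply: extend_gr0.
case: (extendP m) => [u ->|_]; last by move=> _ ->; rewrite gmulx0; apply: extend_gr0.
by rewrite -raddfD extend_gr_val; apply: ga_gr_mul.
Qed.
Fact extend_gr_star l x : extend_gr l x -> extend_gr l (star x).
Proof.
by case: extendP => [s _|_]; [exact: ga_gr_star|move=> /= ->; rewrite gstar0].
Qed.

Definition extend : gradedInvAlg F L :=
  @GradedInvAlg F L B (@ga_mul _ _ B) (one B) star extend_gr
    (@ga_mul_linearl _ _ B) (@ga_mul_linearr _ _ B) (@ga_mul1x _ _ B)
    (@ga_mulx1 _ _ B) (@ga_star_linear _ _ B) (@ga_starK _ _ B)
    (@ga_starM _ _ B) extend_gr0 extend_grP extend_gr_span extend_gr_indep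
    extend_gr_mul extend_gr_star.
End Extension.

Record assocTorus (F : fieldType) (L : zmodType) := AssocTorus {
  at_alg :> gradedInvAlg F L;
  at_torus : structurable_torus at_alg;
  at_assoc : associative (@ga_mul _ _ at_alg)
}.

Record diagForm (F : fieldType) (L : zmodType) (M : zmodClosed L)
    (B : assocTorus F (subgrp M)) := DiagForm {
  df_m : nat;
  df_rho : 'I_df_m -> L;
  df_b : 'I_df_m -> B;
  df_m_gt0 : (0 < df_m)%N;
  df_rho_notin : forall i, df_rho i \notin M;
  df_generated : generated ([set x | x \in M] `|` range df_rho) = setT;
  df_rho_diff : forall i j, i != j -> df_rho i - df_rho j \notin M;
  df_2rho : forall i, supp_plus (extend B) (df_rho i *+ 2);
  df_b_gr : forall i, (extend B)`_[df_rho i *+ 2] (df_b i);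
  df_b_neq0 : forall i, df_b i <> 0
}.

Arguments df_rho {F L M B} d i.
Arguments df_b {F L M B} d i.

Section DiagonalForm.
Variables (F : fieldType) (L : zmodType) (M : zmodClosed L).
Variables (B : assocTorus F (subgrp M)) (k : diagForm B).
Local Notation I := 'I_(df_m k).
Local Notation rho := (df_rho k).
Local Notation b := (df_b k).
Local Notation X := {ffun I -> B}.

Lemma df_star_b i : star (b i) = b i.
Proof.
have := df_b_gr i; have [x [/= grx sx /eqP x0]] := df_2rho i.
rewrite /=; move: grx; case: extendP => [s _ grx grb|_ /= xE]; last by rewrite xE eqxx in x0.
have [_ fine _ _] := at_torus B.
have [|y [_ _] Hy] := fine s; first by exists x; [|apply/eqP].
have [c xE] := Hy _ grx; have [d bE] := Hy _ grb.
have starZ e z : star (e *: z) = e *: star z :> B.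
  by have := ga_star_linear e z (0 : B); rewrite gstar0 !addr0.
have c0 : c != 0 by apply: contraNneq x0 => c0; rewrite xE c0 scale0r.
have sy : star y = y.
  by move: sx; rewrite xE starZ => /(scalerI c0).
by rewrite bE starZ sy.
Qed.

(* The free left B-module with basis v_1, ..., v_m is B^m, and u : X stands for
   $\sum_i u_i v_i$. *)
Definition herm (u v : X) : B := \sum_i (u i ** b i) ** star (v i).

Definition X_scale (a : B) (u : X) : X := [ffun i => a ** u i].
Definition X_basis (i : I) : X := [ffun j => if j == i then one B else 0].

Lemma herm_basis i j : herm (X_basis i) (X_basis j) = if i == j then b i else 0.
Proof.
rewrite /herm (bigD1 i) //= big1 ?addr0 => [|l li]; last first.
  by rewrite !ffunE (negbTE li) !gmul0x.
rewrite !ffunE eqxx ga_mul1x; case: eqVneq => _.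
  by rewrite gstar1 ga_mulx1.
by rewrite gstar0 gmulx0.
Qed.

Lemma hermDl u u' v : herm (u + u') v = herm u v + herm u' v.
Proof.
by rewrite -big_split; apply: eq_bigr => i _; rewrite !ffunE !gmulDl.
Qed.

Lemma hermZl a u v : herm (X_scale a u) v = a ** herm u v.
Proof.
rewrite /herm (big_morph (@ga_mul _ _ B a) (id1 := 0) (op1 := +%R)).
- by apply: eq_bigr => i _; rewrite ffunE !(at_assoc (a := B)).
- by move=> x y; rewrite gmulDr.
- exact: gmulx0.
Qed.

Lemma hermC u v : herm v u = star (herm u v).
Proof.
rewrite gstar_sum; apply: eq_bigr => i _.
by rewrite !ga_starM ga_starK df_star_b (at_assoc (a := B)).
Qed.

Lemma hermDr u v v' : herm u (v + v') = herm u v + herm u v'.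
Proof. by rewrite hermC hermDl gstarD -!hermC. Qed.

Lemma hermZr a u v : herm u (X_scale a v) = herm u v ** star a.
Proof. by rewrite hermC hermZl ga_starM -hermC. Qed.

Definition Ak_car : Type := (B * X)%type.
HB.instance Definition _ := GRing.Lmodule.copy Ak_car (B * X)%type.

Definition Ak_mul (x y : Ak_car) : Ak_car :=
  (y.1 ** x.1 + herm x.2 y.2, X_scale x.1 y.2 + X_scale (star y.1) x.2).
Definition Ak_one : Ak_car := (one B, 0).
Definition Ak_star (x : Ak_car) : Ak_car := (star x.1, x.2).
(* $b v_i$ with $b \in B^\sigma$ has degree $\sigma + \rho_i$. *)
Definition Ak_gr (l : L) : set Ak_car := [set x : Ak_car |
  (extend B)`_[l] x.1 /\ forall i, (extend B)`_[l - rho i] (x.2 i)].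

Lemma hermPl c u u' v : herm (c *: u + u') v = c *: herm u v + herm u' v.
Proof.
rewrite hermDl; congr (_ + _); rewrite /herm scaler_sumr.
apply: eq_bigr => i _; rewrite !ffunE.
have mulZ e (x y : B) : (e *: x) ** y = e *: (x ** y).
  by have := ga_mul_linearl y e x (0 : B); rewrite gmul0x !addr0.
by rewrite !mulZ.
Qed.

Lemma hermPr c u v v' : herm u (c *: v + v') = c *: herm u v + herm u v'.
Proof.
by rewrite hermC hermPl ga_star_linear -!hermC.
Qed.

Lemma X_scalePr a c u v : X_scale a (c *: u + v) = c *: X_scale a u + X_scale a v.
Proof. by apply/ffunP => i; rewrite !ffunE ga_mul_linearr. Qed.

Lemma X_scalePl a a' c u : X_scale (c *: a + a') u = c *: X_scale a u + X_scale a' u.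
Proof. by apply/ffunP => i; rewrite !ffunE ga_mul_linearl. Qed.

Lemma addrPACA (V : lmodType F) c (p q r s : V) :
  c *: p + q + (c *: r + s) = c *: (p + r) + (q + s).
Proof. by rewrite addrACA -scalerDr. Qed.

Fact Ak_mul_linearl y : linear (Ak_mul^~ y).
Proof.
move=> c x z; rewrite /Ak_mul /=.
by rewrite ga_mul_linearr hermPl X_scalePl X_scalePr !addrPACA.
Qed.
Fact Ak_mul_linearr y : linear (Ak_mul y).
Proof.
move=> c x z; rewrite /Ak_mul /=.
by rewrite ga_mul_linearl hermPr ga_star_linear X_scalePl X_scalePr !addrPACA.
Qed.

Lemma X_scale0 a : X_scale a 0 = 0.
Proof. by apply/ffunP => i; rewrite !ffunE gmulx0. Qed.
Lemma X_scale1 u : X_scale (one B) u = u.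
Proof. by apply/ffunP => i; rewrite !ffunE ga_mul1x. Qed.
Lemma herm0l v : herm 0 v = 0.
Proof. by rewrite /herm big1 // => i _; rewrite ffunE !gmul0x. Qed.
Lemma herm0r v : herm v 0 = 0.
Proof. by rewrite hermC herm0l gstar0. Qed.

Fact Ak_mul1x : left_id Ak_one Ak_mul.
Proof.
move=> [a u]; rewrite /Ak_mul /= ga_mulx1 herm0l X_scale0 X_scale1.
by rewrite !addr0.
Qed.
Fact Ak_mulx1 : right_id Ak_one Ak_mul.
Proof.
move=> [a u]; rewrite /Ak_mul /= ga_mul1x herm0r X_scale0 gstar1 X_scale1.
by rewrite addr0 add0r.
Qed.
Fact Ak_star_linear : linear Ak_star.
Proof. by move=> c x y; rewrite /Ak_star /= ga_star_linear. Qed.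
Fact Ak_starK : involutive Ak_star.
Proof. by move=> [a u]; rewrite /Ak_star /= ga_starK. Qed.
Fact Ak_starM x y : Ak_star (Ak_mul x y) = Ak_mul (Ak_star y) (Ak_star x).
Proof.
rewrite /Ak_star /Ak_mul /= gstarD ga_starM -hermC ga_starK.
by congr (_, _); rewrite addrC.
Qed.

Fact Ak_gr0 l : Ak_gr l 0.
Proof. by split=> [|i]; rewrite ?ffunE; apply: extend_gr0. Qed.
Fact Ak_grP l c x y : Ak_gr l x -> Ak_gr l y -> Ak_gr l (c *: x + y).
Proof.
move=> [x1 x2] [y1 y2]; split=> [|i]; first exact: (@ga_grP _ _ (extend B)).
by rewrite !ffunE; apply: (@ga_grP _ _ (extend B)).
Qed.
Fact Ak_gr_span x : hspan Ak_gr x.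
Proof.
move: x => [a u]; pose X_at i (x : B) : X := [ffun j => if j == i then x else 0].
have uE : u = \sum_i X_at i (u i).
  apply/ffunP => j; rewrite sum_ffunE (bigD1 j) //= big1 ?addr0 ?ffunE ?eqxx //.
  by move=> i ij; rewrite ffunE eq_sym (negbTE ij).
have -> : (a, u) = ((a, 0) : Ak_car) + ((0, u) : Ak_car).
  by congr (_, _); rewrite /= ?addr0 ?add0r.
apply: hspanD.
  have [s Hs ->] := @ga_gr_span _ _ (extend B) a.
  have pairD : {morph (fun v : B => (v, 0) : Ak_car) : v w / v + w}.
    by move=> v w; congr (_, _); rewrite /= addr0.
  rewrite (big_morph _ pairD (erefl _)) big_seq.
  apply: (big_ind (hspan Ak_gr)) => [||y /Hs [l Hl]].
  - exact: hspan0.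
  - exact: hspanD.
  apply: (@hspan1 _ _ _ _ l); split=> // i; rewrite ffunE; exact: extend_gr0.
have pairX : {morph (fun v : X => (0, v) : Ak_car) : v w / v + w}.
  by move=> v w; congr (_, _); rewrite /= addr0.
rewrite uE (big_morph _ pairX (erefl _)).
apply: hspan_sum => i; have [s Hs ->] := @ga_gr_span _ _ (extend B) (u i).
have pairD : {morph (fun v : B => (0, X_at i v) : Ak_car) : v w / v + w}.
  move=> v w; congr (_, _); first by rewrite /= addr0.
  by apply/ffunP => j; rewrite !ffunE; case: eqP => _; rewrite ?addr0.
have pair0 : ((0, X_at i 0) : Ak_car) = 0.
  by congr (_, _); apply/ffunP => j; rewrite !ffunE if_same.
rewrite (big_morph _ pairD pair0) big_seq.
apply: (big_ind (hspan Ak_gr)) => [||y /Hs [l Hl]].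
- exact: hspan0.
- exact: hspanD.
apply: (@hspan1 _ _ _ _ (l + rho i)); split=> [|j]; first exact: extend_gr0.
rewrite ffunE; case: eqP => [->|_]; last exact: extend_gr0.
by rewrite addrK.
Qed.
Fact Ak_gr_indep (s : seq L) (f : L -> Ak_car) :
    uniq s -> (forall l, Ak_gr l (f l)) ->
  \sum_(l <- s) f l = 0 -> forall l, l \in s -> f l = 0.
Proof.
move=> us Hf sum0 l ls.
have f1 : (f l).1 = 0.
  apply: (@ga_gr_indep _ _ (extend B) s (fun l => (f l).1)) => //.
    by move=> m; case: (Hf m).
  transitivity ((\sum_(m <- s) f m).1); last by rewrite sum0.
  by rewrite (big_morph (fun x : Ak_car => x.1) (id1 := 0) (op1 := +%R)).
have f2 i : (f l).2 i = 0.
  pose g m := (f (m + rho i)).2 i.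
  suff : g (l - rho i) = 0 by rewrite /g subrK.
  apply: (@ga_gr_indep _ _ (extend B) [seq m - rho i | m <- s] g).
  - by rewrite map_inj_uniq // => ? ? /addIr.
  - by move=> m; have [_ /(_ i)] := Hf (m + rho i); rewrite addrK.
  - rewrite big_map; under eq_bigr do rewrite /g subrK.
    transitivity ((\sum_(m <- s) f m).2 i); last by rewrite sum0 ffunE.
    rewrite (big_morph (fun x : Ak_car => x.2 i) (id1 := 0) (op1 := +%R)) //.
      by move=> x y; rewrite /= ffunE.
    by rewrite /= ffunE.
  - exact: map_f.
by case: (f l) f1 f2 => [a u] /= -> u0; congr (_, _); apply/ffunP => i; rewrite u0 ffunE.
Qed.
Fact Ak_gr_mul l m x y :
  Ak_gr l x -> Ak_gr m y -> Ak_gr (l + m) (Ak_mul x y).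
Proof.
move=> [x1 x2] [y1 y2]; split=> [|i].
  apply: (@ggrD _ _ (extend B)); first by rewrite addrC; apply: (@ga_gr_mul _ _ (extend B)).
  apply: (@ggr_sum _ _ (extend B)) => i.
  have -> : l + m = l - rho i + rho i *+ 2 + (m - rho i).
    by rewrite mulr2n [l - _ + (_ + _)]addrA subrK addrACA subrr addr0.
  apply: (@ga_gr_mul _ _ (extend B)); last exact: (@ga_gr_star _ _ (extend B)).
  by apply: (@ga_gr_mul _ _ (extend B)) => //; apply: df_b_gr.
rewrite !ffunE; apply: (@ggrD _ _ (extend B)).
  by rewrite -addrA; apply: (@ga_gr_mul _ _ (extend B)).
have -> : l + m - rho i = m + (l - rho i) by rewrite (addrC l) addrA.
by apply: (@ga_gr_mul _ _ (extend B)) => //; apply: (@ga_gr_star _ _ (extend B)).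
Qed.
Fact Ak_gr_star l x : Ak_gr l x -> Ak_gr l (Ak_star x).
Proof. by move=> [x1 x2]; split=> //; apply: (@ga_gr_star _ _ (extend B)). Qed.

Definition Ak : gradedInvAlg F L :=
  @GradedInvAlg F L Ak_car Ak_mul Ak_one Ak_star Ak_gr
    Ak_mul_linearl Ak_mul_linearr Ak_mul1x Ak_mulx1
    Ak_star_linear Ak_starK Ak_starM
    Ak_gr0 Ak_grP Ak_gr_span Ak_gr_indep Ak_gr_mul Ak_gr_star.
End DiagonalForm.

Definition isograded_to_C2_P (F : fieldType) (L : zmodType)
    (B : gradedInvAlg F L) := exists (r : nat)
    (T : gradedInvAlg F ('rV[int]_2 * 'rV[int]_r)%type),
  is_tensor_product (C2alg F) (Palg F r) T /\ isograded_isomorphic B T.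

(* Main.v *)
(* Converse.  Let W be the complement of E = A^(Lambda_-).  For skew s, t the
   structurable identity gives [s, x, y] = - [x, s, y], hence s(tw) = (ts)w,
   u(sv) = - s(uv) and (su)v = (uv)s on W.  As WW is not contained in E, this
   forces [s, t] = 0, S_- + S_- + S_- = S_-, and E is commutative and associative
   and acts associatively on W, while h(a, b<>c) is symmetric in a, b, c.  If the
   geometry is a star with centre sigma, then M = Lambda_- + Z sigma contains
   2 Lambda, and XX is contained in A^M for X = A^(S - M).  For 0 <> g of degree
   sigma, (gx)(gy) = (g(xy))g on X, which makes X a left module over the opposite B
   of A^M, on which (x, y) |-> xy is a hermitian form; homogeneous representatives of
   the cosets of M in the support form an orthogonal basis.  The involution of B is
   determined by two parities (degree modulo Lambda_- and skewness): in a basis of M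
   adapted to them, the homogeneous elements of even degree are central and two
   generators anticommute, so that B is C_*(2) (x) P(r).

   Direct part.  The involution of B negates exactly the degrees with both Z^2
   coordinates odd, so Lambda_- consists of the degrees in M whose coordinates have
   equal parity, and the nontrivial coset of Lambda_- in M is the centre of a star,
   because X is orthogonal to B and XX is contained in B. *)

Require Import Defs.
From HB Require Import structures.
From mathcomp Require Import all_boot all_order all_algebra.
From mathcomp Require Import finmap.
From mathcomp Require Import boolp classical_sets ring zify.
From mathcomp Require monalg.
Import Defs.

Set Implicit Arguments.
Unset Strict Implicit.
Unset Printing Implicit Defensive.

Import GRing.Theory.
Local Open Scope ring_scope.
Local Open Scope classical_set_scope.

(** * Graded algebras with involution *)

(** Homogeneous components are lines of invertible elements, so a doubtful sign or a product that
    might vanish is settled by cancelling factors. The definition of invertibility supplies little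
    for this, namely commuting multiplications by x and its inverse; skew-alternativity improves it
    to s(tx) = x for skew s with inverse t. Hence everything in degrees [Lambda_minus] is deduced
    from skew elements, and E is handled as the span of skew elements and of products of two of
    them. Associativity of E and of A^M is not reached by identities between their own elements: E
    acts faithfully on W, A^M acts faithfully on X, and the products are read off from these
    actions. The two halves of the definition of a star do different work. That every line passes
    through the centre limits the degrees of nonzero products, while collinearity of the centre with
    all points makes multiplication by g nonvanishing on homogeneous elements of X. Freeness of
    Lambda serves twice: it makes Lambda/M finite, so that the orthogonal basis is finite, and it
    gives M a basis. *)

Section SquareZero.
Variable V : zmodType.
Definition sqz : Type := (int * V)%type.
HB.instance Definition _ := GRing.Zmodule.copy sqz (int * V)%type.
Definition sqz_mul (x y : sqz) : sqz := (x.1 * y.1, x.2 *~ y.1 + y.2 *~ x.1).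
Fact sqz_mulA : associative sqz_mul.
Proof.
move=> [a u] [b v] [c w]; congr (_, _); rewrite /= ?mulrA //.
by rewrite !mulrzDl -!mulrzA addrA [c * a]mulrC [b * a]mulrC.
Qed.
Fact sqz_mulC : commutative sqz_mul.
Proof. by move=> [a u] [b v]; congr (_, _); rewrite /= (mulrC, addrC). Qed.
Fact sqz_mul1 : left_id ((1, 0) : sqz) sqz_mul.
Proof. by move=> [a u]; congr (_, _); rewrite /= ?mul1r // mul0rz add0r. Qed.
Fact sqz_mulD : left_distributive sqz_mul +%R.
Proof.
move=> [a u] [b v] [c w]; congr (_, _); rewrite /= ?mulrDl //.
by rewrite mulrzDl mulrzDr addrACA.
Qed.
Fact sqz_1neq0 : ((1, 0) : sqz) != 0.
Proof. by []. Qed.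
HB.instance Definition _ := GRing.Zmodule_isComNzRing.Build sqz
  sqz_mulA sqz_mulC sqz_mul1 sqz_mulD sqz_1neq0.
Definition sqz_inc (v : V) : sqz := (0, v).
Fact sqz_inc_additive : zmod_morphism sqz_inc.
Proof. by move=> u v; congr (_, _). Qed.
HB.instance Definition _ :=
  GRing.isZmodMorphism.Build V sqz sqz_inc sqz_inc_additive.
Lemma sqz_inc_inj : injective sqz_inc.
Proof. by move=> u v []. Qed.
End SquareZero.

(* Decides identities of abelian groups: V embeds in the commutative ring
   Z + V with V^2 = 0, where [ring] applies. *)
Ltac zmod := apply: sqz_inc_inj; ring.

Section CharNeq.
Variables (F : fieldType) (V : lmodType F).
Hypothesis charF_neq2 : 2%N \notin [pchar F].

Lemma two_neq0 : 2%:R != 0 :> F.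
Proof. by apply: contra charF_neq2 => /eqP z; rewrite inE /= z eqxx. Qed.

Lemma mulr2n_inj : injective (fun v : V => v *+ 2).
Proof.
by move=> u v; rewrite -!(scaler_nat 2); apply: scalerI; apply: two_neq0.
Qed.

Lemma mulr2n_eq0 (v : V) : v *+ 2 = 0 -> v = 0.
Proof. by move=> h; apply: mulr2n_inj; rewrite h mul0rn. Qed.

Lemma opp_fix0 (v : V) : v = - v -> v = 0.
Proof. by move=> h; apply: mulr2n_eq0; rewrite mulr2n {2}h subrr. Qed.
End CharNeq.

Lemma sum_widen (I : eqType) (V : nmodType) (r t : seq I) (h : I -> V) :
    uniq r -> uniq t -> {subset r <= t} -> (forall i, i \notin r -> h i = 0) ->
  \sum_(i <- r) h i = \sum_(i <- t) h i.
Proof.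
move=> ur ut sub h0; rewrite [RHS](bigID (mem r)) /= [X in _ + X]big1 ?addr0 //.
rewrite -[RHS]big_filter; apply: perm_big; apply: uniq_perm => //.
  by rewrite filter_uniq.
by move=> i; rewrite mem_filter; case: (boolP (i \in r)) => //= /sub ->.
Qed.

Section GradedBasics.
Variables (F : fieldType) (L : zmodType) (A : gradedInvAlg F L).
Implicit Types (x y z w : A) (l m : L) (X : set L).

Definition gmulr y x := x ** y.
HB.instance Definition _ (y : A) := GRing.isLinear.Build F A A *:%R
  (gmulr y) (ga_mul_linearl y).
HB.instance Definition _ (x : A) := GRing.isLinear.Build F A A *:%R
  (ga_mul x) (ga_mul_linearr x).
HB.instance Definition _ := GRing.isLinear.Build F A A *:%R
  (@ga_star _ _ A) (@ga_star_linear _ _ A).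

Lemma gmulNl x y : (- x) ** y = - (x ** y).
Proof. exact: (raddfN (gmulr y)). Qed.
Lemma gmulNr x y : x ** (- y) = - (x ** y).
Proof. exact: raddfN. Qed.
Lemma gmulZl c x y : (c *: x) ** y = c *: (x ** y).
Proof. exact: (linearZ_LR (gmulr y)). Qed.
Lemma gmulZr c x y : x ** (c *: y) = c *: (x ** y).
Proof. exact: linearZ_LR. Qed.
Lemma gmulBl x y z : (x - y) ** z = x ** z - y ** z.
Proof. exact: (raddfB (gmulr z)). Qed.
Lemma gmulBr x y z : z ** (x - y) = z ** x - z ** y.
Proof. exact: raddfB. Qed.
Lemma gmul_suml (I : Type) (s : seq I) (P : pred I) (f : I -> A) y :
  (\sum_(i <- s | P i) f i) ** y = \sum_(i <- s | P i) f i ** y.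
Proof. exact: (raddf_sum (gmulr y)). Qed.
Lemma gmul_sumr (I : Type) (s : seq I) (P : pred I) (f : I -> A) y :
  y ** (\sum_(i <- s | P i) f i) = \sum_(i <- s | P i) y ** f i.
Proof. exact: raddf_sum. Qed.
Lemma gstarN x : star (- x) = - star x.
Proof. exact: raddfN. Qed.
Lemma gstarB x y : star (x - y) = star x - star y.
Proof. exact: raddfB. Qed.
Lemma gstarZ c x : star (c *: x) = c *: star x.
Proof. exact: linearZ_LR. Qed.
Lemma gstar_inj : injective (@ga_star _ _ A).
Proof. exact: can_inj (@ga_starK _ _ A). Qed.

Definition gmulE := (gmulDl, gmulDr, gmulBl, gmulBr, gmulNl, gmulNr).

Lemma ggrZ l c x : A`_[l] x -> A`_[l] (c *: x).
Proof. by move=> xl; rewrite -[_ *: _]addr0; apply: ga_grP => //; apply: ga_gr0. Qed.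
Lemma ggrN l x : A`_[l] x -> A`_[l] (- x).
Proof. by rewrite -scaleN1r; apply: ggrZ. Qed.
Lemma ggrB l x y : A`_[l] x -> A`_[l] y -> A`_[l] (x - y).
Proof. by move=> xl yl; apply: ggrD => //; apply: ggrN. Qed.
Lemma ggr_big l (I : eqType) (s : seq I) (P : pred I) (f : I -> A) :
  (forall i, i \in s -> P i -> A`_[l] (f i)) -> A`_[l] (\sum_(i <- s | P i) f i).
Proof.
move=> H; rewrite big_seq_cond; apply: (big_ind A`_[l]).
- exact: ga_gr0.
- exact: ggrD.
by move=> i /andP[]; apply: H.
Qed.

Lemma gr_decomp x : exists f : L -> A, exists s : seq L,
  [/\ forall l, A`_[l] (f l), uniq s, forall l, l \notin s -> f l = 0 &
      x = \sum_(l <- s) f l].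
Proof.
have [t Ht ->] := ga_gr_span x; elim: t Ht => [|y t IH] Ht.
  by exists (fun=> 0), [::]; split=> //; [move=> l; apply: ga_gr0|rewrite !big_nil].
have [f [s [fg us fs E]]] := IH (fun z zt => Ht z (mem_behead (s := y :: t) zt)).
have [l ly] := Ht y (mem_head _ _).
pose g m := if m == l then f l + y else f m.
exists g, (if l \in s then s else l :: s); split=> [m||m|].
- by rewrite /g; case: eqP => [->|_]; [apply: ggrD|].
- by case: ifP => //= ->.
- rewrite /g; case: eqP => [->|/eqP ml]; first by case: ifP => [->|]//; rewrite mem_head.
  by case: ifP => _ h; apply: fs => //; move: h; rewrite inE (negbTE ml).
rewrite big_cons E; case: ifP => ls.
  rewrite !(bigD1_seq l) //= {1}/g eqxx [f l + y]addrC -addrA; congr (_ + (_ + _)).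
  by apply: eq_bigr => m /negbTE ml; rewrite /g ml.
rewrite big_cons {1}/g eqxx fs ?ls // add0r; congr (_ + _).
apply: eq_big_seq => m ms; rewrite /g; case: eqP => // ml.
by rewrite -ml ms in ls.
Qed.

Lemma gr_decomp_uniq (f g : L -> A) (s t : seq L) :
    (forall l, A`_[l] (f l)) -> (forall l, A`_[l] (g l)) ->
    uniq s -> uniq t -> (forall l, l \notin s -> f l = 0) ->
    (forall l, l \notin t -> g l = 0) ->
  \sum_(l <- s) f l = \sum_(l <- t) g l -> forall l, f l = g l.
Proof.
move=> fg gg us ut f0 g0 E.
have sums : \sum_(l <- undup (s ++ t)) (f l - g l) = 0.
  have [ss tt] : {subset s <= undup (s ++ t)} /\ {subset t <= undup (s ++ t)}.
    by split=> i; rewrite mem_undup mem_cat => ->; rewrite ?orbT.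
  have uu := undup_uniq (s ++ t).
  by rewrite sumrB -(sum_widen us uu ss f0) -(sum_widen ut uu tt g0) E subrr.
move=> l; case: (boolP (l \in undup (s ++ t))) => [lst|].
  apply/eqP; rewrite -subr_eq0; apply/eqP.
  exact: (ga_gr_indep (undup_uniq (s ++ t)) (fun l => ggrB (fg l) (gg l)) sums).
by rewrite mem_undup mem_cat negb_or => /andP[/f0 -> /g0 ->].
Qed.

(** The record asserts only that homogeneous elements span and are independent. Components are
    therefore selected by choice, and [gr_decomp_uniq] is what makes them linear in [x]. *)
Definition gr_comp x : L -> A := sval (cid (gr_decomp x)).
Definition gr_supp x : seq L := sval (cid (svalP (cid (gr_decomp x)))).

Lemma gr_compP x : [/\ forall l, A`_[l] (gr_comp x l), uniq (gr_supp x),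
  forall l, l \notin gr_supp x -> gr_comp x l = 0 &
  x = \sum_(l <- gr_supp x) gr_comp x l].
Proof. exact: (svalP (cid (svalP (cid (gr_decomp x))))). Qed.

Definition proj l x : A := gr_comp x l.

Lemma proj_gr l x : A`_[l] (proj l x).
Proof. by case: (gr_compP x). Qed.

Lemma gr_suppE x : x = \sum_(l <- gr_supp x) proj l x.
Proof. by case: (gr_compP x). Qed.

Lemma proj_uniq (f : L -> A) (s : seq L) x :
    (forall l, A`_[l] (f l)) -> uniq s -> (forall l, l \notin s -> f l = 0) ->
  x = \sum_(l <- s) f l -> forall l, proj l x = f l.
Proof.
have [g us g0 E] := gr_compP x => fg ut f0 E' l.
by apply: gr_decomp_uniq us ut g0 f0 _ l => //; rewrite -E.
Qed.

Lemma proj_id l x : A`_[l] x -> proj l x = x.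
Proof.
move=> xl; rewrite (@proj_uniq (fun m => if m == l then x else 0) [:: l]) ?eqxx //.
- by move=> m; case: eqP => [->//|_]; apply: ga_gr0.
- by move=> m; rewrite inE => /negbTE ->.
- by rewrite big_seq1 eqxx.
Qed.

Lemma proj_neq l m x : A`_[l] x -> m != l -> proj m x = 0.
Proof.
move=> xl /negbTE ml.
rewrite (@proj_uniq (fun m => if m == l then x else 0) [:: l]) ?ml //.
- by move=> n; case: eqP => [->//|_]; apply: ga_gr0.
- by move=> n; rewrite inE => /negbTE ->.
- by rewrite big_seq1 eqxx.
Qed.

Fact proj_linear l : linear (proj l).
Proof.
move=> c x y; have [fx ux x0 Ex] := gr_compP x; have [fy uy y0 Ey] := gr_compP y.
apply: (@proj_uniq (fun l => c *: proj l x + proj l y) (undup (gr_supp x ++ gr_supp y))).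
- by move=> m; apply: ga_grP; apply: proj_gr.
- exact: undup_uniq.
- move=> m; rewrite mem_undup mem_cat negb_or => /andP[/x0 h /y0 h'].
  by rewrite /proj h h' scaler0 addr0.
rewrite big_split /= -scaler_sumr; congr (_ *: _ + _).
  rewrite {1}Ex; apply: sum_widen => //; rewrite ?undup_uniq // => i.
  by rewrite mem_undup mem_cat => ->.
rewrite {1}Ey; apply: sum_widen => //; rewrite ?undup_uniq // => i.
by rewrite mem_undup mem_cat orbC => ->.
Qed.
HB.instance Definition _ l := GRing.isLinear.Build F A A *:%R (proj l) (proj_linear l).
Lemma proj0 l : proj l 0 = 0. Proof. exact: raddf0. Qed.
Lemma projD l x y : proj l (x + y) = proj l x + proj l y.
Proof. exact: raddfD. Qed.
Lemma projZ l c x : proj l (c *: x) = c *: proj l x.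
Proof. exact: linearZ_LR. Qed.

Lemma proj_eq0 x : (forall l, proj l x = 0) -> x = 0.
Proof. by move=> h; rewrite (gr_suppE x) big1. Qed.

Lemma gr_inj l m x : A`_[l] x -> A`_[m] x -> x <> 0 -> l = m.
Proof.
move=> xl xm x0; apply/eqP/negPn/negP => lm; apply: x0.
by rewrite -(proj_id xl) (proj_neq xm).
Qed.

Lemma gr_ind (P : A -> Prop) : P 0 -> (forall x y, P x -> P y -> P (x + y)) ->
  (forall l x, A`_[l] x -> P x) -> forall x, P x.
Proof.
by move=> P0 PD PH x; rewrite (gr_suppE x); apply: big_ind => // l _; apply: PH (proj_gr l x).
Qed.

Lemma projMl l m x y : A`_[l] x -> proj (l + m) (x ** y) = x ** proj m y.
Proof.
move=> xl; elim/gr_ind: y => [|y z IH IH'|n y yn].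
- by rewrite ?(gmulx0, proj0).
- by rewrite gmulDr !projD gmulDr IH IH'.
have [->|nm] := eqVneq m n; first by rewrite !proj_id //; apply: ga_gr_mul.
rewrite (proj_neq yn nm) gmulx0 (proj_neq (ga_gr_mul xl yn)) //.
by apply: contra nm => /eqP /addrI ->.
Qed.

Lemma projMr l m x y : A`_[l] x -> proj (m + l) (y ** x) = proj m y ** x.
Proof.
move=> xl; elim/gr_ind: y => [|y z IH IH'|n y yn].
- by rewrite ?(gmul0x, proj0).
- by rewrite gmulDl !projD gmulDl IH IH'.
have [->|nm] := eqVneq m n; first by rewrite !proj_id //; apply: ga_gr_mul.
rewrite (proj_neq yn nm) gmul0x (proj_neq (ga_gr_mul yn xl)) //.
by apply: contra nm => /eqP /addIr ->.
Qed.

Lemma gr_one : A`_[0] (one A).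
Proof.
suff -> : one A = proj 0 (one A) by apply: proj_gr.
(* The component of 1 in degree 0 is a right unit: compare y 1 = y in the degree of a homogeneous
   y. *)
have H x : x ** proj 0 (one A) = x.
  elim/gr_ind: x => [|y z IH IH'|n y yn]; first by rewrite gmul0x.
    by rewrite gmulDl IH IH'.
  by rewrite -(projMl _ _ yn) addr0 ga_mulx1 proj_id.
by rewrite -[RHS]ga_mul1x H.
Qed.

Lemma graded_part_proj X x : graded_part X x <-> forall l, ~ X l -> proj l x = 0.
Proof.
split=> [[s Hs -> l nX]|H].
  rewrite raddf_sum big_seq big1 // => y /Hs [m Xm ym].
  by apply: proj_neq ym _; apply/eqP => lm; apply: nX; rewrite lm.
have [f us f0 E] := gr_compP x.
exists [seq proj l x | l <- [seq l <- gr_supp x | `[< X l >]]].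
  move=> y /mapP[l]; rewrite mem_filter => /andP[/asboolP Xl _] ->.
  by exists l => //; apply: proj_gr.
rewrite big_map big_filter {1}E (bigID (fun l => `[< X l >])) /=.
by rewrite [X in _ + X]big1 ?addr0 // => l /asboolPn /H.
Qed.

Lemma graded_part0 X : graded_part X (0 : A).
Proof. by apply/graded_part_proj => l _; rewrite raddf0. Qed.

Lemma graded_partP X c x y : graded_part X x -> graded_part X y -> graded_part X (c *: x + y).
Proof.
move=> /graded_part_proj hx /graded_part_proj hy; apply/graded_part_proj => l Xl.
by rewrite linearP /= hx // hy // scaler0 addr0.
Qed.

Lemma graded_part_hom X l x : X l -> A`_[l] x -> graded_part X x.
Proof.
move=> Xl xl; apply/graded_part_proj => m nXm; apply: proj_neq xl _.
by apply/eqP => ml; apply: nXm; rewrite ml.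
Qed.

Lemma graded_part_ind X (P : A -> Prop) : P 0 ->
  (forall x y, P x -> P y -> P (x + y)) ->
  (forall l x, X l -> A`_[l] x -> P x) -> forall x, graded_part X x -> P x.
Proof.
move=> P0 PD PH x [s Hs ->]; rewrite big_seq; apply: big_ind => // y /Hs [l].
exact: PH.
Qed.

Lemma graded_part_mul X Y (Z : set L) x y : (forall l m, X l -> Y m -> Z (l + m)) ->
  graded_part X x -> graded_part Y y -> graded_part Z (x ** y).
Proof.
move=> XYZ hx; move: y; apply: graded_part_ind => [|y z Zy Zz|m y Ym ym].
- by rewrite gmulx0; apply: graded_part0.
- by rewrite gmulDr -[x ** y]scale1r; apply: graded_partP.
move: x hx; apply: graded_part_ind => [|x z Zx Zz|l x Xl xl].
- by rewrite gmul0x; apply: graded_part0.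
- by rewrite gmulDl -[x ** y]scale1r; apply: graded_partP.
exact: graded_part_hom (XYZ _ _ Xl Ym) (ga_gr_mul xl ym).
Qed.

Lemma graded_part_star X x : graded_part X x -> graded_part X (star x).
Proof.
move: x; apply: graded_part_ind => [|x y sx sy|l x Xl xl].
- by rewrite gstar0; apply: graded_part0.
- by rewrite gstarD -[star x]scale1r; apply: graded_partP.
by apply: (graded_part_hom Xl); apply: ga_gr_star.
Qed.

Lemma graded_partB X x y : graded_part X x -> graded_part X y -> graded_part X (x - y).
Proof. by move=> hx hy; rewrite addrC -scaleN1r; apply: graded_partP. Qed.

(** An inverse in the sense of [invertible] may be inhomogeneous. Its component in degree [- l]
    still is one, because each condition can be compared in a single degree. *)
Lemma invertible_gr l x : A`_[l] x -> invertible x -> exists y,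
  [/\ A`_[- l] y, x ** y = one A, y ** x = one A,
      forall z, x ** (y ** z) = y ** (x ** z) &
      forall z, (z ** y) ** x = (z ** x) ** y].
Proof.
move=> xl [y [xy yx Lxy Rxy]]; exists (proj (- l) y); split.
- exact: proj_gr.
- by rewrite -(projMl _ _ xl) subrr xy proj_id //; apply: gr_one.
- by rewrite -(projMr _ _ xl) addNr yx proj_id //; apply: gr_one.
- move=> z; elim/gr_ind: z => [|z w IH IH'|n z zn]; first by rewrite !gmulx0.
    by rewrite !gmulDr IH IH'.
  have xz := ga_gr_mul xl zn.
  rewrite -(projMr _ _ zn) -(projMl _ _ xl) Lxy -(projMr _ _ xz).
  by rewrite addNKr addKr.
move=> z; elim/gr_ind: z => [|z w IH IH'|n z zn]; first by rewrite !gmul0x.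
  by rewrite !gmulDl IH IH'.
have xz := ga_gr_mul zn xl.
rewrite -(projMl _ _ zn) -(projMr _ _ xl) Rxy -(projMl _ _ xz).
by rewrite subrK addrK.
Qed.
End GradedBasics.

(** Reduces an identity to a certificate: the goal is a sum of known equations, and [zmod] checks
    the arithmetic. *)
Lemma add_eqs (V : zmodType) (l r l1 r1 l2 r2 : V) :
  l1 = r1 -> l2 = r2 -> l - r = (l1 - r1) + (l2 - r2) -> l = r.
Proof.
by move=> -> -> /eqP; rewrite !subrr addr0 subr_eq0 => /eqP.
Qed.

Lemma add_eqs2 (V : zmodType) (l1 r1 l2 r2 : V) :
  l1 = r1 -> l2 = r2 -> l1 + l2 = r1 + r2.
Proof. by move=> -> ->. Qed.

(** * Consequences of the structurable identity *)

Section StructurableIdentities.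
Variables (F : fieldType) (L : zmodType) (A : gradedInvAlg F L).
Hypothesis charF_neq2 : 2%N \notin [pchar F].
Hypothesis strA : structurable A.
Implicit Types (s x y z a b c q : A).

Let expand := (@gmulDl F L A, @gmulDr F L A, @gmulBl F L A, @gmulBr F L A,
  @gmulNl F L A, @gmulNr F L A, @gstarD F L A, @gstarB F L A, @gstarN F L A,
  @ga_starM F L A, @ga_starK F L A, @gstar1 F L A, @ga_mul1x F L A,
  @ga_mulx1 F L A, @opprK A).

(** In terms of the associator this is [s, x, y] = - [x, s, y]. It comes from the structurable
    identity with 1 in two of the five places; which instances combine depends on whether x and y
    are hermitian or skew, whence four lemmas. *)
Lemma skew_alt_hh s x y : star s = - s -> star x = x -> star y = y ->
  (s ** x) ** y + (x ** s) ** y = s ** (x ** y) + x ** (s ** y).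
Proof.
move=> ss sx sy; have := strA x (one A) s y (one A); have := strA y (one A) (one A) x s.
rewrite /triple !expand !(ss, sx, sy, expand) => h1 h2.
by apply: (mulr2n_inj charF_neq2); apply: (add_eqs (esym h1) (esym h2)); zmod.
Qed.

Lemma skew_alt_hs s x y : star s = - s -> star x = x -> star y = - y ->
  (s ** x) ** y + (x ** s) ** y = s ** (x ** y) + x ** (s ** y).
Proof.
move=> ss sx sy; have := strA x (one A) s y (one A); have := strA x (one A) (one A) y s.
rewrite /triple !expand !(ss, sx, sy, expand) => h1 h2.
by apply: (mulr2n_inj charF_neq2); apply: (add_eqs h1 (esym h2)); zmod.
Qed.

Lemma skew_alt_sh s x y : star s = - s -> star x = - x -> star y = y ->
  (s ** x) ** y + (x ** s) ** y = s ** (x ** y) + x ** (s ** y).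
Proof.
move=> ss sx sy; have := strA x (one A) s y (one A); have := strA y (one A) (one A) x s.
rewrite /triple !expand !(ss, sx, sy, expand) => h1 h2.
by apply: (mulr2n_inj charF_neq2); apply: (add_eqs h1 (esym h2)); zmod.
Qed.

Lemma skew_alt_ss s x y : 3%N \notin [pchar F] ->
    star s = - s -> star x = - x -> star y = - y ->
  (s ** x) ** y + (x ** s) ** y = s ** (x ** y) + x ** (s ** y).
Proof.
move=> charF_neq3 ss sx sy.
have := strA y (one A) x (one A) s; have := strA (one A) s y (one A) x.
have := strA (one A) x y s (one A); have := strA s y (one A) x (one A).
rewrite /triple !expand !(ss, sx, sy, expand) => h1 h2 h3 h4.
have inj3 (u v : A) : u *+ 3 = v *+ 3 -> u = v.
  rewrite -!(scaler_nat 3); apply: scalerI.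
  by apply: contra charF_neq3 => /eqP z; rewrite inE /= z eqxx.
apply: inj3; apply: (mulr2n_inj charF_neq2); apply: (mulr2n_inj charF_neq2).
(* Twelve times the claim is 3 h1 - 6 h2 + 8 h3 + 2 h4; the factor 3 is where characteristic 3 is
   excluded. *)
pose c n (u : A) := u *+ n.
apply: (add_eqs (add_eqs2 (congr1 (c 3) h1) (congr1 (c 6) (esym h2)))
                (add_eqs2 (congr1 (c 8) h3) (congr1 (c 2) h4))).
by rewrite /c; zmod.
Qed.

(** For hermitian a both {a 1 z} and {1 a z} equal a z, so the structurable identity turns into a
    rule for moving left multiplication by a through a triple product. *)
Lemma herm_triple a b c q : star a = a ->
  a ** triple b c q - triple b c (a ** q) =
  triple (a ** b) c q - triple b (a ** c) q.
Proof.
move=> sa; have := strA a (one A) b c q.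
have E z : triple a (one A) z = a ** z.
  by rewrite /triple gstar1 sa !ga_mulx1 addrK.
have -> : triple (one A) a c = a ** c; last by rewrite !E.
by rewrite /triple gstar1 sa ga_mul1x !ga_mulx1 addrK.
Qed.
End StructurableIdentities.

(** * Subgroups generated by a set *)

Section Generated.
Variables (L : zmodType).
Implicit Types (X H : set L).

Lemma subgroupN H x : is_subgroup H -> H x -> H (- x).
Proof. by move=> [H0 HB] Hx; rewrite -sub0r; apply: HB. Qed.
Lemma subgroupD H x y : is_subgroup H -> H x -> H y -> H (x + y).
Proof. by move=> sH Hx Hy; rewrite -[y]opprK; apply: sH.2 => //; apply: subgroupN. Qed.
Lemma subgroupDr H x y : is_subgroup H -> H y -> H (x + y) -> H x.
Proof. by move=> sH Hy Hxy; rewrite -(addrK y x); apply: sH.2. Qed.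
Lemma subgroupDl H x y : is_subgroup H -> H x -> H (x + y) -> H y.
Proof. by rewrite addrC; apply: subgroupDr. Qed.
Lemma subgroupC H x y : is_subgroup H -> H (x - y) -> H (y - x).
Proof. by move=> sH h; rewrite -opprB; apply: subgroupN. Qed.

Lemma generated_subgroup X : is_subgroup (generated X).
Proof.
split=> [H [[]//]|x y gx gy H [HS XH]].
by apply: HS.2; [apply: gx|apply: gy].
Qed.
Lemma sub_generated X : X `<=` generated X.
Proof. by move=> x Xx H [_]; apply. Qed.
Lemma generated_min X H : is_subgroup H -> X `<=` H -> generated X `<=` H.
Proof. by move=> HS XH x; apply; split. Qed.
End Generated.

(** * Structurable tori of class III *)

Section Torus.
Variables (F : fieldType) (L : zmodType) (A : gradedInvAlg F L).
Hypothesis charF_neq2 : 2%N \notin [pchar F].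
Hypothesis charF_neq3 : 3%N \notin [pchar F].
Hypothesis torA : structurable_torus A.
Implicit Types (s t r x y z u v w : A) (l m k : L).

Let strA : structurable A. Proof. by case: torA. Qed.

Lemma gr_line l x y : A`_[l] x -> x <> 0 -> A`_[l] y -> exists c, y = c *: x.
Proof.
case: torA => _ fine _ _ xl x0 yl; have [|z [zl z0] H] := fine l; first by exists x.
have [c xE] := H _ xl; have [d yE] := H _ yl.
have c0 : c != 0 by apply/eqP => c0; apply: x0; rewrite xE c0 scale0r.
by exists (d / c); rewrite xE scalerA divfK.
Qed.

Lemma inv_gr l x : A`_[l] x -> x <> 0 -> exists y,
  [/\ A`_[- l] y, x ** y = one A, y ** x = one A,
      forall z, x ** (y ** z) = y ** (x ** z) &
      forall z, (z ** y) ** x = (z ** x) ** y].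
Proof.
by case: torA => _ _ inv _ xl x0; apply: invertible_gr => //; apply: inv xl x0.
Qed.

Lemma gone_neq0 x : x <> 0 -> one A <> 0.
Proof. by move=> x0 e; apply: x0; rewrite -[x]ga_mul1x e gmul0x. Qed.

(** The involution acts on the line A^l by a scalar of square 1. *)
Lemma gr_star_pm l x : A`_[l] x -> star x = x \/ star x = - x.
Proof.
move=> xl; have [->|/eqP x0] := eqVneq x 0; first by left; rewrite gstar0.
have [c E] := gr_line xl x0 (ga_gr_star xl).
have : (c ^+ 2 - 1) *: x = 0.
  by rewrite scalerBl scale1r expr2 -scalerA -E -gstarZ -E ga_starK subrr.
move=> /eqP; rewrite scaler_eq0 subr_eq0 sqrf_eq1 => /orP[/orP[]/eqP c1|/eqP//].
  by left; rewrite E c1 scale1r.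
by right; rewrite E c1 scaleN1r.
Qed.

Lemma star_herm l x : A`_[l] x -> ~ supp_minus A l -> star x = x.
Proof.
move=> xl nl; have [//|sx] := gr_star_pm xl.
have [->|/eqP x0] := eqVneq x 0; first by rewrite gstar0.
by case: nl; exists x.
Qed.

Lemma star_skew l x : A`_[l] x -> supp_minus A l -> star x = - x.
Proof.
move=> xl [s [sl ss s0]]; have [c ->] := gr_line sl s0 xl.
by rewrite gstarZ ss scalerN.
Qed.

(** Both sides are additive in x and y, and homogeneous elements are hermitian or skew, so the four
    cases suffice. *)
Lemma skew_alt s x y : star s = - s ->
  (s ** x) ** y + (x ** s) ** y = s ** (x ** y) + x ** (s ** y).
Proof.
move=> ss; elim/gr_ind: x => [|x x' IH IH'|l x xl].
- by rewrite ?(gmulx0, gmul0x).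
- by rewrite !gmulE addrACA IH IH'; zmod.
elim/gr_ind: y => [|y y' IH IH'|m y ym].
- by rewrite ?(gmulx0, gmul0x).
- by rewrite !gmulE addrACA IH IH'; zmod.
have [sx|sx] := gr_star_pm xl; have [sy|sy] := gr_star_pm ym.
- exact: skew_alt_hh.
- exact: skew_alt_hs.
- exact: skew_alt_sh.
exact: skew_alt_ss.
Qed.

(** Applying star to s t = 1 shows that t cannot be hermitian. Skew-alternativity for s, t, x reads
    2 x = s(tx) + t(sx), and the two summands agree because the left multiplications by s and t
    commute. *)
Lemma skew_inv l s : A`_[l] s -> star s = - s -> s <> 0 -> exists t,
  [/\ A`_[- l] t, star t = - t, t <> 0, forall x, s ** (t ** x) = x &
      forall x, t ** (s ** x) = x].
Proof.
move=> sl ss s0; have [t [tl st ts C _]] := inv_gr sl s0.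
have o0 := gone_neq0 s0.
have t0 : t <> 0 by move=> t0; apply: o0; rewrite -st t0 gmulx0.
have tt : star t = - t.
  have [e|//] := gr_star_pm tl; case: o0; apply: (opp_fix0 charF_neq2).
  by rewrite -[LHS]gstar1 -[in LHS]st ga_starM e ss gmulNr ts.
have H x : s ** (t ** x) = x.
  have := skew_alt t x ss; rewrite st ts ga_mul1x -C -!mulr2n.
  by move/(mulr2n_inj charF_neq2) => <-.
by exists t; split=> // x; rewrite -C H.
Qed.

Lemma skew_mul_eq0 l s x : A`_[l] s -> star s = - s -> s <> 0 -> s ** x = 0 -> x = 0.
Proof.
move=> sl ss s0 sx; have [t [_ _ _ _ H]] := skew_inv sl ss s0.
by rewrite -(H x) sx gmulx0.
Qed.

Lemma suppN l : supp A l -> supp A (- l).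
Proof.
move=> [x xl x0]; have [y [yl xy _ _ _]] := inv_gr xl x0; exists y => // y0.
by apply: (gone_neq0 x0); rewrite -xy y0 gmulx0.
Qed.

Lemma supp_minusN l : supp_minus A l -> supp_minus A (- l).
Proof.
move=> [s [sl ss s0]]; have [t [tl st t0 _ _]] := skew_inv sl ss s0.
by exists t.
Qed.

Local Notation Lm := (Lambda_minus A).
Let sLm : is_subgroup Lm := generated_subgroup _.

Lemma supp_minus_Lm l : supp_minus A l -> Lm l.
Proof. exact: sub_generated. Qed.

Lemma supp_Lm l k : supp A l -> Lm k -> supp A (l + k).
Proof.
move=> sl kL; suff: [set k | forall l, supp A l -> supp A (l + k)] k by apply.
(* Both signs are demanded so that [H] is closed under subtraction. *)
pose H := [set k | forall l, supp A l -> supp A (l + k) /\ supp A (l - k)].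
suff /(_ _ kL) h : Lm `<=` H by move=> m /h [].
apply: generated_min => [|m [s [sm ss s0]] n [x xn x0]].
  split=> [m sm|m n hm hn o so]; first by rewrite subr0 addr0.
  split; rewrite ?opprB; [have := (hn _ (hm _ so).1).2 | have := (hn _ (hm _ so).2).1].
    by rewrite addrA.
  by rewrite addrAC addrA.
split; rewrite addrC.
  exists (s ** x); first exact: ga_gr_mul.
  by move=> /(skew_mul_eq0 sm ss s0).
have [t [tm st t0 _ _]] := skew_inv sm ss s0.
exists (t ** x); first exact: ga_gr_mul.
by move=> /(skew_mul_eq0 tm st t0).
Qed.

Local Notation E := (@partE F L A).
Local Notation W := (@partW F L A).

Lemma EW_ind (P : A -> Prop) : (forall x y, P x -> P y -> P (x + y)) ->
  (forall x, E x -> P x) -> (forall x, W x -> P x) -> forall x, P x.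
Proof.
move=> PD PE PW; elim/gr_ind => [|//|l x xl]; first by apply: PE; apply: graded_part0.
by have [lL|lL] := pselect (Lm l); [apply: PE|apply: PW]; apply: graded_part_hom lL xl.
Qed.

Lemma W_star w : W w -> star w = w.
Proof.
move: w; apply: graded_part_ind => [|x y sx sy|l x lL xl]; first exact: gstar0.
  by rewrite gstarD sx sy.
by apply: star_herm xl _ => /supp_minus_Lm.
Qed.

Lemma E_star e : E e -> E (star e).
Proof. exact: graded_part_star. Qed.

Lemma E_mul e f : E e -> E f -> E (e ** f).
Proof. by apply: graded_part_mul => l m; apply: (subgroupD sLm). Qed.

Lemma EW_mul e w : E e -> W w -> W (e ** w).
Proof. by apply: graded_part_mul => l m lL mL /(subgroupDl sLm lL). Qed.

Lemma WE_comm e w : E e -> W w -> w ** star e = e ** w.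
Proof.
by move=> Ee Ww; rewrite -{1}(W_star Ww) -ga_starM; apply/W_star/EW_mul.
Qed.

Definition skew l s := A`_[l] s /\ star s = - s.

Lemma skew_E l s : skew l s -> E s.
Proof.
move=> [sl ss]; have [->|/eqP s0] := eqVneq s 0; first exact: graded_part0.
by apply: (graded_part_hom (X := Lm) _ sl); apply: supp_minus_Lm; exists s.
Qed.

Lemma W_skew l s w : skew l s -> W w -> w ** s = - (s ** w).
Proof.
move=> sk Ww; have := WE_comm (skew_E sk) Ww.
by rewrite sk.2 gmulNr => <-; rewrite opprK.
Qed.

(** Skew-alternativity for s, w, t: the side (s w) t + (w s) t vanishes since w s = - s w, and w (s
    t) = (t s) w by [WE_comm]. *)
Lemma skew_skew_W l m s t w : skew l s -> skew m t -> W w ->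
  s ** (t ** w) = (t ** s) ** w.
Proof.
move=> hs ht Ww; have := skew_alt w t hs.2.
rewrite (W_skew hs Ww) gmulNl subrr (W_skew ht Ww) gmulNr.
move/esym; rewrite addrC => /eqP; rewrite subr_eq0 => /eqP <-.
rewrite -(WE_comm (E_mul (skew_E ht) (skew_E hs)) Ww) ga_starM hs.2 ht.2.
by rewrite gmulNl !gmulNr opprK.
Qed.

Lemma W_skewr l s u v : skew l s -> W u -> W v -> u ** (s ** v) = - (s ** (u ** v)).
Proof.
move=> hs Wu Wv; have := skew_alt u v hs.2.
rewrite (W_skew hs Wu) gmulNl subrr addrC => /esym/eqP.
by rewrite addr_eq0 => /eqP.
Qed.

Lemma W_skewl l s u v : skew l s -> W u -> W v -> (s ** u) ** v = (u ** v) ** s.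
Proof.
move=> hs Wu Wv; apply: gstar_inj; rewrite !ga_starM hs.2 (W_star Wv) (W_star Wu).
by rewrite !gmulNr (W_skew hs Wu) gmulNr opprK gmulNl (W_skewr hs Wv Wu).
Qed.

(** * Class III: the algebra E and its action on W *)

Section ClassIII.
Hypothesis c3A : class_III A.

Lemma W_pair : exists a b u v, [/\ A`_[a] u, A`_[b] v, ~ Lm a, ~ Lm b &
  ~ Lm (a + b) /\ u ** v <> 0].
Proof.
case: c3A => _ _ [w1 [w2 [W1 W2 nE]]]; apply: contrapT => H; apply: nE.
move: w1 W1; apply: graded_part_ind => [|x y Ex Ey|a u aL ua].
- by rewrite gmul0x; apply: graded_part0.
- by rewrite gmulDl -[x ** w2]scale1r; apply: graded_partP.
move: w2 W2; apply: graded_part_ind => [|x y Ex Ey|b v bL vb].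
- by rewrite gmulx0; apply: graded_part0.
- by rewrite gmulDr -[u ** x]scale1r; apply: graded_partP.
have [->|/eqP uv0] := eqVneq (u ** v) 0; first exact: graded_part0.
have [abL|abL] := pselect (Lm (a + b)); last by case: H; exists a, b, u, v.
exact: (graded_part_hom abL (ga_gr_mul ua vb)).
Qed.

Lemma W_hom l w : A`_[l] w -> ~ Lm l -> W w.
Proof. by move=> wl lL; apply: (graded_part_hom (X := ~` Lm) _ wl). Qed.

Lemma E_hom l x : A`_[l] x -> Lm l -> E x.
Proof. by move=> xl lL; apply: (graded_part_hom lL xl). Qed.

Lemma W_elt : exists l w, [/\ A`_[l] w, ~ Lm l & w <> 0].
Proof.
have [a [b [u [v [ua vb aL bL [abL uv0]]]]]] := W_pair.
by exists (a + b), (u ** v); split=> //; apply: ga_gr_mul.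
Qed.

(** For u, v and a nonzero u v in W, moving s and t out of (s u)(t v) in either order gives t(s(uv))
    = s(t(uv)), so the commutator of s and t kills uv. It is itself skew and homogeneous, hence
    would act injectively if it were nonzero. *)
Lemma skew_comm l m s t : skew l s -> skew m t -> s ** t = t ** s.
Proof.
move=> hs ht; have [a [b [u [v [ua vb aL bL [abL uv0]]]]]] := W_pair.
have [Wu Wv] := (W_hom ua aL, W_hom vb bL).
have Wuv := W_hom (ga_gr_mul ua vb) abL.
have Wtv : W (t ** v) by apply: EW_mul => //; apply: skew_E ht.
have Wsu : W (s ** u) by apply: EW_mul => //; apply: skew_E hs.
have Wt : W (t ** (u ** v)) by apply: EW_mul => //; apply: skew_E ht.
have Ws : W (s ** (u ** v)) by apply: EW_mul => //; apply: skew_E hs.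
have e1 : (s ** u) ** (t ** v) = t ** (s ** (u ** v)).
  by rewrite (W_skewr ht Wsu Wv) (W_skewl hs Wu Wv) (W_skew hs Wuv) gmulNr opprK.
have e2 : (s ** u) ** (t ** v) = s ** (t ** (u ** v)).
  by rewrite (W_skewl hs Wu Wtv) (W_skewr ht Wu Wv) gmulNl (W_skew hs Wt) opprK.
have [//|/eqP d0] := eqVneq (s ** t - t ** s) 0; first by move/eqP; rewrite subr_eq0 => /eqP.
case: uv0; apply: (@skew_mul_eq0 (l + m) (s ** t - t ** s)) => //.
- apply: ggrB; first exact: ga_gr_mul hs.1 ht.1.
  by rewrite addrC; apply: ga_gr_mul ht.1 hs.1.
- by rewrite gstarB !ga_starM hs.2 ht.2 !gmulE !opprK opprB.
by rewrite gmulBl -(skew_skew_W hs ht Wuv) -(skew_skew_W ht hs Wuv) -e1 -e2 subrr.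
Qed.

Lemma skew_act l m s t w : skew l s -> skew m t -> W w -> (s ** t) ** w = s ** (t ** w).
Proof. by move=> hs ht Ww; rewrite (skew_comm hs ht) (skew_skew_W hs ht). Qed.

Lemma skew_actC l m s t w : skew l s -> skew m t -> W w -> s ** (t ** w) = t ** (s ** w).
Proof. by move=> hs ht Ww; rewrite -(skew_act hs ht Ww) (skew_comm hs ht) (skew_act ht hs Ww). Qed.

Lemma skew_prod_star l m s t : skew l s -> skew m t -> star (s ** t) = s ** t.
Proof.
by move=> hs ht; rewrite ga_starM hs.2 ht.2 gmulNl gmulNr opprK (skew_comm ht hs).
Qed.

(** Were s(tr) hermitian, then s would anticommute with the hermitian x = tr, and skew-alternativity
    would give s(xw) + x(sw) = 0 on W. Both terms equal s(t(rw)), which is nonzero for nonzero w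
    unless a factor vanishes. *)
Lemma skew3 l m k s t r : skew l s -> skew m t -> skew k r ->
  skew (l + (m + k)) (s ** (t ** r)).
Proof.
move=> hs ht hr; have g := ga_gr_mul hs.1 (ga_gr_mul ht.1 hr.1); split=> //.
have [e|//] := gr_star_pm g; rewrite e.
have [b [w [wb bL w0]]] := W_elt; have Ww := W_hom wb bL.
have Wr c x w' : skew c x -> W w' -> W (x ** w') by move=> /skew_E; apply: EW_mul.
have sx := skew_prod_star ht hr; set x := t ** r in e g sx *.
have anti : s ** x + x ** s = 0.
  by rewrite -[s ** x]e ga_starM sx hs.2 gmulNr addNr.
have := skew_alt x w hs.2; rewrite -gmulDl anti gmul0x.
rewrite !(skew_act ht hr) //; last exact: Wr hs Ww.
rewrite (skew_actC hr hs) // (skew_actC ht hs) -?mulr2n; last exact: Wr hr Ww.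
move/esym/(mulr2n_eq0 charF_neq2) => z.
have [->|/eqP s0] := eqVneq s 0; first by rewrite gmul0x oppr0.
have [t0|/eqP t0] := eqVneq t 0; first by rewrite /x t0 gmul0x gmulx0 oppr0.
have [r0|/eqP r0] := eqVneq r 0; first by rewrite /x r0 !gmulx0 oppr0.
case: w0; apply: (skew_mul_eq0 hr.1 hr.2 r0); apply: (skew_mul_eq0 ht.1 ht.2 t0).
exact: (skew_mul_eq0 hs.1 hs.2 s0).
Qed.

Lemma supp_minus3 l m k : supp_minus A l -> supp_minus A m -> supp_minus A k ->
  supp_minus A (l + (m + k)).
Proof.
move=> [s [sl ss s0]] [t [tl st t0]] [r [rl sr r0]].
have [g h] : skew (l + (m + k)) (s ** (t ** r)) by apply: skew3.
exists (s ** (t ** r)); split=> // e; apply: r0.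
exact: (skew_mul_eq0 tl st t0 (skew_mul_eq0 sl ss s0 e)).
Qed.

(** As S_- is closed under negation and under sums of three, a sum of any number of its elements
    collapses to one or two of them. *)
Lemma Lm_skew k : Lm k -> supp_minus A k \/
  exists l m, [/\ supp_minus A l, supp_minus A m & k = l + m].
Proof.
pose H := [set k | supp_minus A k \/
  exists l m, [/\ supp_minus A l, supp_minus A m & k = l + m]].
suff : Lm `<=` H by apply.
apply: generated_min => [|l sl]; last by left.
split=> [|x y]; first have [[l sl] _ _] := c3A.
  by right; exists l, (- l); split=> //; [apply: supp_minusN|rewrite subrr].
move=> [sx|[l [m [sl sm ->]]]] [sy|[l' [m' [sl' sm' ->]]]].
- by right; exists x, (- y); split=> //; apply: supp_minusN.
- by left; rewrite opprD; apply: supp_minus3 => //; apply: supp_minusN.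
- by left; rewrite -addrA; apply: supp_minus3 => //; apply: supp_minusN.
right; exists (l + (m - l')), (- m'); split; [|exact: supp_minusN|].
  by apply: supp_minus3 => //; apply: supp_minusN.
by rewrite opprD !addrA.
Qed.

(** By [Lm_skew] every component of E is a line spanned by a skew element or by a product of two. *)
Lemma E_ind (P : A -> Prop) : P 0 -> (forall x y, P x -> P y -> P (x + y)) ->
  (forall l s, skew l s -> P s) ->
  (forall l m s t, skew l s -> skew m t -> P (s ** t)) -> forall e, E e -> P e.
Proof.
move=> P0 PD Ps Pst; apply: graded_part_ind => // k x kL xk.
have [sk|[l [m [[s [sl ss s0]] [t [tl st t0]] kE]]]] := Lm_skew kL.
  by apply: (Ps k); split=> //; apply: star_skew xk sk.
have st0 : s ** t <> 0 by move=> /(skew_mul_eq0 sl ss s0).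
rewrite kE in xk; have [c ->] := gr_line (ga_gr_mul sl tl) st0 xk.
by rewrite -gmulZl; apply: (Pst l m) => //; split; [apply: ggrZ|rewrite gstarZ ss scalerN].
Qed.

Lemma skew2_comm l m k s t r : skew l s -> skew m t -> skew k r ->
  (t ** r) ** s = s ** (t ** r).
Proof.
move=> hs ht hr; have [_] := skew3 hs ht hr.
by rewrite ga_starM (skew_prod_star ht hr) hs.2 gmulNr => /oppr_inj.
Qed.

Lemma skew2_act l m k s t r w : skew l s -> skew m t -> skew k r -> W w ->
  (s ** (t ** r)) ** w = s ** (t ** (r ** w)).
Proof.
move=> hs ht hr Ww; have Wr c x w' : skew c x -> W w' -> W (x ** w').
  by move=> /skew_E; apply: EW_mul.
have := skew_alt (t ** r) w hs.2; rewrite (skew2_comm hs ht hr) -mulr2n.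
rewrite !(skew_act ht hr) //; last exact: Wr hs Ww.
rewrite (skew_actC hr hs) // (skew_actC ht hs) -?mulr2n; last exact: Wr hr Ww.
exact: (mulr2n_inj charF_neq2).
Qed.

Lemma E_act e f w : E e -> E f -> W w -> (e ** f) ** w = e ** (f ** w).
Proof.
move=> Ee Ef Ww; have Wr c x w' : skew c x -> W w' -> W (x ** w').
  by move=> /skew_E; apply: EW_mul.
move: e Ee; apply: E_ind => [|x y IH IH'|l s hs|l m s t hs ht].
- by rewrite !gmul0x.
- by rewrite !gmulDl IH IH'.
- move: f Ef; apply: E_ind => [|x y IH IH'|m t ht|m k t r ht hr].
  + by rewrite ?(gmul0x, gmulx0).
  + by rewrite !gmulE IH IH'.
  + exact: (skew_act hs ht Ww).
  by rewrite (skew2_act hs ht hr Ww) (skew_act ht hr Ww).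
move: f Ef; apply: E_ind => [|x y IH IH'|k r hr|k n r q hr hq].
- by rewrite ?(gmul0x, gmulx0).
- by rewrite !gmulE IH IH'.
- rewrite (skew2_comm hr hs ht) (skew2_act hr hs ht Ww) (skew_act hs ht); last exact: Wr hr Ww.
  by rewrite (skew_actC ht hr Ww) (skew_actC hs hr) //; apply: Wr ht Ww.
have sx := skew_prod_star hr hq; have hx := skew3 ht hr hq; have hx' := skew3 hs hr hq.
set x := r ** q in sx hx hx' *.
have xw w' : W w' -> W (x ** w').
  by apply: EW_mul; apply: E_mul; [apply: skew_E hr|apply: skew_E hq].
(* Four factors: as s and t commute, skew-alternativity says 2 (s t) x = s(t x) + t(s x). Since t x
   and s x are again skew by [skew3], the products with fewer factors suffice. *)
have := skew_alt t x hs.2; rewrite (skew_comm ht hs) -mulr2n => e.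
apply: (mulr2n_inj charF_neq2); rewrite /= [in LHS]mulr2n -gmulDl -mulr2n e gmulDl.
rewrite (skew_act hs hx Ww) (skew_act ht hx' Ww) (skew2_act ht hr hq Ww).
rewrite (skew2_act hs hr hq Ww) -(skew_act hr hq Ww) -/x (skew_actC ht hs) ?xw //.
  by rewrite (skew_act hs ht) ?mulr2n //; apply: xw.
exact: xw.
Qed.

Lemma E_mul_eq0 k e w : A`_[k] e -> Lm k -> e <> 0 -> W w -> e ** w = 0 -> w = 0.
Proof.
move=> ek kL e0 Ww; have [sk|[l [m [[s [sl ss s0]] [t [tl st t0]] kE]]]] := Lm_skew kL.
  exact: (skew_mul_eq0 ek (star_skew ek sk) e0).
have st0 : s ** t <> 0 by move=> /(skew_mul_eq0 sl ss s0).
rewrite kE in ek; have [c eE] := gr_line (ga_gr_mul sl tl) st0 ek.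
rewrite eE gmulZl (skew_act (l := l) (m := m)) //.
move=> /eqP; rewrite scaler_eq0 => /orP[/eqP c0|/eqP]; first by rewrite eE c0 scale0r in e0.
by move=> /(skew_mul_eq0 sl ss s0) /(skew_mul_eq0 tl st t0).
Qed.

(** A single homogeneous w suffices: no nonzero component of e kills it, and its products with
    distinct components have distinct degrees. *)
Lemma E_faithful e : E e -> (forall w, W w -> e ** w = 0) -> e = 0.
Proof.
move=> Ee H; apply: proj_eq0 => k; have [kL|kL] := pselect (Lm k); last first.
  by move/graded_part_proj: Ee; apply.
have [l [w [wl lL w0]]] := W_elt; have Ww := W_hom wl lL.
apply: contrapT => e0; apply: w0; apply: (E_mul_eq0 (proj_gr k e) kL e0 Ww).
by rewrite -(projMr _ _ wl) H // proj0.
Qed.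

Lemma E_sub e f : E e -> E f -> E (e - f).
Proof. exact: graded_partB. Qed.

Lemma E_eq e f : E e -> E f -> (forall w, W w -> e ** w = f ** w) -> e = f.
Proof.
move=> Ee Ef H; apply/eqP; rewrite -subr_eq0; apply/eqP.
by apply: E_faithful => [|w /H e1]; [apply: E_sub|rewrite gmulBl e1 subrr].
Qed.

Lemma E_actC e f w : E e -> E f -> W w -> e ** (f ** w) = f ** (e ** w).
Proof.
move=> Ee Ef Ww.
have H l s w' : skew l s -> W w' -> s ** (f ** w') = f ** (s ** w').
  move=> hs Ww'; move: f Ef; apply: E_ind => [|x y IH IH'|m t ht|m k t r ht hr].
  - by rewrite ?(gmul0x, gmulx0).
  - by rewrite !gmulE IH IH'.
  - exact: (skew_actC hs ht Ww').
  have [Es Et Er] := And3 (skew_E hs) (skew_E ht) (skew_E hr).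
  have [Wr Wsw] := (EW_mul Er Ww', EW_mul Es Ww').
  rewrite (E_act Et Er Ww') (E_act Et Er Wsw).
  by rewrite (skew_actC hs ht Wr) (skew_actC hs hr Ww').
move: e Ee; apply: E_ind => [|x y IH IH'|l s hs|l m s t hs ht].
- by rewrite ?(gmul0x, gmulx0).
- by rewrite !gmulE IH IH'.
- exact: H hs Ww.
have [Es Et] := (skew_E hs, skew_E ht).
have [Wt Wf] := (EW_mul Et Ww, EW_mul Ef Ww).
by rewrite (E_act Es Et Wf) (E_act Es Et Ww) (H _ _ _ ht Ww) (H _ _ _ hs Wt).
Qed.

Lemma E_comm e f : E e -> E f -> e ** f = f ** e.
Proof.
move=> Ee Ef; apply: E_eq => [||w Ww]; try exact: E_mul.
by rewrite !E_act // E_actC.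
Qed.

(** On W this is [E_act]; for x in E both sides are compared through their action on W, which is
    faithful. *)
Lemma E_assoc e f x : E e -> E f -> e ** (f ** x) = (e ** f) ** x.
Proof.
move=> Ee Ef; elim/EW_ind: x => [x y IH IH'|x Ex|w Ww]; last by rewrite E_act.
  by rewrite !gmulDr IH IH'.
apply: E_eq => [||w Ww]; try by do ?apply: E_mul.
have Wx := EW_mul Ex Ww.
by rewrite (E_act Ee (E_mul Ef Ex) Ww) (E_act Ef Ex Ww) (E_act (E_mul Ee Ef) Ex Ww) E_act.
Qed.

Lemma W_sesqr e u v : E e -> W u -> W v -> u ** (e ** v) = star e ** (u ** v).
Proof.
move=> Ee Wu Wv; move: e Ee; apply: E_ind => [|x y IH IH'|l s hs|l m s t hs ht].
- by rewrite gstar0 ?(gmul0x, gmulx0).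
- by rewrite gstarD !gmulE IH IH'.
- by rewrite (W_skewr hs Wu Wv) hs.2 gmulNl.
have [Es Et] := (skew_E hs, skew_E ht).
rewrite (skew_prod_star hs ht) (skew_act hs ht Wv) (W_skewr hs Wu (EW_mul Et Wv)).
by rewrite (W_skewr ht Wu Wv) gmulNr opprK E_assoc.
Qed.

Lemma W_sesql e u v : E e -> W u -> W v -> (e ** u) ** v = (u ** v) ** e.
Proof.
move=> Ee Wu Wv; apply: gstar_inj; have We := EW_mul Ee Wu.
by rewrite ga_starM (W_star Wv) (W_star We) W_sesqr // !ga_starM (W_star Wv) (W_star Wu).
Qed.

Lemma W_comm a b u v : A`_[a] u -> A`_[b] v -> ~ Lm a -> ~ Lm b -> ~ Lm (a + b) ->
  u ** v = v ** u.
Proof.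
move=> ua vb aL bL abL; have Wuv := W_hom (ga_gr_mul ua vb) abL.
by rewrite -(W_star Wuv) ga_starM (W_star (W_hom ua aL)) (W_star (W_hom vb bL)).
Qed.

Lemma Lm_compl a b : ~ Lm a -> Lm (a + b) -> ~ Lm b.
Proof. by move=> aL abL bL; apply: aL; apply: subgroupDr sLm bL abL. Qed.

(** Cyclic invariance of h(x, y <> z). In a skew total degree (y z) x = - x (y z), and likewise with
    z and x y, so the instance [q := 1] of [herm_triple] becomes twice the claim. *)
Lemma trilinear_sym_skew a b c x y z :
    A`_[a] x -> A`_[b] y -> A`_[c] z -> ~ Lm a -> ~ Lm b -> ~ Lm c ->
  supp_minus A (a + b + c) -> x ** (y ** z) = z ** (x ** y).
Proof.
move=> xa yb zc aL bL cL sk; have abcL := supp_minus_Lm sk.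
have bcL : ~ Lm (b + c) by apply: (Lm_compl aL); rewrite addrA.
have acL : ~ Lm (a + c) by apply: (Lm_compl bL); rewrite addrCA addrA.
have abL : ~ Lm (a + b) by apply: (Lm_compl cL); rewrite addrC.
have [Wx Wy Wz] := And3 (W_hom xa aL) (W_hom yb bL) (W_hom zc cL).
have [sx sy sz] := And3 (W_star Wx) (W_star Wy) (W_star Wz).
have cxy := W_comm xa yb aL bL abL; have cyz := W_comm yb zc bL cL bcL.
have cxz := W_comm xa zc aL cL acL.
have e1 : (y ** z) ** x = - (x ** (y ** z)).
  have h : A`_[a + b + c] (x ** (y ** z)) by rewrite -addrA; do ?apply: ga_gr_mul.
  by rewrite -(star_skew h sk) !ga_starM sx sy sz cyz.
have e2 : (x ** y) ** z = - (z ** (x ** y)).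
  have h : A`_[a + b + c] (z ** (x ** y)) by rewrite addrC; do ?apply: ga_gr_mul.
  by rewrite -(star_skew h sk) !ga_starM sx sy sz cxy.
have := herm_triple strA y z (one A) sx.
rewrite /triple !(ga_starM, gstar1, sx, sy, sz, ga_mulx1, ga_mul1x) -?(cxy, cyz, cxz).
rewrite !gmulE e1 e2 => h.
by apply: (mulr2n_inj charF_neq2); apply: (add_eqs h (erefl 0)); zmod.
Qed.

(* The hermitian case follows from the skew one by replacing x by s x. *)
Lemma trilinear_sym a b c x y z :
    A`_[a] x -> A`_[b] y -> A`_[c] z -> ~ Lm a -> ~ Lm b -> ~ Lm c ->
  Lm (a + b + c) -> x ** (y ** z) = z ** (x ** y).
Proof.
move=> xa yb zc aL bL cL abcL.
have [|nsk] := pselect (supp_minus A (a + b + c)); first exact: trilinear_sym_skew.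
have [[k [s [sk ss s0]] _ _]] := c3A.
have hs : skew k s by [].
have kL : Lm k by apply: supp_minus_Lm; exists s.
have kaL : ~ Lm (k + a) by move/(subgroupDl sLm kL).
have Es := skew_E hs.
have [Wx Wy Wz] := And3 (W_hom xa aL) (W_hom yb bL) (W_hom zc cL).
have bcL : ~ Lm (b + c) by apply: (Lm_compl aL); rewrite addrA.
have abL : ~ Lm (a + b) by apply: (Lm_compl cL); rewrite addrC.
have Wxy := W_hom (ga_gr_mul xa yb) abL; have Wyz := W_hom (ga_gr_mul yb zc) bcL.
have Exyz : E (x ** (y ** z)).
  by apply: (E_hom _ abcL); rewrite -addrA; do ?apply: ga_gr_mul.
have sk' : supp_minus A (k + a + b + c).
  have [w wl w0] : supp A (0 + (a + b + c)).
    by apply: supp_Lm => //; exists (one A); [apply: gr_one|apply: gone_neq0 s0].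
  rewrite add0r in wl; have sw := star_herm wl nsk.
  exists (s ** w); split; first by rewrite -!addrA [a + _]addrA; apply: ga_gr_mul.
    by rewrite ga_starM sw ss gmulNr (E_comm (E_hom wl abcL) Es).
  by move=> /(skew_mul_eq0 sk ss s0).
have := trilinear_sym_skew (ga_gr_mul sk xa) yb zc kaL bL cL sk'.
rewrite (W_sesql Es Wx Wyz) -(E_comm Es Exyz) (W_sesql Es Wx Wy) (W_skew hs Wxy).
rewrite gmulNr (W_skewr hs Wz Wxy) opprK => e.
apply/eqP; rewrite -subr_eq0; apply/eqP; apply: (skew_mul_eq0 sk ss s0).
by rewrite gmulBr e subrr.
Qed.

(** * The star geometry and the subgroup M *)

Section Star.
Variable sg : L.
Local Notation coset := (@coset F L A).
Hypotheses (sgS : supp A sg) (sgL : ~ Lm sg).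
Hypothesis star_sg : star_with_centre A (coset sg).

Lemma coset_eqP a b : coset a = coset b -> Lm (a - b).
Proof. by move=> e; suff: coset b a by []; rewrite -e /coset /= subrr; apply: sLm.1. Qed.

Lemma star_line a b c x y z : A`_[a] x -> A`_[b] y -> A`_[c] z ->
    ~ Lm a -> ~ Lm b -> ~ Lm c -> Lm (a + b + c) -> x ** (y ** z) <> 0 ->
  [\/ Lm (a - sg), Lm (b - sg) | Lm (c - sg)].
Proof.
move=> xa yb zc aL bL cL abcL xyz0.
have bcL : ~ Lm (b + c) by apply: (Lm_compl aL); rewrite addrA.
have yz0 : y ** z <> 0 by move=> e; apply: xyz0; rewrite e gmulx0.
have [_ _ H] := star_sg.
have : line A (coset a) (coset b) (coset c).
  exists a, b, c; split=> //.
    split; split=> //; [exists x|exists y|exists z] => // e; apply: xyz0;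
    by rewrite e ?(gmul0x, gmulx0).
  exists x, y, z, 0, (y ** z), (x ** (y ** z)), 0; split=> //; split=> //.
    split; rewrite ?add0r //; first exact: graded_part0.
    by apply: W_hom bcL; apply: ga_gr_mul.
  split; rewrite ?addr0 //; last exact: graded_part0.
  by apply: (E_hom _ abcL); rewrite -addrA; do ?apply: ga_gr_mul.
move/H; rewrite !inE => /or3P[] /eqP /coset_eqP e.
- by apply: Or31; apply: (subgroupC sLm e).
- by apply: Or32; apply: (subgroupC sLm e).
by apply: Or33; apply: (subgroupC sLm e).
Qed.

(** The elements (x y)^-1, x, y have product 1, so their cosets form a line and one of them is the
    centre. *)
Lemma star_prod a b x y : A`_[a] x -> A`_[b] y -> ~ Lm a -> ~ Lm b ->
  ~ Lm (a + b) -> x ** y <> 0 -> [\/ Lm (a - sg), Lm (b - sg) | Lm (a + b + sg)].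
Proof.
move=> xa yb aL bL abL xy0; have xyab := ga_gr_mul xa yb.
have [z [zc _ zxy _ _]] := inv_gr xyab xy0.
have cL : ~ Lm (- (a + b)) by move/(subgroupN sLm); rewrite opprK.
have : [\/ Lm (- (a + b) - sg), Lm (a - sg) | Lm (b - sg)].
  apply: (star_line zc xa yb) => //; rewrite -?addrA ?addNr; first exact: sLm.1.
  by rewrite zxy; apply: gone_neq0 xy0.
move=> [h|h|h]; [apply: Or33|exact: Or31|exact: Or32].
by rewrite -[_ + sg]opprK opprD; apply: (subgroupN sLm).
Qed.

(** x = x (x^-1 x) = x^-1 (x x), as the left multiplications by x and its inverse commute. *)
Lemma sqr_neq0 a x : A`_[a] x -> x <> 0 -> x ** x <> 0.
Proof.
move=> xa x0 e; have [y [_ xy yx C _]] := inv_gr xa x0; apply: x0.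
by rewrite -[x]ga_mulx1 -yx C e gmulx0.
Qed.

(** The square of an element of degree [- sg] is used: for degree [sg] the alternative [Lm (a - sg)]
    of [star_prod] would hold trivially. *)
Lemma sg2_Lm : Lm (sg *+ 2).
Proof.
apply: contrapT => nL; have [g gN g0] := suppN sgS.
have nsgL : ~ Lm (- sg) by move/(subgroupN sLm); rewrite opprK.
have : [\/ Lm (- sg - sg), Lm (- sg - sg) | Lm (- sg - sg + sg)].
  apply: (star_prod gN gN nsgL nsgL _ (sqr_neq0 gN g0)).
  by rewrite -opprD -mulr2n => /(subgroupN sLm); rewrite opprK.
rewrite subrK -opprD -mulr2n => -[] /(subgroupN sLm); by rewrite opprK.
Qed.

Lemma sgD_sgB a : Lm (a + sg) <-> Lm (a - sg).
Proof.
split=> h.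
  by rewrite (_ : a - sg = a + sg - sg *+ 2) ?mulr2n; [apply: sLm.2 => //; apply: sg2_Lm|zmod].
by rewrite (_ : a + sg = a - sg + sg *+ 2) ?mulr2n; [apply: (subgroupD sLm h sg2_Lm)|zmod].
Qed.

(** The group generated by [Lambda_minus] and [sg]: since [sg *+ 2] lies in [Lambda_minus], two
    cosets are enough. *)
Definition Ms := [set l | Lm l \/ Lm (l - sg)].

Lemma Ms_sg : Ms sg. Proof. by right; rewrite subrr; apply: sLm.1. Qed.

Lemma Ms_subgroup : is_subgroup Ms.
Proof.
split=> [|x y [hx|hx] [hy|hy]]; first by left; apply: sLm.1.
- by left; apply: sLm.2.
- right; rewrite -sgD_sgB (_ : x - y + sg = x - (y - sg)); last by zmod.
  exact: sLm.2.
- right; rewrite (_ : x - y - sg = x - sg - y); last by zmod.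
  exact: sLm.2.
left; rewrite (_ : x - y = x - sg - (y - sg)); last by zmod.
exact: sLm.2.
Qed.

(** It is enough to take a in the support outside [Lambda_minus]. The square of a nonzero element of
    degree a is nonzero, so by [star_prod] either 2a lies in [Lambda_minus] or 2a is congruent to -
    sg, hence to sg. *)
Lemma Ms2 l : Ms (l *+ 2).
Proof.
have H : supp A `<=` [set l | Ms (l *+ 2)].
  move=> a [x xa x0] /=; have [aL|aL] := pselect (Lm a).
    by left; rewrite mulr2n; apply: (subgroupD sLm).
  have [a2|a2] := pselect (Lm (a *+ 2)); first by left.
  have : [\/ Lm (a - sg), Lm (a - sg) | Lm (a + a + sg)].
    by apply: (star_prod xa xa aL aL _ (sqr_neq0 xa x0)); rewrite -mulr2n.
  have nn : ~ Lm (a - sg).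
    move=> h; apply: a2; rewrite (_ : a *+ 2 = (a - sg) + (a - sg) + sg *+ 2); last by zmod.
    by apply: (subgroupD sLm _ sg2_Lm) => //; apply: (subgroupD sLm).
  by move=> [//|//|/sgD_sgB h]; right; rewrite mulr2n.
case: torA => _ _ _ gen; have : generated (supp A) l by rewrite gen.
move: l; apply: generated_min H; split=> [|x y hx hy] /=.
  by rewrite mul0rn; apply: Ms_subgroup.1.
by rewrite mulrnBl; apply: Ms_subgroup.2.
Qed.

Lemma nMs_Lm l : ~ Ms l -> ~ Lm l. Proof. by move=> h ?; apply: h; left. Qed.

Lemma nMs_prod a b x y : A`_[a] x -> A`_[b] y -> ~ Ms a -> ~ Ms b ->
  x ** y <> 0 -> Ms (a + b).
Proof.
move=> xa yb aM bM xy0; have [|abL] := pselect (Lm (a + b)); first by left.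
have [h|h|/sgD_sgB h] := star_prod xa yb (nMs_Lm aM) (nMs_Lm bM) abL xy0.
- by case: aM; right.
- by case: bM; right.
by right.
Qed.

(** Otherwise W would live on the coset of sg and WW on that of 2 sg, which is [Lambda_minus]; this
    contradicts class III. *)
Lemma nMs_ex : exists a, supp A a /\ ~ Ms a.
Proof.
apply: contrapT => H; have HM a x : A`_[a] x -> x <> 0 -> Ms a.
  by move=> xa x0; apply: contrapT => aM; apply: H; exists a; split=> //; exists x.
have [a [b [u [v [ua vb aL bL [abL uv0]]]]]] := W_pair.
have u0 : u <> 0 by move=> e; apply: uv0; rewrite e gmul0x.
have v0 : v <> 0 by move=> e; apply: uv0; rewrite e gmulx0.
have [//|h] := HM _ _ ua u0; have [//|h'] := HM _ _ vb v0.
apply: abL; rewrite (_ : a + b = (a - sg) + (b - sg) + sg *+ 2); last by zmod.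
by apply: (subgroupD sLm _ sg2_Lm) => //; apply: (subgroupD sLm).
Qed.

(** For homogeneous factors a product lies entirely in E or entirely in W, so h and the diamond are
    each either the whole product or 0. *)
Lemma h_diam_prod a b c : ~ Lm a -> h_diam_neq0 A a b c -> Lm (a + b + c) /\
  exists x y z, [/\ A`_[a] x, A`_[b] y, A`_[c] z & x ** (y ** z) <> 0].
Proof.
move=> aL [x [y [z [e [w [e' [w' [[xa yb zc] [[Ee Ww ew] [Ee' Ww' ew'] e'0]]]]]]]]].
have EW0 v : E v -> W v -> v = 0.
  move=> /graded_part_proj Ev /graded_part_proj Wv; apply: proj_eq0 => l.
  by have [lL|lL] := pselect (Lm l); [apply: Wv|apply: Ev].
have WB u v : W u -> W v -> W (u - v).
  exact: graded_partB.
have yzg := ga_gr_mul yb zc; have xyzg := ga_gr_mul xa yzg.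
have [bcL|bcL] := pselect (Lm (b + c)).
  have w0 : w = 0.
    apply: EW0 => //; rewrite -[w](addKr e) -ew addrC; apply: E_sub => //.
    exact: E_hom yzg bcL.
  case: e'0; apply: EW0 => //; rewrite -[e'](addrK w') -ew' w0 gmulx0 sub0r -scaleN1r.
  by rewrite -[_ *: _]addr0; apply: graded_partP => //; apply: graded_part0.
have e0 : e = 0.
  apply: EW0 => //; rewrite -[e](addrK w) -ew; apply: WB => //.
  exact: W_hom yzg bcL.
rewrite e0 add0r in ew; rewrite -ew in ew'.
have [abcL|abcL] := pselect (Lm (a + (b + c))); last first.
  case: e'0; apply: EW0 => //; rewrite -[e'](addrK w') -ew'; apply: WB => //.
  exact: W_hom xyzg abcL.
rewrite -addrA; split=> //; exists x, y, z; split=> // xyz0.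
rewrite xyz0 in ew'; case: e'0; apply: EW0 => //.
rewrite -[e'](addrK w') -ew' sub0r -scaleN1r.
by rewrite -[_ *: _]addr0; apply: graded_partP => //; apply: graded_part0.
Qed.

Lemma E_elt k : Lm k -> exists e, A`_[k] e /\ e <> 0.
Proof.
move=> kL; have [e ek e0] : supp A (0 + k).
  apply: supp_Lm => //; have [x _ x0] := sgS.
  by exists (one A); [apply: gr_one|apply: gone_neq0 x0].
by exists e; rewrite add0r in ek.
Qed.

(** A nonzero e of degree b - a in E does not kill x, so e x spans the line of degree b. *)
Lemma Lm_transfer a b x y : A`_[a] x -> x <> 0 -> A`_[b] y -> ~ Lm a -> Lm (b - a) ->
  exists2 e, A`_[b - a] e & y = e ** x.
Proof.
move=> xa x0 yb aL baL; have [e [ek e0]] := E_elt baL.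
have ex0 : e ** x <> 0.
  by move=> h; apply: x0; apply: (E_mul_eq0 ek baL e0 (W_hom xa aL) h).
have exb := ga_gr_mul ek xa; rewrite subrK in exb.
have [c ->] := gr_line exb ex0 yb.
by exists (c *: e); [apply: ggrZ|rewrite gmulZl].
Qed.

Variable g : A.
Hypotheses (gsg : A`_[sg] g) (g0 : g <> 0).

Lemma Wg : W g. Proof. exact: W_hom gsg sgL. Qed.

Lemma nMs_sgD a : ~ Ms a -> ~ Ms (sg + a).
Proof. by move=> aM h; apply: aM; apply: subgroupDl Ms_subgroup Ms_sg h. Qed.

(** The centre and the coset of a lie on a common line, which supplies y, z, w with y(zw) nonzero.
    By cyclic invariance all products of two of them are nonzero, and two of them lie in the cosets
    of sg and a. *)
Lemma gmul_neq0 a x : A`_[a] x -> x <> 0 -> ~ Ms a -> g ** x <> 0.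
Proof.
move=> xa x0 aM gx0; have aL := nMs_Lm aM; have Wx := W_hom xa aL.
(* Elements of the two cosets are E-multiples of g and x, and the product is sesquilinear over E, so
   g x = 0 would annihilate all their products. *)
have tr b c y z : A`_[b] y -> A`_[c] z -> coset sg = coset b -> coset a = coset c ->
    y ** z = 0.
  move=> yb zc /coset_eqP/(subgroupC sLm) bL /coset_eqP/(subgroupC sLm) cL.
  have [e eb ->] := Lm_transfer gsg g0 yb sgL bL.
  have [f fc ->] := Lm_transfer xa x0 zc aL cL.
  have [Ee Ef] := (E_hom eb bL, E_hom fc cL).
  rewrite W_sesqr ?(W_sesql Ee Wg Wx) ?gx0 ?gmul0x ?gmulx0 //.
  exact: EW_mul Ee Wg.
have aneq : coset a <> coset sg by move=> /coset_eqP h; apply: aM; right.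
have [_ H _] := star_sg.
have [|r _ [b [c [d [[[Sb bL] [Sc cL] [Sd dL]] hd pe]]]]] := H (coset a) _ aneq.
  by exists a => //; split=> //; exists x.
have [bcdL [y [z [w [yb zc wd yzw]]]]] := h_diam_prod bL hd.
have e1 := trilinear_sym yb zc wd bL cL dL bcdL.
have dbcL : Lm (d + b + c) by rewrite -addrA addrC.
have e2 := trilinear_sym wd yb zc dL bL cL dbcL.
have yz0 : y ** z <> 0 by move=> h; apply: yzw; rewrite e1 h gmulx0.
have wy0 : w ** y <> 0 by move=> h; apply: yzw; rewrite e1 e2 h gmulx0.
have zw0 : z ** w <> 0 by move=> h; apply: yzw; rewrite h gmulx0.
have bcL : ~ Lm (b + c) by apply: (Lm_compl dL); rewrite addrA.
have dbL : ~ Lm (d + b) by apply: (Lm_compl cL); rewrite addrC.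
have cdL : ~ Lm (c + d) by apply: (Lm_compl bL); rewrite addrA.
have c1 := W_comm yb zc bL cL bcL; have c2 := W_comm wd yb dL bL dbL.
have c3 := W_comm zc wd cL dL cdL.
have := perm_mem pe (coset sg); have := perm_mem pe (coset a).
rewrite !inE !eqxx orbT /= => /esym/or3P[]/eqP ea /esym/or3P[]/eqP es.
- by apply: aneq; rewrite ea es.
- by apply: yz0; rewrite c1; apply: tr zc yb es ea.
- by apply: wy0; apply: tr wd yb es ea.
- by apply: yz0; apply: tr yb zc es ea.
- by apply: aneq; rewrite ea es.
- by apply: zw0; rewrite c3; apply: tr wd zc es ea.
- by apply: wy0; rewrite c2; apply: tr yb wd es ea.
- by apply: zw0; apply: tr zc wd es ea.
by apply: aneq; rewrite ea es.
Qed.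

(** The preimage is a multiple of e(gx) with e of degree - 2 sg: multiplying it by g returns to the
    line of x without vanishing. *)
Lemma gmul_surj a x : A`_[a] x -> x <> 0 -> ~ Ms a ->
  exists2 y, A`_[a - sg] y & x = g ** y.
Proof.
move=> xa x0 aM; have [e [ek e0]] := E_elt (subgroupN sLm sg2_Lm).
have gxa := ga_gr_mul gsg xa; have gaL := nMs_Lm (nMs_sgD aM).
have yg : A`_[a - sg] (e ** (g ** x)).
  rewrite (_ : a - sg = - (sg *+ 2) + (sg + a)); last by zmod.
  exact: ga_gr_mul.
have y0 : e ** (g ** x) <> 0.
  move=> h; apply: (gmul_neq0 xa x0 aM).
  exact: (E_mul_eq0 ek (subgroupN sLm sg2_Lm) e0 (W_hom gxa gaL) h).
have aM' : ~ Ms (a - sg).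
  by move=> h; apply: aM; rewrite -(subrK sg a); apply: (subgroupD Ms_subgroup h Ms_sg).
have gyg := ga_gr_mul gsg yg; rewrite addrC subrK in gyg.
have [c ->] := gr_line gyg (gmul_neq0 yg y0 aM') xa.
by exists (c *: (e ** (g ** x))); [apply: ggrZ|rewrite gmulZr].
Qed.

Local Notation mu := (g ** g).
Lemma Emu : E mu.
Proof. by apply: E_hom (ga_gr_mul gsg gsg) _; rewrite -mulr2n; apply: sg2_Lm. Qed.
Lemma star_mu : star mu = mu.
Proof. by rewrite ga_starM (W_star Wg). Qed.

(* Both instances of [herm_triple] contain the same products (xg)(gy) etc.;
   in their sum everything but 4 (xg)(gy) = 4 (g(xy))g cancels. *)
Lemma gmul_gmul a b x y : A`_[a] x -> A`_[b] y -> ~ Ms a -> ~ Ms b -> Lm (a + b - sg) ->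
  (g ** x) ** (g ** y) = (g ** (x ** y)) ** g.
Proof.
move=> xa yb aM bM abL; have [aL bL] := (nMs_Lm aM, nMs_Lm bM).
have [gaM gbM] := (nMs_sgD aM, nMs_sgD bM); have [gaL gbL] := (nMs_Lm gaM, nMs_Lm gbM).
have [gxa gyb] := (ga_gr_mul gsg xa, ga_gr_mul gsg yb).
have abL' : ~ Lm (a + b).
  by move=> h; apply: sgL; have := sLm.2 _ _ h abL; rewrite opprB addrC subrK.
have gabL : Lm (sg + a + b) by rewrite -addrA addrC sgD_sgB.
have [Wx Wy] := (W_hom xa aL, W_hom yb bL); have [Wgx Wgy] := (W_hom gxa gaL, W_hom gyb gbL).
have Wxy := W_hom (ga_gr_mul xa yb) abL'.
have [sx sy sgg] := And3 (W_star Wx) (W_star Wy) (W_star Wg).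
have cgx := W_comm gsg xa sgL aL gaL; have cgy := W_comm gsg yb sgL bL gbL.
have cxy := W_comm xa yb aL bL abL'.
have cggx := W_comm gsg gxa sgL gaL (nMs_Lm (nMs_sgD gaM)).
have ggL : ~ Lm (sg + a + (sg + b)).
  move=> h; apply: abL'; rewrite (_ : a + b = sg + a + (sg + b) - sg *+ 2); last by zmod.
  exact: sLm.2 _ _ h sg2_Lm.
have cgxgy := W_comm gxa gyb gaL gbL ggL.
have agbL : Lm (a + (sg + b)) by rewrite addrCA addrA.
have t1 : y ** (g ** x) = g ** (x ** y) by rewrite (trilinear_sym gsg xa yb).
have t2 : x ** (g ** y) = g ** (x ** y).
  by rewrite (trilinear_sym xa gsg yb) // -?cgx ?t1 // [a + sg]addrC.
have t3 : (g ** x) ** y = star (g ** (x ** y)).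
  by rewrite -t1 ga_starM sy (W_star Wgx).
have t4 : (g ** y) ** x = star (g ** (x ** y)).
  by rewrite -t2 ga_starM sx (W_star Wgy).
have t5 : (x ** y) ** g = star (g ** (x ** y)).
  by rewrite ga_starM sgg (W_star Wxy).
have Et : E (g ** (x ** y)).
  by apply: E_hom (ga_gr_mul gsg (ga_gr_mul xa yb)) _; rewrite addrA.
have t6 : g ** star (g ** (x ** y)) = (g ** (x ** y)) ** g by apply: WE_comm Et Wg.
have m1 w : W w -> w ** mu = mu ** w by move=> Ww; rewrite -(WE_comm Emu Ww) star_mu.
have m2 : (mu ** x) ** y = mu ** (x ** y).
  by rewrite (W_sesql Emu Wx Wy) m1.
have m2' : (mu ** y) ** x = mu ** (x ** y).
  by rewrite (W_sesql Emu Wy Wx) -cxy m1.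
have m3 : x ** (mu ** y) = mu ** (x ** y).
  by rewrite (W_sesqr Emu Wx Wy) star_mu.
have m4 : y ** (mu ** x) = mu ** (x ** y).
  by rewrite (W_sesqr Emu Wy Wx) star_mu -cxy.
have h1 := herm_triple strA x g y sgg; have h2 := herm_triple strA g x y sgg.
move: h1 h2; rewrite /triple !(ga_starM, sx, sy, sgg) -?(cgx, cgy, cxy).
rewrite ?(m1 _ Wx, m1 _ Wy, m1 _ Wxy) !gmulE.
rewrite !(t1, t2, t3, t4, t5, t6, m2, m2', m3, m4) -?cgxgy -?cggx => h1 h2.
apply: (mulr2n_inj charF_neq2); apply: (mulr2n_inj charF_neq2).
by apply: (add_eqs (esym h1) (esym h2)); zmod.
Qed.

(** Three cases for a + b. Outside M both sides vanish. In the coset of sg it is cyclic invariance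
    after applying star. In [Lambda_minus] write y = g z, so that [gmul_gmul] applies to x and z. *)
Lemma gmul_prodl a b x y : A`_[a] x -> A`_[b] y -> ~ Ms a -> ~ Ms b ->
  (g ** x) ** y = (x ** y) ** g.
Proof.
move=> xa yb aM bM; have [aL bL] := (nMs_Lm aM, nMs_Lm bM).
have gaM := nMs_sgD aM; have gxa := ga_gr_mul gsg xa.
have [abM|abM] := pselect (Ms (a + b)); last first.
  have [e|/eqP h] := eqVneq (x ** y) 0; last by case: abM; apply: nMs_prod xa yb aM bM h.
  have [->|/eqP h] := eqVneq ((g ** x) ** y) 0; first by rewrite e gmul0x.
  case: abM; apply: subgroupDl Ms_subgroup Ms_sg _.
  by rewrite addrA; apply: nMs_prod gxa yb gaM bM h.
have [->|/eqP y0] := eqVneq y 0; first by rewrite !gmulx0 gmul0x.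
have [Wx Wy] := (W_hom xa aL, W_hom yb bL).
case: abM => abL; last first.
  have gabL : Lm (sg + a + b) by rewrite -addrA addrC sgD_sgB.
  have abL' : ~ Lm (a + b).
    by move=> h; apply: sgL; have := sLm.2 _ _ h abL; rewrite opprB addrC subrK.
  have Wxy := W_hom (ga_gr_mul xa yb) abL'.
  have := trilinear_sym gsg xa yb sgL aL bL gabL.
  move/(congr1 (@ga_star _ _ A)); rewrite !ga_starM.
  rewrite (W_star Wg) (W_star Wx) (W_star Wy) (W_comm gsg xa sgL aL (nMs_Lm gaM)).
  by rewrite (W_comm xa yb aL bL abL').
have [z za yE] := gmul_surj yb y0 bM.
have bM' : ~ Ms (b - sg).
  by move=> h; apply: bM; rewrite -(subrK sg b); apply: (subgroupD Ms_subgroup h Ms_sg).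
have azL : Lm (a + (b - sg) - sg).
  rewrite (_ : _ - sg = a + b - sg *+ 2); last by zmod.
  exact: sLm.2 _ _ abL sg2_Lm.
rewrite yE (gmul_gmul xa za aM bM' azL); congr (_ ** g).
apply/esym; rewrite (trilinear_sym xa gsg za aL sgL (nMs_Lm bM')); last first.
  by rewrite (_ : _ + (b - sg) = a + b); [|zmod].
have cgx := W_comm gsg xa sgL aL (nMs_Lm gaM).
rewrite -cgx (trilinear_sym gsg xa za sgL aL (nMs_Lm bM')) //.
by rewrite (_ : _ + (b - sg) = a + b); [|zmod].
Qed.

Lemma gmul_prodr a b x y : A`_[a] x -> A`_[b] y -> ~ Ms a -> ~ Ms b ->
  x ** (g ** y) = g ** (x ** y).
Proof.
move=> xa yb aM bM; have [aL bL] := (nMs_Lm aM, nMs_Lm bM).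
have gbM := nMs_sgD bM; have gyb := ga_gr_mul gsg yb.
have [Wx Wy Wgy] := And3 (W_hom xa aL) (W_hom yb bL) (W_hom gyb (nMs_Lm gbM)).
apply: gstar_inj; rewrite (ga_starM x) (W_star Wgy) (W_star Wx) (gmul_prodl yb xa bM aM).
by rewrite !ga_starM (W_star Wg) (W_star Wx) (W_star Wy).
Qed.

(** If d = g(gx) - (gg)x were nonzero, multiply by its inverse z: [gmul_prodr] moves g out of
    z(g(gx)), leaving g(g(zx)) with zx in E, and this equals (gg)(zx), which is also z((gg)x). So z
    d would be 0 instead of 1. *)
Lemma gmul_sqr a x : A`_[a] x -> ~ Ms a -> g ** (g ** x) = mu ** x.
Proof.
move=> xa aM; have Wx := W_hom xa (nMs_Lm aM).
apply/eqP; rewrite -subr_eq0; apply/eqP; apply: contrapT => y0.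
have yg : A`_[sg + sg + a] (g ** (g ** x) - mu ** x).
  by apply: ggrB; [rewrite -addrA|]; do ?apply: ga_gr_mul.
have [z [zd _ zy _ _]] := inv_gr yg y0; apply: (gone_neq0 y0).
have gaM := nMs_sgD aM; have ggaM := nMs_sgD gaM.
have zM : ~ Ms (- (sg + sg + a)).
  by move/(subgroupN Ms_subgroup); rewrite opprK -addrA.
have Wz := W_hom zd (nMs_Lm zM).
have Ezx : E (z ** x).
  apply: E_hom (ga_gr_mul zd xa) _.
  rewrite opprD subrK -mulr2n; apply: (subgroupN sLm); exact: sg2_Lm.
have e1 : g ** (z ** x) = star (z ** x) ** g.
  by have := WE_comm (E_star Ezx) Wg; rewrite ga_starK.
rewrite -zy gmulBr (gmul_prodr zd (ga_gr_mul gsg xa) zM gaM) (gmul_prodr zd xa zM aM).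
rewrite e1 (W_sesqr (E_star Ezx) Wg Wg) ga_starK (W_sesqr Emu Wz Wx) star_mu.
by rewrite (E_comm Ezx Emu) subrr.
Qed.

Local Notation B := (graded_part (A := A) Ms).
Local Notation X := (graded_part (A := A) (~` Ms)).

Lemma B_ind (P : A -> Prop) : (forall x y, P x -> P y -> P (x + y)) ->
  (forall e, E e -> P e) -> (forall e, E e -> P (e ** g)) -> forall x, B x -> P x.
Proof.
move=> PD PE PEg; apply: graded_part_ind => [||l x [lL|lL] xl].
- by apply: PE; apply: graded_part0.
- exact: PD.
- by apply: PE; apply: E_hom xl lL.
have [e el ->] := Lm_transfer gsg g0 xl sgL lL.
by apply: PEg; apply: E_hom el lL.
Qed.

Lemma X_W x : X x -> W x.
Proof.
move/graded_part_proj => h; apply/graded_part_proj => l lL.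
by apply: h => nM; apply: lL => ll; apply: nM; left.
Qed.

Lemma B_mul b c : B b -> B c -> B (b ** c).
Proof. by apply: graded_part_mul => l m; apply: (subgroupD Ms_subgroup). Qed.
Lemma BX_mul b x : B b -> X x -> X (b ** x).
Proof.
by apply: graded_part_mul => l m lM mM /(subgroupDl Ms_subgroup lM).
Qed.
Lemma E_B e : E e -> B e.
Proof.
move=> /graded_part_proj h; apply/graded_part_proj => l nl; apply: h => ll.
by apply: nl; left.
Qed.
Lemma B_g : B g. Proof. exact: (graded_part_hom Ms_sg gsg). Qed.

Lemma XX_mul x y : X x -> X y -> B (x ** y).
Proof.
move: x; apply: graded_part_ind => [|x x' IH IH' Xy|l x lM xl Xy].
- by rewrite gmul0x => _; apply: graded_part0.
- by rewrite gmulDl -[x ** y]scale1r; apply: graded_partP; [apply: IH|apply: IH'].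
move: y Xy; apply: graded_part_ind => [|y y' IH IH'|m y mM ym].
- by rewrite gmulx0; apply: graded_part0.
- by rewrite gmulDr -[x ** y]scale1r; apply: graded_partP.
have [->|/eqP xy0] := eqVneq (x ** y) 0; first exact: graded_part0.
exact: graded_part_hom (nMs_prod xl ym lM mM xy0) (ga_gr_mul xl ym).
Qed.

Lemma X_prodr x y : X x -> X y -> x ** (g ** y) = g ** (x ** y).
Proof.
move: x; apply: graded_part_ind => [|x x' IH IH' Xy|l x lM xl].
- by rewrite ?(gmul0x, gmulx0).
- by rewrite !gmulE IH ?IH'.
move: y; apply: graded_part_ind => [|y y' IH IH'|m y mM ym].
- by rewrite ?(gmul0x, gmulx0).
- by rewrite !gmulE IH ?IH'.
exact: gmul_prodr xl ym lM mM.
Qed.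

Lemma X_sqr x : X x -> g ** (g ** x) = mu ** x.
Proof.
move: x; apply: graded_part_ind => [|x x' IH IH'|l x lM xl].
- by rewrite ?(gmul0x, gmulx0).
- by rewrite !gmulE IH ?IH'.
exact: gmul_sqr xl lM.
Qed.

Lemma Eg_act e x : E e -> X x -> (e ** g) ** x = star e ** (g ** x).
Proof.
move=> Ee Xx; rewrite (W_sesql Ee Wg (X_W Xx)).
by have := WE_comm (E_star Ee) (X_W (BX_mul B_g Xx)); rewrite ga_starK.
Qed.

(** Checked on A^M = E + E g. Already a = e in E and b = g show why the order reverses: g e =
    star(e) g, which by [Eg_act] acts as x |-> e(gx). *)
Lemma B_act a b x : B a -> B b -> X x -> a ** (b ** x) = (b ** a) ** x.
Proof.
move=> Ba Bb Xx; have Wx := X_W Xx; have Xgx := BX_mul B_g Xx; have Wgx := X_W Xgx.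
move: a Ba; apply: B_ind => [a a' IH IH'|e Ee|e Ee]; first by rewrite !gmulE IH IH'.
  move: b Bb; apply: B_ind => [b b' IH IH'|f Ef|f Ef]; first by rewrite !gmulE IH IH'.
    by rewrite (E_assoc x Ee Ef) (E_comm Ee Ef).
  have -> : (f ** g) ** e = (star e ** f) ** g.
    have := WE_comm (E_star Ee) (EW_mul Ef Wg); rewrite ga_starK => ->.
    exact: (E_assoc g (E_star Ee) Ef).
  rewrite (Eg_act Ef Xx) (Eg_act (E_mul (E_star Ee) Ef) Xx) (E_assoc _ Ee (E_star Ef)).
  by rewrite ga_starM ga_starK (E_comm Ee (E_star Ef)).
move: b Bb; apply: B_ind => [b b' IH IH'|f Ef|f Ef]; first by rewrite !gmulE IH IH'.
  rewrite Eg_act //; last exact: BX_mul (E_B Ef) Xx.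
  rewrite (W_sesqr Ef Wg Wx) (E_assoc _ (E_star Ee) (E_star Ef)) (E_assoc g Ef Ee).
  by rewrite (Eg_act (E_mul Ef Ee) Xx) ga_starM.
rewrite (Eg_act Ee); last by apply: BX_mul => //; apply: B_mul (E_B Ef) B_g.
rewrite (Eg_act Ef Xx) (W_sesqr (E_star Ef) Wg Wgx) ga_starK X_sqr //.
rewrite (W_sesqr Ee (EW_mul Ef Wg) Wg) (W_sesql Ef Wg Wg).
have [Es Em] := (E_star Ee, Emu).
by rewrite (E_comm Em Ef) -(E_assoc _ Es (E_mul Ef Em)) -(E_assoc _ Ef Em).
Qed.

Lemma BX_neq0 l m b x : A`_[l] b -> A`_[m] x -> Ms l -> ~ Ms m ->
  b <> 0 -> x <> 0 -> b ** x <> 0.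
Proof.
move=> bl xm [lL|lL] mM b0 x0; have Wx := W_hom xm (nMs_Lm mM).
  by move=> e; apply: x0; apply: (E_mul_eq0 bl lL b0 Wx e).
have [e el bE] := Lm_transfer gsg g0 bl sgL lL.
have Ee := E_hom el lL; have Xx : X x by apply: (graded_part_hom (X := ~` Ms) mM xm).
rewrite bE (Eg_act Ee Xx) => h; apply: (gmul_neq0 xm x0 mM).
apply: (E_mul_eq0 (ga_gr_star el) lL _ (X_W (BX_mul B_g Xx)) h) => e0.
by apply: b0; rewrite bE -[e]ga_starK e0 gstar0 gmul0x.
Qed.

Lemma B_faithful b : B b -> (forall x, X x -> b ** x = 0) -> b = 0.
Proof.
move=> Bb H; apply: proj_eq0 => l; have [lM|lM] := pselect (Ms l); last first.
  by move/graded_part_proj: Bb; apply.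
have [m [[x xm x0] mM]] := nMs_ex; apply: contrapT => b0.
apply: (BX_neq0 (proj_gr l b) xm lM mM b0 x0).
by rewrite -(projMr _ _ xm) H ?proj0 //; apply: (graded_part_hom (X := ~` Ms) mM xm).
Qed.

(** Both sides act on X in the same way by [B_act], and X is a faithful module. *)
Lemma B_assoc a b c : B a -> B b -> B c -> a ** (b ** c) = (a ** b) ** c.
Proof.
move=> Ba Bb Bc; apply/eqP; rewrite -subr_eq0; apply/eqP; apply: B_faithful => [|x Xx].
  by apply: graded_partB; do ?apply: B_mul.
have [Bab Bbc] := (B_mul Ba Bb, B_mul Bb Bc).
rewrite gmulBl -(B_act Bbc Ba Xx) -(B_act Bc Bb (BX_mul Ba Xx)).
by rewrite -(B_act Bc Bab Xx) -(B_act Bb Ba Xx) subrr.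
Qed.

(** For a = e g the action is y |-> star(e)(gy); sesquilinearity over E and [X_prodr] bring e and g
    out of the product. The element e g lies in W, so it equals its own star. *)
Lemma X_form a x y : B a -> X x -> X y -> x ** (a ** y) = star a ** (x ** y).
Proof.
move=> Ba Xx Xy; have [Wx Wy] := (X_W Xx, X_W Xy).
move: a Ba; apply: B_ind => [a a' IH IH'|e Ee|e Ee].
- by rewrite gstarD !gmulE IH IH'.
- exact: W_sesqr.
have Xgy := BX_mul B_g Xy; rewrite (Eg_act Ee Xy) (W_sesqr (E_star Ee) Wx (X_W Xgy)) ga_starK.
rewrite (X_prodr Xx Xy) (W_star (EW_mul Ee Wg)) B_assoc //; [exact: E_B|exact: B_g|].
exact: XX_mul.
Qed.

Lemma Ms_supp l : Ms l -> supp A l.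
Proof.
move=> [/E_elt[e [el e0]]|lL]; first by exists e.
by rewrite -(subrK sg l) addrC; apply: supp_Lm.
Qed.

Definition skew_par l := `[< supp_minus A l >].

Lemma supp_minus_sub l m : supp_minus A l -> supp_minus A m -> ~ supp_minus A (l - m).
Proof.
move=> [s [sl ss s0]] /supp_minusN [t [tm st t0]] /(star_skew (ga_gr_mul sl tm)).
have hs : skew l s by []; have ht : skew (- m) t by [].
rewrite (skew_prod_star hs ht) => /(opp_fix0 charF_neq2).
by move=> /(skew_mul_eq0 sl ss s0).
Qed.

(** [Lambda_minus] is the disjoint union of S_- and S_- + S_-, so skewness of a degree is a
    homomorphism to Z/2. *)
Lemma skew_parB l m : Lm l -> Lm m -> skew_par (l - m) = skew_par l (+) skew_par m.
Proof.
move=> lL mL; rewrite /skew_par.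
have [sl|[a [b [sa sb lE]]]] := Lm_skew lL; have [sm|[c [d [sc sd mE]]]] := Lm_skew mL.
- by rewrite (asboolT sl) (asboolT sm) asboolF //; apply: supp_minus_sub.
- have nm : ~ supp_minus A m.
    by rewrite mE -[d]opprK; apply: supp_minus_sub => //; apply: supp_minusN.
  rewrite (asboolT sl) (asboolF nm) asboolT // mE opprD.
  by apply: supp_minus3 => //; apply: supp_minusN.
- have nl : ~ supp_minus A l.
    by rewrite lE -[b]opprK; apply: supp_minus_sub => //; apply: supp_minusN.
  rewrite (asboolT sm) (asboolF nl) asboolT // lE -addrA.
  by apply: supp_minus3 => //; apply: supp_minusN.
have nm : ~ supp_minus A m.
    by rewrite mE -[d]opprK; apply: supp_minus_sub => //; apply: supp_minusN.
have nl : ~ supp_minus A l.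
    by rewrite lE -[b]opprK; apply: supp_minus_sub => //; apply: supp_minusN.
rewrite (asboolF nm) (asboolF nl) asboolF // lE mE opprD addrA -[a + b - c]addrA.
by apply: supp_minus_sub => //; apply: supp_minus3 => //; apply: supp_minusN.
Qed.

Definition par1 l := ~~ `[< Lm l >].
(** Extends [skew_par] to M by the value 0 at sg. This is additive because g g is hermitian and
    nonzero, so that 2 sg is not a skew degree. *)
Definition par2 l := if par1 l then skew_par (l - sg) else skew_par l.

Lemma par1B l m : Ms l -> Ms m -> par1 (l - m) = par1 l (+) par1 m.
Proof.
have nLm k : Lm (k - sg) -> ~ Lm k.
  by move=> h h'; apply: sgL; rewrite -(subKr k sg); apply: sLm.2.
rewrite /par1; move=> [lL|lL] [mL|mL].
- by rewrite (asboolT lL) (asboolT mL) asboolT //; apply: sLm.2.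
- rewrite (asboolT lL) (asboolF (nLm _ mL)) asboolF //.
  by move=> h; apply: (nLm _ mL); rewrite -(subKr l m); apply: sLm.2.
- rewrite (asboolT mL) (asboolF (nLm _ lL)) asboolF //.
  by move=> h; apply: (nLm _ lL); apply: (subgroupDr sLm (subgroupN sLm mL)).
rewrite (asboolF (nLm _ lL)) (asboolF (nLm _ mL)) asboolT //.
by rewrite (_ : l - m = l - sg - (m - sg)); [apply: sLm.2|zmod].
Qed.

Lemma skew_par_sg2 : skew_par (sg *+ 2) = false.
Proof.
apply: asboolF => /star_skew h; have := sqr_neq0 gsg g0.
have := ga_gr_mul gsg gsg; rewrite -mulr2n => /h; rewrite star_mu.
by move/(opp_fix0 charF_neq2).
Qed.

Lemma par2B l m : Ms l -> Ms m -> par2 (l - m) = par2 l (+) par2 m.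
Proof.
move=> lM mM; rewrite /par2 par1B //.
have mem k : Ms k -> (par1 k /\ Lm (k - sg)) \/ (par1 k = false /\ Lm k).
  rewrite /par1; case: asboolP => h [kL|kL]; [by right|by right|by []|by left].
have [[-> lL]|[-> lL]] := mem _ lM; have [[-> mL]|[-> mL]] := mem _ mM => /=.
- rewrite -skew_parB //; congr skew_par; zmod.
- by rewrite -skew_parB //; congr skew_par; zmod.
- rewrite -skew_parB // -[RHS]addbF -skew_par_sg2 -skew_parB //; last exact: sg2_Lm.
    by congr skew_par; zmod.
  exact: sLm.2.
by rewrite -skew_parB.
Qed.

Lemma par_star l x : A`_[l] x ->
  star x = if ~~ par1 l && par2 l then - x else x.
Proof.
move=> xl; rewrite /par2 /par1; case: asboolP => lL /=.
  rewrite /skew_par; case: asboolP => h; first exact: star_skew xl h.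
  exact: star_herm xl h.
by apply: star_herm xl _ => /supp_minus_Lm.
Qed.

(** The two parities take the values (0, 1) and (1, 0), so together they map M onto (Z/2)^2. *)
Lemma par_surj : exists k, [/\ Ms k, par1 k = false, par2 k & par1 sg /\ par2 sg = false].
Proof.
have [[k kS] _ _] := c3A; have sL := supp_minus_Lm kS; exists k.
rewrite /par2 /par1 (asboolT sL) (asboolF sgL) subrr /=; split=> //; [by left|exact/asboolP|].
by split=> //; apply: asboolF => h; have := supp_minus_sub h h; rewrite subrr.
Qed.
End Star.
End ClassIII.
End Torus.

(** * Recognition of A(k) *)

Section AssocStructurable.
Variables (F : fieldType) (L : zmodType) (A : gradedInvAlg F L).
Hypothesis mulA : associative (@ga_mul _ _ A).

Lemma assoc_structurable : structurable A.
Proof.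
move=> x y z w q.
rewrite /triple !(gmulDl, gmulDr, gmulBl, gmulBr, gmulNl, gmulNr, gstarD, gstarB,
  gstarN, ga_starM, ga_starK).
rewrite !mulA; zmod.
Qed.

Lemma assoc_invertible (x y : A) : x ** y = one A -> y ** x = one A -> invertible x.
Proof.
move=> xy yx; exists y; split=> // z; first by rewrite !mulA xy yx.
by rewrite -!mulA xy yx.
Qed.
End AssocStructurable.

(** Only one inclusion of components is required of [psi]: it makes [psi] commute with the
    projections, and injectivity yields the other inclusion. *)
Lemma graded_iso_of_inverse (F : fieldType) (L : zmodType) (A A' : gradedInvAlg F L)
    (psi : A' -> A) : inv_alg_iso psi ->
    (forall l x, A'`_[l] x -> A`_[l] (psi x)) -> graded_isomorphic A A'.
Proof.
move=> [lin [phi phiK psiK] psi1 psiM psiS] gr; have inj := can_inj phiK.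
have psi0 : psi 0 = 0 by have := lin (-1) 0 0; rewrite scaler0 addr0 scaleN1r addNr.
have psi_proj l x : psi (proj l x) = proj l (psi x).
  elim/gr_ind: x => [|x y IH IH'|m x xm]; first by rewrite proj0 psi0 proj0.
    have add u w : psi (u + w) = psi u + psi w.
      by have := lin 1 u w; rewrite !scale1r.
    by rewrite projD !add IH IH' projD.
  have [->|lm] := eqVneq l m; first by rewrite !proj_id //; apply: gr.
  by rewrite (proj_neq xm lm) (proj_neq (gr _ _ xm) lm) psi0.
exists phi; first split.
- by move=> c x y; apply: inj; rewrite lin !psiK.
- by exists psi.
- by apply: inj; rewrite psiK psi1.
- by move=> x y; apply: inj; rewrite psiM !psiK.
- by move=> x; apply: inj; rewrite psiS !psiK.
move=> l; rewrite eqEsubset; split=> [_ [x xl <-]|y yl]; last first.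
  by exists (psi y); [apply: gr|rewrite phiK].
suff -> : phi x = proj l (phi x) by apply: proj_gr.
by apply: inj; rewrite psi_proj !psiK proj_id.
Qed.

Section SubgroupClosed.
Variables (L : zmodType) (P : set L) (sP : is_subgroup P).
(** The proof that P is a subgroup is an argument so that the [zmodClosed] instance can be attached
    to the predicate. *)
Definition subgroup_pred of is_subgroup P : {pred L} := fun l => `[< P l >].
Fact subgroup_pred_zmod_closed : zmod_closed (subgroup_pred sP).
Proof.
split=> [|x y /asboolP hx /asboolP hy]; apply/asboolP; first exact: sP.1.
exact: sP.2.
Qed.
HB.instance Definition _ :=
  GRing.isZmodClosed.Build L (subgroup_pred sP) subgroup_pred_zmod_closed.
End SubgroupClosed.

(** * The opposite of the subalgebra A^M *)

Section OppositeSubalgebra.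
Variables (F : fieldType) (L : zmodType) (A : gradedInvAlg F L) (M : zmodClosed L).
Definition Mset : set L := [set l | l \in M].

Definition graded_pred : {pred A} := fun x => `[< graded_part Mset x >].
Lemma graded_predP x : reflect (graded_part Mset x) (x \in graded_pred).
Proof. exact: asboolP. Qed.
Fact graded_pred_closed : submod_closed graded_pred.
Proof.
split=> [|c x y /graded_predP hx /graded_predP hy]; apply/graded_predP.
  exact: graded_part0.
exact: graded_partP.
Qed.
HB.instance Definition _ := GRing.isSubmodClosed.Build F A graded_pred graded_pred_closed.
Definition oppsub_car := {x : A | x \in graded_pred}.
HB.instance Definition _ := SubChoice.on oppsub_car.
HB.instance Definition _ := [SubChoice_isSubLmodule of oppsub_car by <:].
Implicit Types (x y : oppsub_car).

Lemma oppsub_val x : graded_part Mset (val x).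
Proof. exact/graded_predP/valP. Qed.

Fact oppsub_mul_subproof x y : val y ** val x \in graded_pred.
Proof.
apply/graded_predP; apply: graded_part_mul (oppsub_val y) (oppsub_val x) => l m.
exact: rpredD.
Qed.
(* Opposite product, since (a, 0)(b, 0) = (ba, 0) in A(k). *)
Definition oppsub_mul x y : oppsub_car := Sub (val y ** val x) (oppsub_mul_subproof x y).
Fact oppsub_one_subproof : one A \in graded_pred.
Proof.
by apply/graded_predP; apply: (graded_part_hom (X := Mset) _ (@gr_one _ _ A)); apply: rpred0.
Qed.
Definition oppsub_one : oppsub_car := Sub (one A) oppsub_one_subproof.
Fact oppsub_star_subproof x : star (val x) \in graded_pred.
Proof. by apply/graded_predP/graded_part_star/oppsub_val. Qed.
Definition oppsub_star x : oppsub_car := Sub (star (val x)) (oppsub_star_subproof x).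
Definition oppsub_gr (l : subgrp M) : set oppsub_car := [set x | A`_[val l] (val x)].

Lemma oppsub_sum (I : Type) (s : seq I) (P : pred I) (f : I -> oppsub_car) :
  val (\sum_(i <- s | P i) f i) = \sum_(i <- s | P i) val (f i).
Proof. exact: (raddf_sum val). Qed.

Lemma oppsub_valE c x y : val (c *: x + y) = c *: val x + val y.
Proof. by rewrite linearP. Qed.

Fact oppsub_mul_linearl y : linear (oppsub_mul^~ y).
Proof. by move=> c x z; apply: val_inj; rewrite [LHS]SubK !oppsub_valE !SubK ga_mul_linearr. Qed.
Fact oppsub_mul_linearr y : linear (oppsub_mul y).
Proof. by move=> c x z; apply: val_inj; rewrite [LHS]SubK !oppsub_valE !SubK ga_mul_linearl. Qed.
Fact oppsub_mul1x : left_id oppsub_one oppsub_mul.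
Proof. by move=> x; apply: val_inj; rewrite /= ga_mulx1. Qed.
Fact oppsub_mulx1 : right_id oppsub_one oppsub_mul.
Proof. by move=> x; apply: val_inj; rewrite /= ga_mul1x. Qed.
Fact oppsub_star_linear : linear oppsub_star.
Proof. by move=> c x z; apply: val_inj; rewrite [LHS]SubK !oppsub_valE !SubK ga_star_linear. Qed.
Fact oppsub_starK : involutive oppsub_star.
Proof. by move=> x; apply: val_inj; rewrite /= ga_starK. Qed.
Fact oppsub_starM x y :
  oppsub_star (oppsub_mul x y) = oppsub_mul (oppsub_star y) (oppsub_star x).
Proof. by apply: val_inj; rewrite /= ga_starM. Qed.
Fact oppsub_gr0 l : oppsub_gr l 0.
Proof. exact: ga_gr0. Qed.
Fact oppsub_grP l c x y : oppsub_gr l x -> oppsub_gr l y -> oppsub_gr l (c *: x + y).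
Proof.
move=> xl yl; change (A`_[val l] (val (c *: x + y))).
by rewrite oppsub_valE; apply: ga_grP.
Qed.
Fact oppsub_gr_span x : exists2 s : seq oppsub_car,
  forall y, y \in s -> exists l, oppsub_gr l y & x = \sum_(y <- s) y.
Proof.
have pM l : l \in M -> proj l (val x) \in graded_pred.
  by move=> lM; apply/graded_predP/(graded_part_hom (X := Mset) lM)/proj_gr.
have pval (l : subgrp M) := pM _ (valP l).
pose f l : oppsub_car := Sub (proj (val l) (val x)) (pval l).
exists [seq f l | l <- pmap insub (gr_supp (val x))].
  by move=> y /mapP[l _ ->]; exists l; apply: proj_gr.
apply: val_inj; rewrite oppsub_sum big_map {1}[val x]gr_suppE.
elim: (gr_supp _) => [|l s IH]; first by rewrite !big_nil.
rewrite big_cons /=; case: insubP => [u _ uE|lM] /=; first by rewrite big_cons -IH /= uE.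
have /graded_part_proj h := oppsub_val x.
by rewrite h ?add0r // /Mset /= => h'; rewrite h' in lM.
Qed.
Fact oppsub_gr_indep (s : seq (subgrp M)) (f : subgrp M -> oppsub_car) : uniq s ->
    (forall l, oppsub_gr l (f l)) -> \sum_(l <- s) f l = 0 ->
  forall l, l \in s -> f l = 0.
Proof.
move=> us fg sum0 l ls; apply: val_inj.
have : proj (val l) (val (\sum_(m <- s) f m)) = 0 by rewrite sum0 (raddf0 val) proj0.
rewrite oppsub_sum raddf_sum (bigD1_seq l) //= (proj_id (fg l)) big1 ?addr0 //.
by move=> m ml; apply: (proj_neq (fg m)); rewrite (inj_eq val_inj) eq_sym.
Qed.
Fact oppsub_gr_mul l m x y :
  oppsub_gr l x -> oppsub_gr m y -> oppsub_gr (l + m) (oppsub_mul x y).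
Proof. by move=> xl ym; rewrite addrC; apply: ga_gr_mul. Qed.
Fact oppsub_gr_star l x : oppsub_gr l x -> oppsub_gr l (oppsub_star x).
Proof. exact: ga_gr_star. Qed.

Definition oppsub : gradedInvAlg F (subgrp M) :=
  @GradedInvAlg F _ oppsub_car oppsub_mul oppsub_one oppsub_star oppsub_gr
    oppsub_mul_linearl oppsub_mul_linearr oppsub_mul1x oppsub_mulx1
    oppsub_star_linear oppsub_starK oppsub_starM oppsub_gr0 oppsub_grP
    oppsub_gr_span oppsub_gr_indep oppsub_gr_mul oppsub_gr_star.
End OppositeSubalgebra.

Lemma odd_absz_sub (x y : int) : odd (absz x) = odd (absz y) ->
  x - y = divz (x - y) 2 + divz (x - y) 2.
Proof. lia. Qed.

(** * Representatives modulo M *)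

Section CosetRepresentatives.
Variables (L : zmodType) (M : zmodClosed L).
Hypothesis freeL : free_abelian_of_finite_rank L.
Hypothesis M2 : forall l : L, l *+ 2 \in M.

Lemma incongruent_subseq (P : set L) (s : seq L) : (forall a, a \in s -> P a) ->
  exists t : seq L, [/\ forall a, a \in t -> P a,
    pairwise (fun a b => a - b \notin M) t &
    forall a, a \in s -> exists2 b, b \in t & a - b \in M].
Proof.
elim: s => [|a s IH] Ps; first by exists [::].
have [|t [Pt pt st]] := IH; first by move=> b bs; apply: Ps; rewrite inE bs orbT.
have [[b bt abM]|nab] := pselect (exists2 b, b \in t & a - b \in M).
  exists t; split=> // c; rewrite inE => /orP[/eqP ->|/st//]; by exists b.
exists (a :: t); split=> [c|/=|c].
- by rewrite inE => /orP[/eqP ->|/Pt//]; apply: Ps; rewrite mem_head.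
- rewrite pt andbT; apply/allP => b bt; apply/negP => abM; apply: nab.
  by exists b.
rewrite inE => /orP[/eqP ->|/st[b bt cbM]].
  by exists a; rewrite ?mem_head // subrr rpred0.
by exists b; rewrite // inE bt orbT.
Qed.

(** As M contains 2 Lambda, elements whose coordinates have equal parities are congruent modulo M.
    One element of P is chosen for each of the finitely many parity vectors that occur, and the list
    is thinned out until it is pairwise incongruent. *)
Lemma coset_reps (P : set L) : exists t : seq L, [/\ forall a, a \in t -> P a,
    pairwise (fun a b => a - b \notin M) t &
    forall a, P a -> exists2 b, b \in t & a - b \in M].
Proof.
have [n [f [f' fK f'K]]] := freeL.
pose par a : {ffun 'I_n -> bool} := [ffun i => odd (absz (f a 0 i))].
have parM a b : par a = par b -> a - b \in M.
  move=> /ffunP e; pose w : 'rV[int]_n := \row_i divz (f a 0 i - f b 0 i) 2.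
  suff -> : a - b = f' w *+ 2 by [].
  apply: (can_inj fK); rewrite raddfB raddfMn f'K; apply/rowP => i.
  by have := e i; rewrite !ffunE mulr2n !mxE => /odd_absz_sub.
pose r c := if pselect (exists a, P a /\ par a = c) is left e then Some (sval (cid e)) else None.
pose s := pmap r (enum {: {ffun 'I_n -> bool}}).
have [|t [Pt pt st]] := @incongruent_subseq P s.
  move=> a; rewrite mem_pmap => /mapP[c _]; rewrite /r; case: pselect => // e [->].
  by have [] := svalP (cid e).
exists t; split=> // a Pa.
have [e rE pe] : exists2 e, r (par a) = Some e & par e = par a.
  rewrite /r; case: pselect => [e|[]]; last by exists a.
  by exists (sval (cid e)) => //; have [] := svalP (cid e).
have [|b bt ebM] := st e; first by rewrite mem_pmap -rE map_f // mem_enum.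
exists b => //; rewrite (_ : a - b = a - e + (e - b)); last by zmod.
by apply: rpredD ebM; apply: parM; rewrite pe.
Qed.
End CosetRepresentatives.

(** * Coordinatization by a diagonal hermitian form *)

Section Coordinates.
Variables (F : fieldType) (L : zmodType) (A : gradedInvAlg F L) (M : zmodClosed L).
Hypothesis torA : structurable_torus A.
Hypothesis freeL : free_abelian_of_finite_rank L.
Hypothesis M2 : forall l : L, l *+ 2 \in M.
Hypothesis Msupp : forall l, l \in M -> supp A l.
Local Notation inB := (graded_part (A := A) (Mset M)).
Local Notation inX := (graded_part (A := A) (~` (Mset M))).
Hypothesis B_assoc : forall a b c, inB a -> inB b -> inB c ->
  a ** (b ** c) = (a ** b) ** c.
Hypothesis B_act : forall a b x, inB a -> inB b -> inX x ->
  a ** (b ** x) = (b ** a) ** x.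
Hypothesis X_star : forall x, inX x -> star x = x.
Hypothesis X_form : forall a x y, inB a -> inX x -> inX y ->
  x ** (a ** y) = star a ** (x ** y).
Hypothesis X_prod : forall a b x y, A`_[a] x -> A`_[b] y -> a \notin M ->
  b \notin M -> x ** y <> 0 -> a + b \in M.
Hypothesis BX_neq0 : forall l m b x, A`_[l] b -> A`_[m] x -> l \in M ->
  m \notin M -> b <> 0 -> x <> 0 -> b ** x <> 0.
Hypothesis X_ex : exists a, supp A a /\ a \notin M.

Local Notation B0 := (oppsub A M).

Lemma oppsub_elt l x (lM : l \in M) : A`_[l] x -> x \in @graded_pred _ _ A M.
Proof. by move=> xl; apply/graded_predP; apply: (graded_part_hom (X := Mset M) lM xl). Qed.

Fact oppsub_assoc : associative (@ga_mul _ _ B0).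
Proof.
move=> x y z; apply: val_inj; rewrite /= -B_assoc //; exact: oppsub_val.
Qed.

Fact oppsub_torus : structurable_torus B0.
Proof.
split; first exact: assoc_structurable oppsub_assoc.
- move=> l [x xl x0]; exists x => // y yl.
  have x0' : val x <> 0 by move=> e; apply: x0; apply: val_inj.
  have [c yE] := gr_line torA xl x0' yl; exists c; apply: val_inj.
  by rewrite yE linearZ.
- move=> l x xl x0; have x0' : val x <> 0 by move=> e; apply: x0; apply: val_inj.
  have [z [zl xz zx _ _]] := inv_gr torA xl x0'.
  have zB : z \in @graded_pred _ _ A M by apply: oppsub_elt zl; rewrite rpredN; apply: valP.
  apply: (@assoc_invertible _ _ _ oppsub_assoc x (Sub z zB)); exact: val_inj.
rewrite eqEsubset; split=> // l _; apply: sub_generated.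
have [x xl x0] := Msupp (valP l).
by exists (Sub x (oppsub_elt (valP l) xl)) => // /(congr1 val).
Qed.

Definition coordB : assocTorus F (subgrp M) := AssocTorus oppsub_torus oppsub_assoc.

Lemma extend_coordB l (x : coordB) :
  (extend coordB)`_[l] x <-> (if l \in M then A`_[l] (val x) else x = 0).
Proof.
rewrite /=; case: (extendP coordB l) => [s ->|/negbTE ->] //.
by rewrite (valP s).
Qed.

Definition creps : seq L :=
  sval (cid (coset_reps freeL M2 [set a | supp A a /\ a \notin M])).
Lemma crepsP : [/\ forall a, a \in creps -> supp A a /\ a \notin M,
    pairwise (fun a b => a - b \notin M) creps &
    forall a, supp A a -> a \notin M -> exists2 b, b \in creps & a - b \in M].
Proof.
have [h1 h2 h3] := svalP (cid (coset_reps freeL M2 [set a | supp A a /\ a \notin M])).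
by split=> // a sa aM; apply: h3.
Qed.

Definition crho (i : 'I_(size creps)) : L := nth 0 creps i.
Lemma crho_mem i : crho i \in creps. Proof. exact: mem_nth. Qed.
Lemma crho_supp i : supp A (crho i).
Proof. by have [/(_ _ (crho_mem i))[]] := crepsP. Qed.
Lemma crho_notin i : crho i \notin M.
Proof. by have [/(_ _ (crho_mem i))[]] := crepsP. Qed.
Definition cbasis i : A := s2val (cid2 (crho_supp i)).
Local Notation v := cbasis.
Lemma cbasis_gr i : A`_[crho i] (v i).
Proof. exact: (s2valP (cid2 (crho_supp i))). Qed.
Lemma cbasis_neq0 i : v i <> 0.
Proof. exact: (s2valP' (cid2 (crho_supp i))). Qed.
Lemma cbasis_X i : inX (v i).
Proof.
by apply: (graded_part_hom (X := ~` (Mset M)) _ (cbasis_gr i)) => /=; apply/negP/crho_notin.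
Qed.

Lemma cbasis_sqr_gr i : A`_[crho i *+ 2] (v i ** v i).
Proof. by rewrite mulr2n; apply: ga_gr_mul; apply: cbasis_gr. Qed.
Definition cform i : coordB := Sub (v i ** v i) (oppsub_elt (M2 _) (cbasis_sqr_gr i)).

Fact cform_gr i : (extend coordB)`_[crho i *+ 2] (cform i).
Proof. by apply/extend_coordB; rewrite M2; apply: cbasis_sqr_gr. Qed.
Fact cform_neq0 i : cform i <> 0.
Proof.
by move=> /(congr1 val); apply: (sqr_neq0 torA (cbasis_gr i)); apply: cbasis_neq0.
Qed.
Fact creps_gt0 : (0 < size creps)%N.
Proof.
have [a [sa aM]] := X_ex; have [_ _ /(_ a sa aM)[b bt _]] := crepsP.
by case: creps bt.
Qed.
Fact crho_generated : generated ([set x | x \in M] `|` range crho) = setT.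
Proof.
have sG := generated_subgroup ([set x | x \in M] `|` range crho).
have [_ _ _ gen] := torA; rewrite eqEsubset; split=> // l _.
have : generated (supp A) l by rewrite gen.
move: l; apply: (generated_min sG) => a sa.
have [aM|aM] := boolP (a \in M); first by apply: sub_generated; left.
have [_ _ /(_ a sa aM)[b bt abM]] := crepsP.
rewrite -(subrK b a); apply: (subgroupD sG); apply: sub_generated; first by left.
have ib : (index b creps < size creps)%N by rewrite index_mem.
by right; exists (Ordinal ib) => //; rewrite /crho /= nth_index.
Qed.
Fact crho_diff i j : i != j -> crho i - crho j \notin M.
Proof.
have [_ /(pairwiseP 0) h _] := crepsP.
have H (k l : 'I_(size creps)) : (k < l)%N -> crho k - crho l \notin M.
  by move=> kl; apply: h kl; rewrite inE.
rewrite neq_ltn => /orP[/H//|/H]; by rewrite -opprB rpredN.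
Qed.
Fact crho_plus i : supp_plus (extend coordB) (crho i *+ 2).
Proof.
exists (cform i); split; [exact: cform_gr| |exact: cform_neq0].
by apply: val_inj; rewrite /= ga_starM (X_star (cbasis_X i)).
Qed.

Definition coordk : diagForm coordB :=
  DiagForm creps_gt0 crho_notin crho_generated crho_diff crho_plus cform_gr cform_neq0.

Local Notation K := (Ak coordk).

Lemma inB_val (b : coordB) : inB (val b).
Proof. exact: oppsub_val. Qed.
Lemma inX_mul (b : coordB) x : inX x -> inX (val b ** x).
Proof.
apply: graded_part_mul (inB_val b) => l m /= lM mM lmM; apply: mM.
by rewrite /Mset /= in lM lmM *; rewrite -(addKr l m) rpredD // rpredN.
Qed.

(** The isomorphism is constructed from A(k) to A, the direction in which it has a formula. *)
Definition decoord (x : K) : A := val x.1 + \sum_i val (x.2 i) ** v i.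

Fact decoord_linear : linear decoord.
Proof.
move=> c x y; rewrite /decoord scalerDr addrACA scaler_sumr -big_split /=.
congr (_ + _).
apply: eq_bigr => i _; rewrite -ga_mul_linearl; congr (_ ** _).
by rewrite !ffunE; apply: (oppsub_valE c (x.2 i) (y.2 i)).
Qed.
HB.instance Definition _ := GRing.isLinear.Build F K A *:%R decoord decoord_linear.

Lemma decoord1 : decoord (one K) = one A.
Proof.
rewrite /decoord /= big1 ?addr0 // => i _.
by rewrite ffunE gmul0x.
Qed.

Lemma coset_B_comm (b : coordB) x : inX x -> x ** val b = star (val b) ** x.
Proof.
move=> Xx; rewrite -{1}(X_star Xx) -[val b in LHS]ga_starK -ga_starM.
exact: X_star (inX_mul (star b) Xx).
Qed.

(** A nonzero v_i v_j would put the sum of the two degrees in M, hence, 2 Lambda being in M, also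
    their difference. *)
Lemma cbasis_orth i j : i != j -> v i ** v j = 0.
Proof.
move=> ij; apply: contrapT => vv.
have := X_prod (cbasis_gr i) (cbasis_gr j) (crho_notin i) (crho_notin j) vv.
apply/negP; rewrite (_ : crho i + crho j = crho i - crho j + crho j *+ 2); last by zmod.
apply: contra (crho_diff ij) => h.
by rewrite -(addrK (crho j *+ 2) (_ - _)) rpredB.
Qed.

(** Read in the opposite product, the value for i = j is the summand (a b_i) star(b) of [herm]. *)
Lemma decoord_form i j (a b : coordB) :
  (val a ** v i) ** (val b ** v j) =
  if i == j then star (val b) ** ((v i ** v i) ** val a) else 0.
Proof.
have [Xi Xj] := (cbasis_X i, cbasis_X j); have Xai := inX_mul a Xi.
rewrite X_form //; last exact: inB_val.
have -> : (val a ** v i) ** v j = (v i ** v j) ** val a.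
  apply: gstar_inj; rewrite ga_starM (X_star Xai) (X_star Xj) X_form //; last exact: inB_val.
  by rewrite !ga_starM (X_star Xi) (X_star Xj).
by case: eqVneq => [<-//|/cbasis_orth ->]; rewrite gmul0x gmulx0.
Qed.

Lemma decoordM : {morph decoord : x y / x ** y}.
Proof.
move=> [a x] [b y]; pose p : K := ((a, x) : K) ** ((b, y) : K).
have e1 : val p.1 = val a ** val b +
    (\sum_i val (x i) ** v i) ** (\sum_i val (y i) ** v i).
  transitivity (val a ** val b + val (herm x y)); first exact: (raddfD val).
  congr (_ + _); rewrite /herm oppsub_sum gmul_suml; apply: eq_bigr => i _.
  rewrite gmul_sumr (bigD1 i) //= big1 ?addr0 => [|j ji].
    by rewrite decoord_form eqxx.
  by rewrite decoord_form eq_sym (negbTE ji).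
have e2 i : val (p.2 i) = val (y i) ** val a + val (x i) ** star (val b).
  by rewrite !ffunE; apply: (raddfD val).
have e3 i : (val (y i) ** val a) ** v i = val a ** (val (y i) ** v i).
  by rewrite B_act //; [exact: inB_val|exact: inB_val|exact: cbasis_X].
have e4 i : (val (x i) ** star (val b)) ** v i = (val (x i) ** v i) ** val b.
  rewrite coset_B_comm; last exact/inX_mul/cbasis_X.
  rewrite B_act //; [exact: graded_part_star (inB_val b)|exact: inB_val|exact: cbasis_X].
have -> : decoord p = val p.1 +
    \sum_i (val a ** (val (y i) ** v i) + (val (x i) ** v i) ** val b).
  congr (_ + _); apply: eq_bigr => i _; rewrite -e3 -e4 -gmulDl; congr (_ ** _).
  exact: e2.
by rewrite e1 big_split /= -gmul_sumr -gmul_suml /decoord /= !gmulE; zmod.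
Qed.

Lemma decoord_star : {morph decoord : x / star x}.
Proof.
move=> [a x]; rewrite /decoord /= gstarD gstar_sum; congr (_ + _).
by apply: eq_bigr => i _; rewrite X_star //; apply/inX_mul/cbasis_X.
Qed.

Lemma decoord_gr l (x : K) : K`_[l] x -> A`_[l] (decoord x).
Proof.
move=> [/extend_coordB x1 x2]; apply: ggrD.
  by case: ifP x1 => // _ ->; apply: ga_gr0.
apply: ggr_sum => i; have := x2 i; move/extend_coordB; case: ifP => _ => [xi|->].
  by rewrite -(subrK (crho i) l); apply: ga_gr_mul xi (cbasis_gr i).
by rewrite gmul0x; apply: ga_gr0.
Qed.

Lemma proj_inB l (b : coordB) : l \notin M -> proj l (val b) = 0.
Proof. by move=> lM; have /graded_part_proj := inB_val b; apply; apply/negP. Qed.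

Lemma decoord_eq0 (x : K) : decoord x = 0 -> x = 0.
Proof.
case: x => a u e.
have p l : proj l (val a) + \sum_i proj l (val (u i) ** v i) = 0.
  by rewrite -(raddf_sum (proj l)) -projD [X in proj l X]e proj0.
have pv l i : proj l (val (u i) ** v i) = proj (l - crho i) (val (u i)) ** v i.
  by rewrite -{1}(subrK (crho i) l) (projMr _ _ (cbasis_gr i)).
have a0 : a = 0.
  apply: val_inj; apply: proj_eq0 => l; have [lM|/proj_inB -> //] := boolP (l \in M).
  rewrite -[LHS]addr0 -[RHS](p l); congr (_ + _); rewrite big1 // => i _.
  rewrite pv proj_inB ?gmul0x //; apply: contra (crho_notin i) => h.
  by rewrite -(subKr l (crho i)) rpredB.
have u0 : u = 0.
  apply/ffunP => i; rewrite ffunE; apply: val_inj; apply: proj_eq0 => l.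
  have [lM|/proj_inB -> //] := boolP (l \in M).
  apply: contrapT => h.
  apply: (BX_neq0 (proj_gr _ _) (cbasis_gr i) lM (crho_notin i) h (@cbasis_neq0 i)).
  (* In degree l + rho_i, which is outside M, only the i-th summand survives, since the rho are
     incongruent modulo M. *)
  have := p (l + crho i); rewrite proj_inB ?add0r => [|]; last first.
    apply: contra (crho_notin i) => h'; by rewrite -(addKr l (crho i)) rpredD // rpredN.
  rewrite (bigD1 i) //= big1 ?addr0 => [|j ji]; first by rewrite pv addrK.
  rewrite pv proj_inB ?gmul0x //; rewrite eq_sym in ji; apply: contra (crho_diff ji) => h'.
  have -> : crho i - crho j = (l + crho i - crho j) - l by zmod.
  exact: rpredB.
by rewrite a0 u0.
Qed.

Lemma decoord_surj y : exists x : K, decoord x = y.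
Proof.
elim/gr_ind: y => [|y z [x <-] [x' <-]|l y yl]; first by exists 0; rewrite raddf0.
  by exists (x + x'); rewrite raddfD.
have [lM|lM] := boolP (l \in M).
  exists (Sub y (oppsub_elt lM yl), 0); rewrite /decoord /= big1 ?addr0 // => i _.
  by rewrite ffunE gmul0x.
have [->|/eqP y0] := eqVneq y 0; first by exists 0; rewrite raddf0.
have [_ _ H] := crepsP; have [|r rt lrM] := H l _ lM; first by exists y.
have ir : (index r creps < size creps)%N by rewrite index_mem.
pose i := Ordinal ir; have rE : crho i = r by rewrite /crho /= nth_index.
have [b bl b0] := Msupp lrM; rewrite -rE in bl lrM.
have bvl := ga_gr_mul bl (cbasis_gr i); rewrite subrK in bvl.
have bv0 := BX_neq0 bl (cbasis_gr i) lrM (crho_notin i) b0 (@cbasis_neq0 i).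
have [c yE] := gr_line torA bvl bv0 yl.
have bB : c *: b \in @graded_pred _ _ A M by apply: oppsub_elt lrM _; apply: ggrZ.
exists (0, [ffun j => if j == i then Sub (c *: b) bB else 0]).
rewrite /decoord /= (bigD1 i) //= big1 => [|j /negbTE ji]; last first.
  by rewrite ffunE ji gmul0x.
by rewrite ffunE eqxx /= addr0 add0r yE gmulZl.
Qed.

Theorem coordinatization : graded_isomorphic A (Ak coordk).
Proof.
apply: (@graded_iso_of_inverse _ _ _ _ decoord); last exact: decoord_gr.
split; [exact: decoord_linear| |exact: decoord1|exact: decoordM|exact: decoord_star].
have inj : injective decoord.
  move=> x y e; apply/eqP; rewrite -subr_eq0; apply/eqP; apply: decoord_eq0.
  by rewrite raddfB /= e subrr.
pose g y := sval (cid (decoord_surj y)).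
have gK y : decoord (g y) = y by exact: svalP (cid (decoord_surj y)).
by exists g => // x; apply: inj; rewrite gK.
Qed.
End Coordinates.

(** * Recognition of C_*(2) (x) P(r) *)

Section LinearExtension.
Variables (F : fieldType) (G : zmodType) (V : lmodType F) (v : G -> V).
Implicit Types x y : grpalg F G.

Definition linext x : V := \sum_(a <- monalg.msupp x) lcoef x a *: v a.

Lemma linext_widen (d : seq G) x : uniq d -> {subset monalg.msupp x <= d} ->
  linext x = \sum_(a <- d) lcoef x a *: v a.
Proof.
move=> ud sub; apply: sum_widen ud sub _ => // [|a ax]; first exact: fset_uniq.
by have := monalg.mcoeff_outdom ax; rewrite -/(lcoef _ _) => ->; rewrite scale0r.
Qed.

Fact linext_linear : linear linext.
Proof.
move=> c x y; pose d := undup (monalg.msupp x ++ (monalg.msupp y ++ monalg.msupp (c *: x + y))).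
have ud := undup_uniq (monalg.msupp x ++ (monalg.msupp y ++ monalg.msupp (c *: x + y))).
rewrite !(@linext_widen d) //; try by move=> a ax; rewrite mem_undup !mem_cat ax ?orbT.
rewrite scaler_sumr -big_split; apply: eq_bigr => a _ /=.
by rewrite lcoefD lcoefZ scalerDl scalerA.
Qed.
HB.instance Definition _ := GRing.isLinear.Build F (grpalg F G) V *:%R linext linext_linear.

Lemma linextU c a : linext (lterm c a) = c *: v a.
Proof.
rewrite (@linext_widen [:: a]) ?big_seq1 ?lcoefU ?eqxx //.
move=> b; have [->|ab] := eqVneq b a; first by rewrite mem_head.
by rewrite -monalg.mcoeff_neq0 -/(lcoef _ _) lcoefU [a == b]eq_sym (negbTE ab) eqxx.
Qed.
End LinearExtension.

Section Glue.
Variables (F : fieldType) (L : zmodType) (A : gradedInvAlg F L) (V : lmodType F).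
Variables (phi : L -> A -> V) (phi_lin : forall l, linear (phi l)).

(** Assembles a map prescribed degree by degree; this is how a bilinear map is factored through the
    tensor product in [tens_universal]. *)
Definition glue (x : A) : V := \sum_(l <- gr_supp x) phi l (proj l x).

Lemma glue_phi0 l : phi l 0 = 0.
Proof. by have := phi_lin l (-1) 0 0; rewrite scaler0 addr0 scaleN1r addNr. Qed.

Lemma glue_widen (d : seq L) x : uniq d -> {subset gr_supp x <= d} ->
  glue x = \sum_(l <- d) phi l (proj l x).
Proof.
have [_ us s0 _] := gr_compP x.
move=> ud sub; apply: sum_widen ud sub _ => // l ls.
by rewrite /proj s0 // glue_phi0.
Qed.

Lemma glue_linear : linear glue.
Proof.
move=> c x y; pose d := undup (gr_supp x ++ (gr_supp y ++ gr_supp (c *: x + y))).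
have ud := undup_uniq (gr_supp x ++ (gr_supp y ++ gr_supp (c *: x + y))).
rewrite !(@glue_widen d) //; try by move=> a ax; rewrite mem_undup !mem_cat ax ?orbT.
rewrite scaler_sumr -big_split; apply: eq_bigr => a _ /=.
by rewrite projD projZ phi_lin.
Qed.

Lemma glue_hom l x : A`_[l] x -> glue x = phi l x.
Proof.
move=> xl; rewrite (@glue_widen (undup (l :: gr_supp x))) ?undup_uniq //; last first.
  by move=> m mx; rewrite mem_undup inE mx orbT.
rewrite (bigD1_seq l) ?undup_uniq ?mem_undup ?mem_head //= proj_id // big1 ?addr0 //.
by move=> m ml; rewrite (proj_neq xl ml) glue_phi0.
Qed.
End Glue.

Definition oddz (x : int) : bool := odd (absz x).
Lemma oddzD x y : oddz (x + y) = oddz x (+) oddz y. Proof. rewrite /oddz; lia. Qed.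
Lemma oddzN x : oddz (- x) = oddz x. Proof. rewrite /oddz; lia. Qed.

Lemma assoc_torus_mul_neq0 (F : fieldType) (L : zmodType) (A : gradedInvAlg F L)
    (torA : structurable_torus A) (mulA : associative (@ga_mul _ _ A)) l (x y : A) :
  A`_[l] x -> x <> 0 -> y <> 0 -> x ** y <> 0.
Proof.
move=> xl x0 y0 xy; apply: y0; have [z [_ _ zx _ _]] := inv_gr torA xl x0.
by rewrite -[y]ga_mul1x -zx -mulA xy gmulx0.
Qed.

Lemma divz_double0 (x : int) : divz (x + x + 0) 2 = x. Proof. lia. Qed.
Lemma divz_double1 (x : int) : divz (x + x + 1) 2 = x. Proof. lia. Qed.
Lemma divzK0 (x : int) : oddz x = oddz 0 -> divz x 2 + divz x 2 + 0 = x.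
Proof. rewrite /oddz; lia. Qed.
Lemma divzK1 (x : int) : oddz x = oddz 1 -> divz x 2 + divz x 2 + 1 = x.
Proof. rewrite /oddz; lia. Qed.

Lemma pair_mulz (U V : zmodType) (x : U) (y : V) (n : int) :
  (x, y) *~ n = (x *~ n, y *~ n) :> (U * V)%type.
Proof.
have h1 : ((x, y) *~ n).1 = x *~ n by apply: (raddfMz fst).
have h2 : ((x, y) *~ n).2 = y *~ n by apply: (raddfMz snd).
by rewrite -h1 -h2; case: (_ *~ _).
Qed.

Lemma ord2_ind (P : 'I_2 -> Prop) : P 0 -> P 1 -> forall i, P i.
Proof. by move=> P0 P1 [[|[|//]] h]; [move: P0|move: P1]; congr P; apply: val_inj. Qed.

(** * Homogeneous components of the quaternion algebra *)

Section Halves.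
Variable F : fieldType.
Local Notation d1 := (delta_mx 0 0 : 'rV[int]_2).
Local Notation d2 := (delta_mx 0 1 : 'rV[int]_2).
Implicit Types (l m d : 'rV[int]_2).

Definition half l : 'rV[int]_2 := \row_j divz (l 0 j) 2.
Definition bits d := forall j, d 0 j = 0 \/ d 0 j = 1.

Lemma bits0 : bits 0. Proof. by move=> j; rewrite mxE; left. Qed.
Lemma bits1 : bits d1. Proof. by move=> j; elim/ord2_ind: j; rewrite !mxE /=; [right|left]. Qed.
Lemma bits2 : bits d2. Proof. by move=> j; elim/ord2_ind: j; rewrite !mxE /=; [left|right]. Qed.
Lemma bits12 : bits (d1 + d2). Proof. by move=> j; elim/ord2_ind: j; rewrite !mxE /=; right. Qed.

Lemma half_double m d : bits d -> half (m *+ 2 + d) = m.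
Proof.
move=> bd; apply/rowP => j; rewrite !mxE mulr2n ?mxE.
by have [->|->] := bd j; [apply: divz_double0|apply: divz_double1].
Qed.
Lemma oddz_double_add m d j : oddz ((m *+ 2 + d) 0 j) = oddz (d 0 j).
Proof. by rewrite mxE oddzD mulr2n ?mxE oddzD addbb. Qed.
Lemma halfK l d : bits d -> (forall j, oddz (l 0 j) = oddz (d 0 j)) -> half l *+ 2 + d = l.
Proof.
move=> bd ld; apply/rowP => j; have := ld j; rewrite !mxE mulr2n ?mxE.
by have [->|->] := bd j; [apply: divzK0|apply: divzK1].
Qed.

Lemma supported_line l d (x : grpalg F 'rV[int]_2) : bits d ->
    supported [set m | m *+ 2 + d = l] x -> x = lcoef x (half l) *: lterm 1 (half l).
Proof.
move=> bd sx; apply: grpalgP => a; rewrite lcoefZ lcoefU.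
case: eqVneq => [->|ne]; first by rewrite mulr1.
rewrite mulr0; apply/eqP; apply: contraNT ne => nz; have /= <- := sx _ nz.
by rewrite half_double.
Qed.

Lemma supported_eq0 l d (x : grpalg F 'rV[int]_2) j :
  supported [set m | m *+ 2 + d = l] x -> oddz (l 0 j) != oddz (d 0 j) -> x = 0.
Proof.
move=> sx ne; apply: grpalgP => a; rewrite lcoef0; apply/eqP; apply: contraNT ne => nz.
by have /= <- := sx _ nz; rewrite oddz_double_add.
Qed.

(** The monomial of degree l = 2 m + d with coordinates of d in {0, 1}: m = [half l] is the exponent
    of the central factor, and d selects the word in the generators. *)
Definition quat_elt l : C2alg F :=
  let X : grpalg F 'rV[int]_2 := lterm 1 (half l) in
  match oddz (l 0 0), oddz (l 0 1) with
  | false, false => (X, 0, 0, 0)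
  | true, false => (0, X, 0, 0)
  | false, true => (0, 0, X, 0)
  | true, true => (0, 0, 0, X)
  end.

Lemma quat_elt_gr l : (C2alg F)`_[l] (quat_elt l).
Proof.
have s0 := @supported0 F 'rV[int]_2; rewrite /quat_elt.
case h0: (oddz (l 0 0)); case h1: (oddz (l 0 1)); split=> //; apply: supportedU => /=.
- by apply: halfK bits12 _; apply: ord2_ind; rewrite !mxE.
- by apply: halfK bits1 _; apply: ord2_ind; rewrite !mxE.
- by apply: halfK bits2 _; apply: ord2_ind; rewrite !mxE.
by rewrite -[RHS](halfK bits0) ?addr0 //; apply: ord2_ind; rewrite !mxE.
Qed.

Lemma quat_line l x : (C2alg F)`_[l] x -> exists c, x = c *: quat_elt l.
Proof.
have E (c : F) (x0 x1 x2 x3 : grpalg F 'rV[int]_2) :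
  c *: ((x0, x1, x2, x3) : C2alg F) = (c *: x0, c *: x1, c *: x2, c *: x3) by [].
move: x => [[[x0 x1] x2] x3] [s0 s1 s2 s3].
have s0' : supported [set m | m *+ 2 + 0 = l] x0 by move=> a /s0 /=; rewrite addr0.
rewrite /quat_elt; case h0: (oddz (l 0 0)); case h1: (oddz (l 0 1)).
- rewrite (supported_eq0 (j := 0) s0') ?h0 ?mxE // (supported_eq0 (j := 1) s1) ?h1 ?mxE //.
  rewrite (supported_eq0 (j := 0) s2) ?h0 ?mxE //; exists (lcoef x3 (half l)).
  by rewrite E !scaler0 {1}(supported_line bits12 s3).
- rewrite (supported_eq0 (j := 0) s0') ?h0 ?mxE // (supported_eq0 (j := 0) s2) ?h0 ?mxE //.
  rewrite (supported_eq0 (j := 1) s3) ?h1 ?mxE //; exists (lcoef x1 (half l)).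
  by rewrite E !scaler0 {1}(supported_line bits1 s1).
- rewrite (supported_eq0 (j := 1) s0') ?h1 ?mxE // (supported_eq0 (j := 1) s1) ?h1 ?mxE //.
  rewrite (supported_eq0 (j := 0) s3) ?h0 ?mxE //; exists (lcoef x2 (half l)).
  by rewrite E !scaler0 {1}(supported_line bits2 s2).
rewrite (supported_eq0 (j := 0) s1) ?h0 ?mxE // (supported_eq0 (j := 1) s2) ?h1 ?mxE //.
rewrite (supported_eq0 (j := 1) s3) ?h1 ?mxE //; exists (lcoef x0 (half l)).
by rewrite E !scaler0 {1}(supported_line bits0 s0').
Qed.
End Halves.

Section BilinearMaps.
Variables (F : fieldType) (U V W : lmodType F) (f : U -> V -> W).
Hypothesis fb : bilinear_map f.

Lemma bilinear0l v : f 0 v = 0.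
Proof. by have := fb.1 v (-1) 0 0; rewrite scaler0 addr0 scaleN1r addNr. Qed.
Lemma bilinear0r u : f u 0 = 0.
Proof. by have := fb.2 u (-1) 0 0; rewrite scaler0 addr0 scaleN1r addNr. Qed.
Lemma bilinearDl u u' v : f (u + u') v = f u v + f u' v.
Proof. by have := fb.1 v 1 u u'; rewrite !scale1r. Qed.
Lemma bilinearDr u v v' : f u (v + v') = f u v + f u v'.
Proof. by have := fb.2 u 1 v v'; rewrite !scale1r. Qed.
Lemma bilinearZ c d u v : f (c *: u) (d *: v) = (c * d) *: f u v.
Proof.
rewrite -[c *: u]addr0 fb.1 bilinear0l addr0 -[d *: v]addr0 fb.2 bilinear0r addr0.
by rewrite scalerA.
Qed.
End BilinearMaps.

(** * Homomorphisms out of a quaternion algebra *)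

Section QuaternionExtension.
Variables (F : fieldType) (L : zmodType) (T : gradedInvAlg F L) (R : comAlgType F).
Variables (Z : R -> T) (g1 g2 : T).

Definition quat_ext (x : quat R) : T := let: (x0, x1, x2, x3) := x in
  Z x0 + Z x1 ** g1 + Z x2 ** g2 + Z x3 ** (g2 ** g1).

Variables (t1 t2 : R).
Hypothesis mulA : associative (@ga_mul _ _ T).
Hypothesis ZD : {morph Z : a b / a + b}.
Hypothesis ZN : {morph Z : a / - a}.
Hypothesis ZM : forall a b, Z (a * b) = Z a ** Z b.
Hypothesis Zc : forall a x, Z a ** x = x ** Z a.
Hypotheses (g11 : Z t1 = g1 ** g1) (g22 : Z t2 = g2 ** g2) (g12 : g1 ** g2 = - (g2 ** g1)).

Lemma quat_extM x y :
  quat_ext (quat_mul t1 t2 x y) = quat_ext x ** quat_ext y.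
Proof.
move: x y => [[[x0 x1] x2] x3] [[[y0 y1] y2] y3].
have E (p q s t : R) :
  quat_ext (p, q, s, t) = Z p ** one T + Z q ** g1 + Z s ** g2 + Z t ** (g2 ** g1).
  by rewrite ga_mulx1.
have ZZ a b w w' : (Z a ** w) ** (Z b ** w') = Z (a * b) ** (w ** w').
  by rewrite ZM !mulA -(mulA (Z a) w) -(Zc b w) !mulA.
have Zt a t w : Z a ** (Z t ** w) = Z (a * t) ** w by rewrite ZM mulA.
have p11 : g1 ** g1 = Z t1 ** one T by rewrite ga_mulx1 g11.
have p22 : g2 ** g2 = Z t2 ** one T by rewrite ga_mulx1 g22.
have p31 : (g2 ** g1) ** g1 = Z t1 ** g2 by rewrite -mulA -g11 Zc.
have p13 : g1 ** (g2 ** g1) = - (Z t1 ** g2) by rewrite mulA g12 gmulNl p31.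
have p23 : g2 ** (g2 ** g1) = Z t2 ** g1 by rewrite mulA -g22.
have p32 : (g2 ** g1) ** g2 = - (Z t2 ** g1) by rewrite -mulA g12 gmulNr p23.
have p33 : (g2 ** g1) ** (g2 ** g1) = - (Z t1 ** (Z t2 ** one T)).
  by rewrite -mulA p13 gmulNr mulA -Zc -mulA p22.
(* The coefficients are rearranged with t1 and t2 on the right, the form in which [Zt] collects
   them. *)
have -> : quat_mul t1 t2 (x0, x1, x2, x3) (y0, y1, y2, y3) =
  (x0 * y0 + x1 * y1 * t1 + x2 * y2 * t2 - x3 * y3 * t1 * t2,
   x0 * y1 + x1 * y0 + x2 * y3 * t2 - x3 * y2 * t2,
   x0 * y2 + x2 * y0 + x3 * y1 * t1 - x1 * y3 * t1,
   x0 * y3 + x3 * y0 + x2 * y1 - x1 * y2).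
  by congr (_, _, _, _); ring.
rewrite !E !gmulDl !gmulDr !ZZ !(@ga_mul1x _ _ T) !(@ga_mulx1 _ _ T).
rewrite !(p11, p22, p31, p13, p23, p32, p33, g12) !gmulNr !Zt.
rewrite !(ZD, ZN) !(gmulDl, gmulNl, @ga_mulx1 _ _ T); zmod.
Qed.
End QuaternionExtension.

(** * Tori whose involution follows the sign rule of the tensor product *)

Section TensorProduct.
Variables (F : fieldType) (r : nat).
Local Notation H := ('rV[int]_2 * 'rV[int]_r)%type.
Variable T : gradedInvAlg F H.
Hypothesis mulA : associative (@ga_mul _ _ T).
Hypothesis torT : structurable_torus T.
Hypothesis suppT : forall h, supp T h.
Local Notation o1 h := (oddz (h.1 0 0)).
Local Notation o2 h := (oddz (h.1 0 1)).
Hypothesis starT : forall h x, T`_[h] x -> star x = if o1 h && o2 h then - x else x.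
Implicit Types (x y z : T) (h k : H).

Let mul_neq0 := assoc_torus_mul_neq0 torT mulA.

Definition evenh h := ~~ o1 h && ~~ o2 h.

(** x is hermitian, and multiplication by it does not change the sign by which star acts on a
    homogeneous y, so star(xy) = star(y) x reads xy = yx. *)
Lemma even_central h x y : evenh h -> T`_[h] x -> x ** y = y ** x.
Proof.
move=> /andP[h1 h2] xh; elim/gr_ind: y => [|y z IH IH'|k y yk].
- by rewrite gmulx0 gmul0x.
- by rewrite gmulDl gmulDr IH IH'.
have sx : star x = x by rewrite (starT xh) (negbTE h1).
apply: gstar_inj; rewrite [in RHS]ga_starM sx (starT yk) (starT (ga_gr_mul xh yk)).
rewrite !mxE !oddzD (negbTE h1) (negbTE h2) /=.
by case: ifP; rewrite ?gmulNr.
Qed.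

Definition even_unit x := exists h, [/\ evenh h, T`_[h] x & x <> 0].
(** The homogeneous units of even degree form an abelian group of central elements. A homomorphism
    from a group G into it extends to an algebra map on the group algebra of G, [grhom], with
    central values. *)
Definition cunit := {x : T | `[< even_unit x >]}.
HB.instance Definition _ := SubChoice.on cunit.

Lemma cunitP (u : cunit) : even_unit (val u).
Proof. by have /asboolP := valP u. Qed.

Fact cunit_mul_subproof (u w : cunit) : `[< even_unit (val u ** val w) >].
Proof.
have [h [/andP[h1 h2] uh u0]] := cunitP u; have [k [/andP[k1 k2] wk w0]] := cunitP w.
apply/asboolP; exists (h + k); split; [|exact: ga_gr_mul|exact: mul_neq0 uh u0 w0].
by rewrite /evenh !mxE !oddzD (negbTE h1) (negbTE h2) k1.
Qed.
Definition cunit_mul u w : cunit := Sub (val u ** val w) (cunit_mul_subproof u w).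
Fact cunit_one_subproof : `[< even_unit (one T) >].
Proof.
apply/asboolP; exists 0; split; first by rewrite /evenh !mxE.
  exact: gr_one.
by have [x _ x0] := suppT 0; apply: gone_neq0 x0.
Qed.
Definition cunit_one : cunit := Sub (one T) cunit_one_subproof.
Fact cunit_inv_ex (u : cunit) : exists w : cunit, val w ** val u = one T.
Proof.
have [h [/andP[h1 h2] uh u0]] := cunitP u; have [w [wh uw wu _ _]] := inv_gr torT uh u0.
have ew : `[< even_unit w >].
  apply/asboolP; exists (- h); split=> //; first by rewrite /evenh !mxE !oddzN h1.
  by move=> w0; apply: (gone_neq0 u0); rewrite -uw w0 gmulx0.
by exists (Sub w ew).
Qed.
Definition cunit_inv u := sval (cid (cunit_inv_ex u)).
Fact cunit_mulA : associative cunit_mul.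
Proof. by move=> u v w; apply: val_inj; rewrite /= mulA. Qed.
Fact cunit_mulC : commutative cunit_mul.
Proof.
move=> u v; apply: val_inj; have [h [eh uh _]] := cunitP u; exact: even_central eh uh.
Qed.
Fact cunit_mul1 : left_id cunit_one cunit_mul.
Proof. by move=> u; apply: val_inj; rewrite /= ga_mul1x. Qed.
Fact cunit_mulV : left_inverse cunit_one cunit_inv cunit_mul.
Proof. by move=> u; apply: val_inj; apply: (svalP (cid (cunit_inv_ex u))). Qed.
(* The group law of cunit is the product of T, written additively so that the
   monomial maps z1 and z2 below are additive. *)
HB.instance Definition _ := GRing.isZmodule.Build cunit
  cunit_mulA cunit_mulC cunit_mul1 cunit_mulV.

Lemma cunitD (u w : cunit) : val (u + w) = val u ** val w.
Proof. by []. Qed.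
Lemma cunit0 : val (0 : cunit) = one T.
Proof. by []. Qed.

Lemma cunit_gr0 : T`_[0] (val (0 : cunit)). Proof. exact: gr_one. Qed.

Lemma cunit_grN h (u : cunit) : T`_[h] (val u) -> T`_[- h] (val (- u)).
Proof.
move=> uh; have [k [_ wk w0]] := cunitP (- u); have [_ [_ _ u0]] := cunitP u.
have : T`_[k + h] (one T) by rewrite -cunit0 -(addNr u) cunitD; apply: ga_gr_mul.
move=> /gr_inj /(_ (@gr_one _ _ T) (gone_neq0 u0)) /eqP; rewrite addr_eq0 => /eqP <-.
exact: wk.
Qed.

Lemma cunit_gr_mulz h (u : cunit) (n : int) : T`_[h] (val u) -> T`_[h *~ n] (val (u *~ n)).
Proof.
move=> uh; have nat_case m : T`_[h *+ m] (val (u *+ m)).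
  elim: m => [|m IH]; first exact: cunit_gr0.
  by rewrite !mulrS cunitD; apply: ga_gr_mul.
by case: n => n; [apply: nat_case|rewrite NegzE !mulrNz; apply: cunit_grN; apply: nat_case].
Qed.

Lemma cunit_gr_sum (I : finType) (h : I -> H) (u : I -> cunit) :
  (forall i, T`_[h i] (val (u i))) -> T`_[\sum_i h i] (val (\sum_i u i)).
Proof.
move=> uh; apply: (big_ind2 (fun h u => T`_[h] (val u))) => //; first exact: cunit_gr0.
by move=> h1 u1 h2 u2 g1 g2; rewrite cunitD; apply: ga_gr_mul.
Qed.

Lemma cunit_central (u : cunit) x : val u ** x = x ** val u.
Proof. by have [h [eh uh _]] := cunitP u; apply: even_central eh uh. Qed.
Lemma cunit_star (u : cunit) : star (val u) = val u.
Proof.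
by have [h [/andP[h1 _] uh _]] := cunitP u; rewrite (starT uh) (negbTE h1).
Qed.
Lemma cunit_neq0 (u : cunit) : val u <> 0.
Proof. by have [h []] := cunitP u. Qed.

Section Character.
Variables (G : zmodType) (z : {additive G -> cunit}).
Definition grhom : grpalg F G -> T := linext (fun a => val (z a)).
Implicit Types a b : grpalg F G.

Lemma grhomU c (a : G) : grhom (lterm c a) = c *: val (z a). Proof. exact: linextU. Qed.
Lemma grhomP c a b : grhom (c *: a + b) = c *: grhom a + grhom b.
Proof. exact: linext_linear. Qed.
Lemma grhom0 : grhom 0 = 0. Proof. exact: raddf0. Qed.
Lemma grhomD a b : grhom (a + b) = grhom a + grhom b. Proof. exact: raddfD. Qed.
Lemma grhomN a : grhom (- a) = - grhom a. Proof. exact: raddfN. Qed.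
Lemma grhom1 : grhom 1 = one T.
Proof. by rewrite [1]/(lterm 1 0) grhomU scale1r raddf0. Qed.

Lemma grhom_central a x : grhom a ** x = x ** grhom a.
Proof.
elim/grpalg_ind: a => [|a b IH IH'|c a]; first by rewrite grhom0 gmulx0 gmul0x.
  by rewrite grhomD gmulDl gmulDr IH IH'.
by rewrite grhomU gmulZl gmulZr cunit_central.
Qed.

Lemma grhom_star a : star (grhom a) = grhom a.
Proof.
elim/grpalg_ind: a => [|a b IH IH'|c a]; first by rewrite grhom0 gstar0.
  by rewrite grhomD gstarD IH IH'.
by rewrite grhomU gstarZ cunit_star.
Qed.

Lemma grhomM a b : grhom (a * b) = grhom a ** grhom b.
Proof.
elim/grpalg_ind: a => [|a a' IH IH'|c a].
- by rewrite mul0r grhom0 gmul0x.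
- by rewrite mulrDl !grhomD gmulDl IH IH'.
elim/grpalg_ind: b => [|b b' IH IH'|d b].
- by rewrite mulr0 grhom0 gmulx0.
- by rewrite mulrDr !grhomD gmulDr IH IH'.
rewrite lmulE lmulUU !grhomU raddfD cunitD gmulZl gmulZr scalerA //.
Qed.

End Character.

Local Notation d1 := (delta_mx 0 0 : 'rV[int]_2).
Local Notation d2 := (delta_mx 0 1 : 'rV[int]_2).
Variables (g1 g2 : T) (cc : 'I_r -> cunit) (u1 u2 : cunit).
Hypotheses (g1_gr : T`_[(d1, 0)] g1) (g2_gr : T`_[(d2, 0)] g2).
Hypotheses (g1_neq0 : g1 <> 0) (g2_neq0 : g2 <> 0).
Hypotheses (u1E : val u1 = g1 ** g1) (u2E : val u2 = g2 ** g2).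
Hypothesis cc_gr : forall j, T`_[(0, delta_mx 0 j)] (val (cc j)).

(** In multiplicative notation t^m goes to (g1 g1)^(m_0) (g2 g2)^(m_1); degrees double because each
    t_i stands for the square of a generator. *)
Definition z1 (m : 'rV[int]_2) : cunit := u1 *~ m 0 0 + u2 *~ m 0 1.
Fact z1_additive : zmod_morphism z1.
Proof. by move=> m n; rewrite /z1 !mxE !mulrzBr opprD addrACA. Qed.
HB.instance Definition _ := GRing.isZmodMorphism.Build 'rV[int]_2 cunit z1 z1_additive.
Definition z2 (n : 'rV[int]_r) : cunit := \sum_j cc j *~ n 0 j.
Fact z2_additive : zmod_morphism z2.
Proof.
by move=> m n; rewrite /z2 -sumrB; apply: eq_bigr => j _; rewrite !mxE mulrzBr.
Qed.
HB.instance Definition _ := GRing.isZmodMorphism.Build 'rV[int]_r cunit z2 z2_additive.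

Lemma z1_gr m : T`_[(m *+ 2, 0)] (val (z1 m)).
Proof.
have -> : (m *+ 2, 0) = ((d1, 0) + (d1, 0)) *~ m 0 0 + ((d2, 0) + (d2, 0)) *~ m 0 1 :> H.
  rewrite -![(_, _) + (_, _)]/((_ + _, _ + _)) !addr0 !pair_mulz !mul0rz.
  congr (_, _); last by rewrite /= addr0.
  by apply/rowP; apply: ord2_ind; rewrite -!scaler_int !mulr2n !mxE /= !intz; ring.
by rewrite cunitD; apply: ga_gr_mul; apply: cunit_gr_mulz; rewrite ?u1E ?u2E; apply: ga_gr_mul.
Qed.

Lemma z2_gr n : T`_[(0, n)] (val (z2 n)).
Proof.
have -> : (0, n) = \sum_j (0, delta_mx 0 j) *~ n 0 j :> H.
  have e (i : 'I_r) : (0, delta_mx 0 i) *~ n 0 i = (0, n 0 i *: delta_mx 0 i) :> H.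
    by rewrite pair_mulz mul0rz -scaler_int intz.
  under eq_bigr do rewrite e.
  have pm : {morph (fun v : 'rV[int]_r => (0, v) : H) : v w / v + w}.
    by move=> v w; congr (_, _); rewrite /= addr0.
  by rewrite [in LHS](row_sum_delta n); apply: (big_morph _ pm (erefl _)).
by apply: cunit_gr_sum => j; apply: cunit_gr_mulz.
Qed.

Local Notation zeta := (grhom z1).
Local Notation pi := (grhom z2).

Definition psi (x : C2alg F) : T := quat_ext zeta g1 g2 x.

Lemma psiP c (x y : C2alg F) : psi (c *: x + y) = c *: psi x + psi y.
Proof.
move: x y => [[[x0 x1] x2] x3] [[[y0 y1] y2] y3].
rewrite /psi /quat_ext /= !grhomP !gmulDl !gmulZl !scalerDr; zmod.
Qed.

(** The involution fixes g1 and g2 but negates g2 g1, whose degree has both coordinates odd. *)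
Lemma g12 : g1 ** g2 = - (g2 ** g1).
Proof.
have := starT (ga_gr_mul g2_gr g1_gr); rewrite ga_starM !mxE /=.
by rewrite (starT g1_gr) (starT g2_gr) !mxE.
Qed.

Lemma zeta1 : zeta (lterm 1 d1) = g1 ** g1.
Proof.
have e : z1 d1 = u1 by rewrite /z1 !mxE /= mulr0z mulr1z addr0.
by rewrite grhomU scale1r -u1E -e.
Qed.
Lemma zeta2 : zeta (lterm 1 d2) = g2 ** g2.
Proof.
have e : z1 d2 = u2 by rewrite /z1 !mxE /= mulr0z mulr1z add0r.
by rewrite grhomU scale1r -u2E -e.
Qed.

Lemma psiM (x y : C2alg F) : psi (x ** y) = psi x ** psi y.
Proof.
apply: quat_extM => //; [exact: grhomD|exact: grhomN|exact: grhomM|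
  exact: grhom_central|exact: zeta1|exact: zeta2|exact: g12].
Qed.

Lemma psi_star (x : C2alg F) : psi (star x) = star (psi x).
Proof.
move: x => [[[x0 x1] x2] x3]; rewrite /psi /quat_ext /= !gstarD !ga_starM !grhom_star grhomN.
by rewrite (starT g1_gr) (starT g2_gr) !mxE /= g12 !gmulNl !grhom_central.
Qed.

Definition qword (l : 'rV[int]_2) : T :=
  match oddz (l 0 0), oddz (l 0 1) with
  | false, false => one T | true, false => g1 | false, true => g2 | true, true => g2 ** g1
  end.

Lemma psi_elt l : psi (quat_elt F l) = val (z1 (half l)) ** qword l.
Proof.
rewrite /psi /quat_ext /quat_elt /qword.
by case: (oddz _); case: (oddz _);
  rewrite !grhom0 !gmul0x !grhomU scale1r ?(add0r, addr0, ga_mulx1).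
Qed.

Lemma qword_neq0 l : qword l <> 0.
Proof.
rewrite /qword; case: (oddz _); case: (oddz _) => //; first exact: mul_neq0 g2_gr g2_neq0 g1_neq0.
exact: gone_neq0 g1_neq0.
Qed.

Lemma psi_elt_gr l : T`_[(l, 0)] (psi (quat_elt F l)).
Proof.
rewrite psi_elt /qword; have zg := z1_gr (half l).
have sh d w : bits d -> T`_[(d, 0)] w -> (forall j, oddz (l 0 j) = oddz (d 0 j)) ->
    T`_[(l, 0)] (val (z1 (half l)) ** w).
  move=> bd wd ld; have := ga_gr_mul zg wd.
  by rewrite -[(_, _) + (_, _)]/((_ + _, _ + _)) (halfK bd ld) addr0.
case h0: (oddz _); case h1: (oddz _).
- apply: (sh (d1 + d2)); first exact: bits12.
    by have := ga_gr_mul g2_gr g1_gr; rewrite -[(_, _) + (_, _)]/((_ + _, _ + _)) addr0 addrC.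
  by apply: ord2_ind; rewrite !mxE.
- by apply: (sh d1) => //; [apply: bits1|apply: ord2_ind; rewrite !mxE].
- by apply: (sh d2) => //; [apply: bits2|apply: ord2_ind; rewrite !mxE].
by apply: (sh 0); [apply: bits0|apply: gr_one|apply: ord2_ind; rewrite !mxE].
Qed.

Definition tens (x : C2alg F) (p : Palg F r) : T := psi x ** pi p.
Definition telt h : T := tens (quat_elt F h.1) (lterm 1 h.2).

Lemma P_line n (p : Palg F r) : (Palg F r)`_[n] p -> exists c, p = c *: (lterm 1 n : Palg F r).
Proof.
move=> sp; exists (lcoef p n); apply: grpalgP => a; rewrite lcoefZ lcoefU.
case: eqVneq => [->|ne]; first by rewrite mulr1.
by rewrite mulr0; apply/eqP; apply: contraNT ne => /sp /= ->.
Qed.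

Lemma P_elt_gr n : (Palg F r)`_[n] (lterm 1 n).
Proof. exact: supportedU. Qed.

Lemma telt_gr h : T`_[h] (telt h).
Proof.
case: h => l n; rewrite /telt /tens /= grhomU scale1r.
have := ga_gr_mul (psi_elt_gr l) (z2_gr n).
by rewrite -[(_, _) + (_, _)]/((_ + _, _ + _)) addr0 add0r.
Qed.

Lemma telt_neq0 h : telt h <> 0.
Proof.
rewrite /telt /tens grhomU scale1r; apply: (mul_neq0 (psi_elt_gr _) _ (@cunit_neq0 _)).
rewrite psi_elt; apply: (mul_neq0 (z1_gr _) (@cunit_neq0 _)); exact: qword_neq0.
Qed.

Lemma tens_bilinear : bilinear_map tens.
Proof.
split=> [p c x y|x c p q]; rewrite /tens; first by rewrite psiP gmulDl gmulZl.
by rewrite grhomP gmulDr gmulZr.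
Qed.

Lemma tens_hom l n (x : C2alg F) (p : Palg F r) : (C2alg F)`_[l] x -> (Palg F r)`_[n] p ->
  exists c d, [/\ x = c *: quat_elt F l, p = d *: (lterm 1 n : Palg F r) &
    tens x p = (c * d) *: telt (l, n)].
Proof.
move=> /quat_line[c ->] /P_line[d ->]; exists c, d; split=> //.
by rewrite (bilinearZ tens_bilinear).
Qed.

Lemma telt_line h y : T`_[h] y -> exists c, y = c *: telt h.
Proof. exact: (gr_line torT (telt_gr h) (@telt_neq0 h)). Qed.

(** Coordinate with respect to the spanning element [telt h]; 0 is a default for y off the line. *)
Definition tcoef h y : F := if pselect (exists c, y = c *: telt h) is left e
  then sval (cid e) else 0.

Lemma tcoefE h y : T`_[h] y -> y = tcoef h y *: telt h.
Proof.
move=> /telt_line e; rewrite /tcoef; case: pselect => // e'.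
exact: (svalP (cid e')).
Qed.

Lemma tcoefZ h c : tcoef h (c *: telt h) = c.
Proof.
have g : T`_[h] (c *: telt h) by apply: ggrZ; apply: telt_gr.
apply/eqP; rewrite -subr_eq0; apply/eqP.
have : (tcoef h (c *: telt h) - c) *: telt h = 0 by rewrite scalerBl -tcoefE // subrr.
by move=> /eqP; rewrite scaler_eq0 => /orP[/eqP//|/eqP/telt_neq0].
Qed.

(** Each component of T is the line of the pure tensor [telt h]. There the factorization of f is
    forced, and the values on the lines are glued by degree. *)
Lemma tens_universal : universal_bilinear tens.
Proof.
split; first exact: tens_bilinear.
move=> Z f fb.
pose phi h y := tcoef h (proj h y) *: f (quat_elt F h.1) (lterm 1 h.2 : Palg F r).
have phi_lin h : linear (phi h).
  move=> c x y; rewrite /phi projD projZ scalerA -scalerDl; congr (_ *: _).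
  rewrite {1}(tcoefE (proj_gr h x)) {1}(tcoefE (proj_gr h y)) scalerA -scalerDl.
  by rewrite tcoefZ.
have gl := glue_linear phi_lin.
have gD u w : glue phi (u + w) = glue phi u + glue phi w.
  by have := gl 1 u w; rewrite !scale1r.
have g0 : glue phi 0 = 0 by have := gl (-1) 0 0; rewrite scaler0 addr0 scaleN1r addNr.
have tb := tens_bilinear.
have gt (x : C2alg F) (p : Palg F r) : glue phi (tens x p) = f x p.
  elim/gr_ind: x => [|x y IH IH'|l x xl]; first by rewrite !bilinear0l.
    by rewrite !bilinearDl // gD IH IH'.
  elim/gr_ind: p => [|p q IH IH'|n p pn]; first by rewrite !bilinear0r.
    by rewrite !bilinearDr // gD IH IH'.
  have [c [d [-> -> ->]]] := tens_hom xl pn.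
  have g : T`_[(l, n)] ((c * d) *: telt (l, n)) by apply: ggrZ; apply: telt_gr.
  by rewrite (bilinearZ fb) (glue_hom phi_lin g) /phi proj_id // tcoefZ.
exists (glue phi); split; first by split.
move=> g' [g'lin g't]; apply: funext => y.
elim/gr_ind: y => [|x y IH IH'|h y /telt_line[c ->]].
- by rewrite g0; have := g'lin (-1) 0 0; rewrite scaler0 addr0 scaleN1r addNr.
- by rewrite gD IH IH'; have := g'lin 1 x y; rewrite !scale1r.
have g'0 : g' 0 = 0 by have := g'lin (-1) 0 0; rewrite scaler0 addr0 scaleN1r addNr.
by rewrite -[c *: _]addr0 g'lin gl g't gt g0 g'0.
Qed.

Lemma tens_is_tensor_product : is_tensor_product (C2alg F) (Palg F r) T.
Proof.
exists tens; split; first exact: tens_universal.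
- rewrite /tens grhom1 ga_mulx1 /psi /quat_ext /= !grhom0 !gmul0x !addr0.
  exact: grhom1.
- move=> x x' p p'; rewrite /tens psiM grhomM -!mulA; congr (_ ** _).
  by rewrite !mulA (grhom_central z2 p).
- by move=> x p; rewrite /tens psi_star ga_starM grhom_star grhom_central.
move=> l n; rewrite eqEsubset; split=> [y yl|y [s Hs ->]].
  have [c ->] := telt_line yl; exists [:: (c *: quat_elt F l, lterm 1 n)].
    move=> q; rewrite inE => /eqP ->; split; last exact: P_elt_gr.
    exact: ggrZ _ (quat_elt_gr F l).
  have := bilinearZ tens_bilinear c 1 (quat_elt F l) (lterm 1 n : Palg F r).
  by rewrite big_seq1 scale1r mulr1 => ->.
apply: ggr_big => q /Hs [q1 q2] _; have [c [d [_ _ ->]]] := tens_hom q1 q2.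
by apply: ggrZ; apply: telt_gr.
Qed.
End TensorProduct.

Section StarLaw.
Variables (F : fieldType) (r : nat).
Local Notation H := ('rV[int]_2 * 'rV[int]_r)%type.
Variable T : gradedInvAlg F H.
Hypothesis mulA : associative (@ga_mul _ _ T).
Hypothesis torT : structurable_torus T.
Hypothesis suppT : forall h, supp T h.
Hypothesis starT : forall h (x : T), T`_[h] x ->
  star x = if oddz (h.1 0 0) && oddz (h.1 0 1) then - x else x.

(** The generators may be arbitrary nonzero elements of the basis degrees: [starT] determines how
    they commute, and g1 g1 and g2 g2 take the place of t_1 and t_2, so no structure constants have
    to be normalized. *)
Lemma tensor_of_star : is_tensor_product (C2alg F) (Palg F r) T.
Proof.
have [g1 g1_gr g10] := suppT (delta_mx 0 0, 0).
have [g2 g2_gr g20] := suppT (delta_mx 0 1, 0).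
have sq l (g : T) : T`_[l] g -> g <> 0 -> `[< even_unit (g ** g) >].
  move=> gl g0; apply/asboolP; exists (l + l).
  split; last exact: (assoc_torus_mul_neq0 torT mulA gl).
    by rewrite /evenh !mxE !oddzD !addbb.
  exact: ga_gr_mul.
have ccE (j : 'I_r) : exists u : cunit T, T`_[(0, delta_mx 0 j)] (val u).
  have [g gl g0] := suppT (0, delta_mx 0 j).
  have h : `[< even_unit g >].
    by apply/asboolP; exists (0, delta_mx 0 j); split=> //; rewrite /evenh !mxE.
  by exists (Sub g h).
have h1 := sq _ _ g1_gr g10; have h2 := sq _ _ g2_gr g20.
pose u1 : cunit T := Sub (g1 ** g1) h1; pose u2 : cunit T := Sub (g2 ** g2) h2.
have cc_gr j := svalP (cid (ccE j)).
exact: (tens_is_tensor_product mulA torT suppT starT g1_gr g2_gr g10 g20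
  (erefl : val u1 = _) (erefl : val u2 = _) cc_gr).
Qed.
End StarLaw.

(** * Transport of a grading along a group isomorphism *)

Section Regrade.
Variables (F : fieldType) (G H : zmodType) (B : gradedInvAlg F G).
Variables (theta : {additive G -> H}) (theta' : H -> G).
Hypotheses (thetaK : cancel theta theta') (theta'K : cancel theta' theta).

Definition regrade_gr (h : H) : set B := B`_[theta' h].

Let theta'D h k : theta' (h + k) = theta' h + theta' k.
Proof. by apply: (can_inj thetaK); rewrite raddfD !theta'K. Qed.

Fact regrade_span (x : B) : exists2 s : seq B,
  forall y, y \in s -> exists h, regrade_gr h y & x = \sum_(y <- s) y.
Proof.
have [s Hs ->] := ga_gr_span x; exists s => // y /Hs[l yl]; exists (theta l).
by rewrite /regrade_gr thetaK.
Qed.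
Fact regrade_indep (s : seq H) (f : H -> B) : uniq s ->
    (forall h, regrade_gr h (f h)) -> \sum_(h <- s) f h = 0 ->
  forall h, h \in s -> f h = 0.
Proof.
move=> us fg s0 h hs; rewrite -(theta'K h).
apply: (@ga_gr_indep _ _ B [seq theta' h | h <- s] (f \o theta)).
- by rewrite map_inj_uniq //; apply: can_inj theta'K.
- by move=> l /=; have := fg (theta l); rewrite /regrade_gr thetaK.
- by rewrite big_map -[RHS]s0; apply: eq_bigr => k _ /=; rewrite theta'K.
exact: map_f.
Qed.
Fact regrade_mul h k x y :
  regrade_gr h x -> regrade_gr k y -> regrade_gr (h + k) (x ** y).
Proof. by rewrite /regrade_gr theta'D; apply: ga_gr_mul. Qed.

Definition regrade : gradedInvAlg F H :=
  @GradedInvAlg F H B (@ga_mul _ _ B) (one B) star regrade_gr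
    (@ga_mul_linearl _ _ B) (@ga_mul_linearr _ _ B) (@ga_mul1x _ _ B)
    (@ga_mulx1 _ _ B) (@ga_star_linear _ _ B) (@ga_starK _ _ B)
    (@ga_starM _ _ B) (fun h => @ga_gr0 _ _ B (theta' h)) (fun h => @ga_grP _ _ B (theta' h))
    regrade_span regrade_indep regrade_mul (fun h => @ga_gr_star _ _ B (theta' h)).

Lemma regrade_iso : isograded_isomorphic B regrade.
Proof.
exists (id : B -> regrade), theta; split.
- by split=> //; exists id.
- by exists theta'.
move=> l; rewrite eqEsubset /= /regrade_gr thetaK; split=> [_ [x xl <-]//|x xl].
by exists x.
Qed.

Lemma regrade_torus : structurable_torus B -> structurable_torus regrade.
Proof.
move=> [strB fine inv gen]; split.
- exact: strB.
- by move=> h; apply: fine.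
- by move=> h; apply: inv.
rewrite eqEsubset; split=> // h _ K [sK suppK].
rewrite -(theta'K h); have : generated (supp B) (theta' h) by rewrite gen.
move: (theta' h); apply: (@generated_min _ _ [set l | K (theta l)]).
  split=> /= [|x y Kx Ky]; first by rewrite raddf0; apply: sK.1.
  by rewrite raddfB; apply: sK.2.
move=> l [x xl x0] /=; apply: suppK; exists x => //.
by rewrite /= /regrade_gr thetaK.
Qed.
End Regrade.

(** * Subgroups of Z^n *)

Section FreeSubgroups.

Lemma subgroup_mulz (L : zmodType) (I : set L) x (q : int) :
  is_subgroup I -> I x -> I (x *~ q).
Proof.
move=> sI Ix; have Imuln n : I (x *+ n).
  by elim: n => [|n IH]; [apply: sI.1|rewrite mulrS; apply: subgroupD].
by case: q => n; [apply: Imuln|rewrite NegzE mulrNz; apply: (subgroupN sI); apply: Imuln].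
Qed.

Lemma int_subgroup (I : set int) : is_subgroup I -> exists2 d, I d &
  forall x, I x -> exists q, x = q * d.
Proof.
move=> sI; have Imul x (q : int) : I x -> I (q * x).
  by rewrite mulrC -mulrzz; apply: subgroup_mulz.
have [[x [Ix x0]]|n0] := pselect (exists x, I x /\ x != 0); last first.
  exists 0; first exact: sI.1.
  move=> x Ix; exists 0; rewrite mul0r; apply/eqP/negPn/negP => x0.
  by apply: n0; exists x.
pose P := [pred n : nat | (0 < n)%N && `[< I n%:Z >]].
have exP : exists n, P n.
  exists (absz x); rewrite /= absz_gt0 x0 /=; apply/asboolP.
  by case: (x) Ix => n //; rewrite NegzE => /(subgroupN sI); rewrite opprK.
case: (ex_minnP exP) => d /andP[d0 /asboolP Id] dmin; exists d%:Z => // y Iy.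
exists (divz y d); apply/eqP; rewrite -subr_eq0; apply/eqP.
have rE : y - divz y d * d = modz y d by rewrite {1}(divz_eq y d) addrC addKr.
have Ir : I (modz y d) by rewrite -rE; apply: sI.2 => //; apply: Imul.
have rd : (modz y d < d)%R by apply: ltz_pmod; rewrite ltz_nat.
have r0 : (0 <= modz y d)%R by apply: modz_ge0; rewrite eqz_nat -lt0n.
rewrite rE; case: (modz y d) Ir rd r0 => // [[//|n]] In nd _.
have := dmin n.+1; rewrite /P /= => /(_ (introT (asboolP _) In)).
by rewrite leqNgt -ltz_nat nd.
Qed.

(** Induction on n: the first coordinates of P form a group d Z, the elements with first coordinate
    0 are free by induction, and for nonzero d one more generator, with first coordinate d, is
    added. *)
Lemma subgroup_free n (P : set 'rV[int]_n) : is_subgroup P ->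
  exists k (h : 'rV[int]_k -> 'rV[int]_n),
    [/\ zmod_morphism h, injective h & forall v, P v <-> exists a, v = h a].
Proof.
elim: n P => [|n IH] P sP.
  exists 0%N, id; split=> // v; split=> _; first by exists v.
  by rewrite (_ : v = 0); [apply: sP.1|apply/rowP => -[]].
have rB m (x y : 'rV[int]_1) (u w : 'rV[int]_m) :
  row_mx (x - y) (u - w) = row_mx x u - row_mx y w by rewrite opp_row_mx add_row_mx.
have r0B m (u w : 'rV[int]_m) :
  row_mx (0 : 'rV[int]_1) (u - w) = row_mx 0 u - row_mx 0 w by rewrite -rB subrr.
have [|k [h [hB hinj hP]]] := IH [set w | P (row_mx (0 : 'rV_1) w : 'rV_(1 + n))].
  split=> /= [|x y Px Py]; first by rewrite row_mx0; apply: sP.1.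
  by rewrite r0B; apply: sP.2.
have h0 : h 0 = 0 by rewrite -[in LHS](subrr 0) hB subrr.
pose I := [set x : int | exists w, P (row_mx x%:M w : 'rV_(1 + n))].
have [|d [w0 Pd] dI] := @int_subgroup I.
  split=> /= [|x y [u Pu] [w Pw]].
    by exists 0; rewrite (raddf0 scalar_mx) row_mx0; apply: sP.1.
  by exists (u - w); rewrite (raddfB scalar_mx) rB; apply: sP.2.
have rowE (v : 'rV[int]_(1 + n)) : v = row_mx (v 0 0)%:M (rsubmx v).
  rewrite -[LHS]hsubmxK; congr row_mx; rewrite [LHS]mx11_scalar mxE; congr (v 0 _)%:M.
  exact: val_inj.
have [d0|/eqP d0] := eqVneq d 0.
  exists k, (fun a => row_mx (0 : 'rV_1) (h a)); split.
  - by move=> a b; rewrite hB r0B.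
  - by move=> a b /(congr1 (@rsubmx _ 1 1 n)); rewrite !row_mxKr => /hinj.
  move=> v; split=> [Pv|[a ->]]; last by apply/hP; exists a.
  have v00 : v 0 0 = 0.
    have [|q ->] := dI (v 0 0); last by rewrite d0 mulr0.
    by exists (rsubmx (v : 'rV_(1 + n))); rewrite -rowE.
  have [|a aE] := (hP (rsubmx (v : 'rV_(1 + n)))).1.
    by rewrite /= -(raddf0 scalar_mx) -v00 -rowE.
  by exists a; rewrite -aE -(raddf0 scalar_mx) -v00 -rowE.
pose p0 : 'rV[int]_(1 + n) := row_mx d%:M w0.
exists (1 + k)%N, (fun a : 'rV[int]_(1 + k) => a 0 0 *: p0 + row_mx 0 (h (rsubmx a))).
have hzB : zmod_morphism (fun a : 'rV[int]_(1 + k) => a 0 0 *: p0 + row_mx 0 (h (rsubmx a))).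
  move=> a b; rewrite !mxE scalerDl scaleNr opprD addrACA; congr (_ + _).
  by rewrite (raddfB (@rsubmx _ _ _ _)) hB r0B.
split=> //.
- move=> a b /eqP; rewrite -subr_eq0 -hzB => /eqP; set c := a - b => e.
  apply/eqP; rewrite -subr_eq0 -/c; apply/eqP.
  have e1 : row_mx (c 0 0 *: d%:M) (c 0 0 *: w0 + h (rsubmx c)) = 0 :> 'rV[int]_(1 + n).
    by rewrite -[RHS]e scale_row_mx add_row_mx addr0.
  rewrite -(row_mx0 _ 1 1 n) in e1; have := congr1 (@lsubmx _ 1 1 n) e1; rewrite !row_mxKl => c1.
  have := congr1 (@rsubmx _ 1 1 n) e1; rewrite !row_mxKr => c2.
  have c00 : c 0 0 = 0.
    move: c1; rewrite scale_scalar_mx => /matrixP/(_ 0 0); rewrite !mxE eqxx mulr1n => /eqP.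
    by rewrite mulf_eq0 => /orP[/eqP//|/eqP].
  move: c2; rewrite c00 scale0r add0r -h0 => /hinj cr.
  have cE : c = row_mx (c 0 0)%:M (rsubmx c).
    rewrite -[LHS]hsubmxK; congr row_mx; rewrite [LHS]mx11_scalar mxE; congr (c 0 _)%:M.
    exact: val_inj.
  by rewrite cE c00 cr (raddf0 scalar_mx) row_mx0.
move=> v; split=> [Pv|[a ->]]; last first.
  apply: subgroupD => //; last by apply/hP; exists (rsubmx a).
  by rewrite -[a 0 0]intz scaler_int; apply: subgroup_mulz.
have [|q vE] := dI (v 0 0).
  by exists (rsubmx (v : 'rV_(1 + n))); rewrite -rowE.
have vp : (v : 'rV[int]_(1 + n)) - q *: p0 = row_mx 0 (rsubmx (v : 'rV_(1 + n)) - q *: w0).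
  by rewrite {1}(rowE v) scale_row_mx -rB vE scale_scalar_mx subrr.
have [|b bE] := (hP (rsubmx (v : 'rV_(1 + n)) - q *: w0)).1.
  rewrite /= -vp; apply: sP.2 => //.
  by rewrite -[q]intz scaler_int; apply: subgroup_mulz.
pose aq : 'rV[int]_(1 + k) := row_mx q%:M b.
have aq0 : aq 0 0 = q by rewrite mxE; case: splitP => // j _; rewrite ord1 mxE eqxx mulr1n.
by exists aq; rewrite aq0 row_mxKr -bE -vp addrC subrK.
Qed.
End FreeSubgroups.

(** * Homomorphisms to Z/2 and adapted bases *)

Section Parity.
Variables (G : zmodType) (q : G -> bool).
Hypothesis qB : forall x y, q (x - y) = q x (+) q y.

Lemma parity0 : q 0 = false. Proof. by rewrite -(subrr 0) qB addbb. Qed.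
Lemma parityN x : q (- x) = q x. Proof. by rewrite -sub0r qB parity0. Qed.
Lemma parityD x y : q (x + y) = q x (+) q y.
Proof. by rewrite -[y in LHS]opprK qB parityN. Qed.
Lemma parity_mulz x (z : int) : q (x *~ z) = oddz z && q x.
Proof.
have H n : q (x *+ n) = odd n && q x.
  by elim: n => [|n IH]; rewrite ?parity0 // mulrS parityD IH /=; case: (q x); case: (odd n).
by case: z => n; rewrite ?NegzE ?mulrNz ?parityN ?oddzN; apply: H.
Qed.
Lemma parity_sum (I : finType) (f : I -> G) :
  q (\sum_i f i) = \big[addb/false]_i q (f i).
Proof. exact: (big_morph q parityD parity0). Qed.
End Parity.

Section ParitySplit.
Variables (n : nat) (q : 'rV[int]_n.+1 -> bool).
Hypothesis qB : forall x y, q (x - y) = q x (+) q y.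
Local Notation c i := (q (delta_mx 0 i)).

Lemma parityE v : q v = oddz (\sum_i (if c i then v 0 i else 0)).
Proof.
rewrite {1}(row_sum_delta v) (parity_sum qB).
rewrite (big_morph oddz oddzD (erefl _ : oddz 0 = false)); apply: eq_bigr => i _.
by rewrite -[v 0 i]intz scaler_int (parity_mulz qB) intz; case: (c i); rewrite ?andbT ?andbF.
Qed.

(** q is the parity of the sum of those coordinates i for which q is odd on the i-th basis vector.
    Some j is among them as q is nonzero, and replacing coordinate j by this sum is unimodular,
    since v_j occurs in it with coefficient 1. *)
Lemma parity_splitS v0 : q v0 -> exists (t : 'rV[int]_n.+1 -> int * 'rV[int]_n) t',
  [/\ zmod_morphism t, cancel t t', cancel t' t & forall v, q v = oddz (t v).1].
Proof.
move=> qv; have [j cj] : exists j, c j.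
  apply: contrapT => h; move: qv; rewrite parityE big1 // => i _.
  by case: ifP => // ci; case: h; exists i.
pose rest (w : 'rV[int]_n) : int := \sum_k (if c (lift j k) then w 0 k else 0).
pose t (v : 'rV[int]_n.+1) : int * 'rV[int]_n :=
  (\sum_i (if c i then v 0 i else 0), \row_k v 0 (lift j k)).
pose t' (p : int * 'rV[int]_n) : 'rV[int]_n.+1 :=
  \row_i (if unlift j i is Some k then p.2 0 k else p.1 - rest p.2).
have tE v : (t v).1 = v 0 j + rest (t v).2.
  rewrite /= (bigD1_ord j) //= cj; congr (_ + _); apply: eq_bigr => k _.
  by rewrite mxE.
exists t, t'; split; last exact: parityE.
- move=> u v; congr (_, _); last by apply/rowP => k; rewrite !mxE.
  by rewrite -sumrB; apply: eq_bigr => i _; rewrite !mxE; case: ifP; rewrite ?subrr.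
- move=> v; apply/rowP => i; rewrite mxE; case: unliftP => [k ->|->]; first by rewrite mxE.
  by rewrite tE addrK.
move=> [x w]; have e2 : (t (t' (x, w))).2 = w by apply/rowP => k; rewrite !mxE liftK.
by rewrite [t _]surjective_pairing e2 tE e2 mxE unlift_none /= subrK.
Qed.
End ParitySplit.

Lemma parity_split n (q : 'rV[int]_n -> bool) v0 :
    (forall x y, q (x - y) = q x (+) q y) -> q v0 ->
  exists m (t : 'rV[int]_n -> int * 'rV[int]_m) t',
  [/\ zmod_morphism t, cancel t t', cancel t' t & forall v, q v = oddz (t v).1].
Proof.
case: n q v0 => [|n] q v0 qB; last by move=> /(parity_splitS qB)[t]; exists n, t.
by rewrite (_ : v0 = 0) ?(parity0 qB) //; apply/rowP => -[].
Qed.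

Lemma can2_zmod_morphism (U V : zmodType) (f : U -> V) (g : V -> U) :
  zmod_morphism f -> cancel f g -> cancel g f -> zmod_morphism g.
Proof. by move=> fB fK gK x y; apply: (can_inj fK); rewrite fB !gK. Qed.

Section AdaptedBasis.
Variables (G : zmodType) (n : nat) (f : G -> 'rV[int]_n) (f' : 'rV[int]_n -> G).
Hypotheses (fB : zmod_morphism f) (fK : cancel f f') (f'K : cancel f' f).
Variables (q1 q2 : G -> bool) (a b : G).
Hypothesis q1B : forall x y, q1 (x - y) = q1 x (+) q1 y.
Hypothesis q2B : forall x y, q2 (x - y) = q2 x (+) q2 y.
Hypotheses (q1a : q1 a) (q1b : ~~ q1 b) (q2b : q2 b).

(** The first split makes q1 the parity of a coordinate. As b is even for q1 and odd for q2, the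
    second parity stays nonzero on the remaining coordinates and can be split in turn. *)
Lemma adapted_basis : exists (r : nat) (th : G -> 'rV[int]_2 * 'rV[int]_r) th',
  [/\ zmod_morphism th, cancel th th', cancel th' th &
  forall g, oddz ((th g).1 0 0) = q1 g /\ oddz ((th g).1 0 1) = q2 g].
Proof.
have f'B := can2_zmod_morphism fB fK f'K.
have qfB x y : (q1 \o f') (x - y) = (q1 \o f') x (+) (q1 \o f') y by rewrite /= f'B q1B.
have qfa : (q1 \o f') (f a) by rewrite /= fK.
have [m [t1 [t1' [t1B t1K t1'K q1E]]]] := parity_split qfB qfa.
have t1'B := can2_zmod_morphism t1B t1K t1'K.
pose e (p : int * 'rV[int]_m) := f' (t1' p).
have eB : zmod_morphism e by move=> x y; rewrite /e t1'B f'B.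
have q2eB x y : q2 (e (x - y)) = q2 (e x) (+) q2 (e y) by rewrite eB q2B.
pose q2' (u : 'rV[int]_m) := q2 (e (0, u)).
pose c := q2 (e (1, 0)).
have q2E x u : q2 (e (x, u)) = (oddz x && c) (+) q2' u.
  have -> : (x, u) = (1, 0) *~ x + (0, u) :> (int * 'rV[int]_m)%type.
    by rewrite pair_mulz mul0rz mulrzz mul1r; congr (_, _); rewrite /= ?addr0 ?add0r.
  by rewrite (parityD q2eB) (parity_mulz q2eB).
have ef g : e (t1 (f g)) = g by rewrite /e t1K fK.
have fe p : t1 (f (e p)) = p by rewrite /e f'K t1'K.
have q1e g : oddz (t1 (f g)).1 = q1 g by rewrite -q1E /= fK.
have q2e g : q2 g = (oddz (t1 (f g)).1 && c) (+) q2' (t1 (f g)).2.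
  by rewrite -{1}(ef g) [t1 _]surjective_pairing q2E.
have q2'b : q2' (t1 (f b)).2 by move: q2b; rewrite q2e q1e (negbTE q1b).
have q2'B x y : q2' (x - y) = q2' x (+) q2' y.
  by rewrite /q2' -q2eB; congr (q2 (e (_, _))); rewrite /= subrr.
have [r [t2 [t2' [t2B t2K t2'K q2'E]]]] := parity_split q2'B q2'b.
have t2'B := can2_zmod_morphism t2B t2K t2'K.
pose g1 g := (t1 (f g)).1; pose g2 g := t2 (t1 (f g)).2.
(* The second split only sees q2 on vectors whose first coordinate is 0. If q2 is odd on the first
   basis vector, which is the meaning of c, adding the first coordinate to the second corrects the
   parity. *)
pose th g : 'rV[int]_2 * 'rV[int]_r :=
  (\row_i (if i == 0 then g1 g else (g2 g).1 + (if c then g1 g else 0)), (g2 g).2).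
pose th' (p : 'rV[int]_2 * 'rV[int]_r) :=
  let x := p.1 0 0 in e (x, t2' (p.1 0 1 - (if c then x else 0), p.2)).
have g1B x y : g1 (x - y) = g1 x - g1 y by rewrite /g1 fB t1B.
have g2B x y : g2 (x - y) = g2 x - g2 y by rewrite /g2 fB t1B t2B.
exists r, th, th'; split.
- move=> x y; congr (_, _); last by rewrite g2B.
  apply/rowP; apply: ord2_ind; rewrite !mxE /= g1B // g2B /=.
  by case: (c); zmod.
- move=> g; rewrite /th' !mxE /= addrK -surjective_pairing /g2 t2K.
  by rewrite -surjective_pairing ef.
- move=> [v w]; rewrite /th /th' /g1 /g2 fe /= t2'K /=; congr (_, _).
  by apply/rowP; apply: ord2_ind; rewrite !mxE //= subrK.
move=> g; rewrite !mxE /= q1e q2e q2'E oddzD addbC; split=> //.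
by congr (_ (+) _); case: (c); rewrite ?andbT ?andbF.
Qed.
End AdaptedBasis.

(** * From two parities on M to the tensor product *)

Section StarLawC2P.
Variables (F : fieldType) (L : zmodType) (M : zmodClosed L).
Hypothesis freeL : free_abelian_of_finite_rank L.

Lemma subgrp_free : exists k (f : subgrp M -> 'rV[int]_k) f',
  [/\ zmod_morphism f, cancel f f' & cancel f' f].
Proof.
have [n [f [f' fK f'K]]] := freeL.
have f'B := can2_zmod_morphism (raddfB f) fK f'K.
have [|k [h [hB hinj hP]]] := @subgroup_free n [set v | f' v \in M].
  split=> /= [|x y Px Py]; last by rewrite f'B rpredB.
  by rewrite -(raddf0 f) fK rpred0.
have hM a : f' (h a) \in M by apply: (hP (h a)).2; exists a.
have ex (m : subgrp M) : exists a, f (val m) = h a.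
  by apply/hP; rewrite /= fK; apply: valP.
pose g m := sval (cid (ex m)); pose g' a : subgrp M := Sub (f' (h a)) (hM a).
have gE m : h (g m) = f (val m) by rewrite (svalP (cid (ex m))).
have g'K : cancel g' g by move=> a; apply: hinj; rewrite gE SubK f'K.
have gK : cancel g g' by move=> m; apply: val_inj; rewrite SubK gE fK.
have g'B : zmod_morphism g'.
  by move=> x y; apply: val_inj; rewrite SubK hB f'B.
by exists k, g, g'; split=> //; apply: can2_zmod_morphism g'B g'K gK.
Qed.

Variables (B : assocTorus F (subgrp M)) (q1 q2 : subgrp M -> bool) (a b : subgrp M).
Hypothesis suppB : forall l, supp B l.
Hypothesis q1B : forall x y, q1 (x - y) = q1 x (+) q1 y.
Hypothesis q2B : forall x y, q2 (x - y) = q2 x (+) q2 y.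
Hypotheses (q1a : q1 a) (q1b : ~~ q1 b) (q2b : q2 b).
Hypothesis starB : forall l (x : B), B`_[l] x ->
  star x = if q1 l && q2 l then - x else x.

Lemma star_law_C2_P : isograded_to_C2_P B.
Proof.
have [k [f [f' [fB fK f'K]]]] := subgrp_free.
have [r [th [th' [thB thK th'K thE]]]] := adapted_basis fB fK f'K q1B q2B q1a q1b q2b.
pose theta : {additive subgrp M -> 'rV[int]_2 * 'rV[int]_r} :=
  HB.pack th (GRing.isZmodMorphism.Build _ _ th thB).
exists r, (regrade (theta := theta) B thK th'K); split; last exact: regrade_iso.
apply: tensor_of_star => //.
- exact: at_assoc.
- exact: regrade_torus (at_torus B).
- by move=> h; apply: suppB.
move=> h x xh; rewrite (starB xh).
by have [<- <-] := thE (th' h); rewrite th'K.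
Qed.
End StarLawC2P.

(** * Tori of class III(a) are of the form A(k) *)

Section Converse.
Variables (F : fieldType) (L : zmodType) (A : gradedInvAlg F L).
Hypotheses (charF_neq2 : 2%N \notin [pchar F]) (charF_neq3 : 3%N \notin [pchar F]).
Hypothesis freeL : free_abelian_of_finite_rank L.

Theorem class_IIIa_is_Ak : structurable_torus A -> class_IIIa A ->
  exists (M : zmodClosed L) (B : assocTorus F (subgrp M)) (k : diagForm B),
  [/\ forall l : L, l *+ 2 \in M, isograded_to_C2_P B & graded_isomorphic A (Ak k)].
Proof.
move=> torA [c3A [p star_p]]; have [[sg [sgS sgL] pE] _ _] := star_p.
rewrite {}pE in star_p; have [g gsg g0] := sgS.
pose sM := Ms_subgroup torA sgS sgL star_p.
pose M : zmodClosed L := subgroup_pred sM.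
have MP l : reflect (Ms A sg l) (l \in M) by apply: asboolP.
have ME : Mset M = Ms A sg by rewrite eqEsubset; split=> l /MP.
have nMP l : l \notin M -> ~ Ms A sg l by move=> /negP h /MP.
have M2 l : l *+ 2 \in M by apply/MP; apply: (Ms2 torA sgS sgL star_p).
have Msupp l : l \in M -> supp A l by move=> /MP; apply: Ms_supp.
have Bassoc a b c : graded_part (Mset M) a -> graded_part (Mset M) b ->
    graded_part (Mset M) c -> a ** (b ** c) = a ** b ** c :> A.
  rewrite ME; exact: (B_assoc charF_neq2 charF_neq3 torA c3A sgS sgL star_p gsg g0).
have Xstar x : graded_part (~` Mset M) x -> star x = x :> A.
  by rewrite ME => /X_W; apply: W_star.
have Xex : exists a, supp A a /\ a \notin M.
  have [a [aS aM]] := nMs_ex torA c3A sgS sgL star_p.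
  by exists a; split=> //; apply/negP => /MP.
exists M, (coordB torA Msupp Bassoc), (coordk torA freeL M2 Msupp Bassoc Xstar Xex).
split=> //; last first.
  apply: coordinatization.
  - rewrite ME; exact: (B_act charF_neq2 charF_neq3 torA c3A sgS sgL star_p gsg g0).
  - rewrite ME; exact: (X_form charF_neq2 charF_neq3 torA c3A sgS sgL star_p gsg g0).
  - move=> a b x y xa yb /nMP aM /nMP bM xy0; apply/MP.
    exact: (nMs_prod torA sgS sgL star_p xa yb aM bM xy0).
  move=> l m b x bl xm /MP lM /nMP mM.
  exact: (BX_neq0 charF_neq2 charF_neq3 torA c3A sgS sgL star_p gsg g0 bl xm lM mM).
have [s [sM1 s1 s2 [g1 g2]]] := par_surj charF_neq2 charF_neq3 torA c3A sgL.
have MsM (m : subgrp M) : Ms A sg (val m) by apply/MP; apply: valP.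
have sgM : sg \in M by apply/MP; apply: Ms_sg.
have ssM : s - sg \in M by apply: rpredB => //; apply/MP.
(* The parities of the two coordinates in Z^2: the involution negates a degree
   exactly if par1 = 0 and par2 = 1, hence if both are odd. *)
pose q1 (m : subgrp M) := par1 A (val m) (+) par2 A sg (val m).
pose q2 (m : subgrp M) := par2 A sg (val m).
have p1B (x y : subgrp M) : par1 A (val (x - y)) = par1 A (val x) (+) par1 A (val y).
  exact: (par1B sgL (MsM x) (MsM y)).
have p2B (x y : subgrp M) : par2 A sg (val (x - y)) = par2 A sg (val x) (+) par2 A sg (val y).
  exact: (par2B charF_neq2 charF_neq3 torA c3A sgS sgL star_p gsg g0 (MsM x) (MsM y)).
(* Under ([q1], [q2]) the degree sg goes to (1, 0) and s - sg to (0, 1), which provides the two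
   degrees that [star_law_C2_P] asks for. *)
pose a : subgrp M := Sub sg sgM; pose s' : subgrp M := Sub s (introT (MP s) sM1).
apply: (@star_law_C2_P _ _ M freeL _ q1 q2 a (s' - a)).
- move=> l; have [x xl x0] := Msupp _ (valP l).
  by exists (Sub x (oppsub_elt (valP l) xl)) => // /(congr1 val).
- by move=> x y; rewrite /q1 p1B p2B addbACA.
- by move=> x y; rewrite /q2 p2B.
- by rewrite /q1 /= g1 g2.
- by rewrite /q1 p1B p2B /= s1 s2 g1 g2.
- by rewrite /q2 p2B /= s2 g2.
move=> l x xl; have := par_star torA sg (xl : A`_[val l] (val x)).
rewrite /q1 /q2; case: (par1 A _); case: (par2 A sg _) => /= h; exact: val_inj.
Qed.
End Converse.

(** * The torus A(k) *)

Section StructurableSpan.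
Variables (F : fieldType) (L : zmodType) (A : gradedInvAlg F L).
Variable pure : A -> Prop.
Hypothesis pure_span : forall x, exists y z, [/\ pure y, pure z & x = y + z].
Implicit Types x y z w q : A.

Definition str_id x y z w q :=
  triple x y (triple z w q) - triple z w (triple x y q) =
  triple (triple x y z) w q - triple z (triple y x w) q.

Lemma triple_D1 x x' y z : triple (x + x') y z = triple x y z + triple x' y z.
Proof. by rewrite /triple ?gstarD !gmulE; zmod. Qed.
Lemma triple_D2 x x' y z : triple y (x + x') z = triple y x z + triple y x' z.
Proof. by rewrite /triple ?gstarD !gmulE; zmod. Qed.
Lemma triple_D3 x x' y z : triple y z (x + x') = triple y z x + triple y z x'.
Proof. by rewrite /triple ?gstarD !gmulE; zmod. Qed.

(** Both sides are additive in each of the five arguments, so the arguments are reduced to pure ones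
    one at a time. *)
Lemma structurable_pure :
  (forall x y z w q, pure x -> pure y -> pure z -> pure w -> pure q -> str_id x y z w q) ->
  structurable A.
Proof.
move=> H.
have H5 x y z w q : pure x -> pure y -> pure z -> pure w -> str_id x y z w q.
  move=> hx hy hz hw; have [q1 [q2 [h1 h2 ->]]] := pure_span q.
  apply: (add_eqs (H x y z w _ hx hy hz hw h1) (H x y z w _ hx hy hz hw h2)).
  by rewrite !(triple_D1, triple_D2, triple_D3); zmod.
have H4 x y z w q : pure x -> pure y -> pure z -> str_id x y z w q.
  move=> hx hy hz; have [w1 [w2 [h1 h2 ->]]] := pure_span w.
  apply: (add_eqs (H5 x y z _ q hx hy hz h1) (H5 x y z _ q hx hy hz h2)).
  by rewrite !(triple_D1, triple_D2, triple_D3); zmod.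
have H3 x y z w q : pure x -> pure y -> str_id x y z w q.
  move=> hx hy; have [w1 [w2 [h1 h2 ->]]] := pure_span z.
  apply: (add_eqs (H4 x y _ w q hx hy h1) (H4 x y _ w q hx hy h2)).
  by rewrite !(triple_D1, triple_D2, triple_D3); zmod.
have H2 x y z w q : pure x -> str_id x y z w q.
  move=> hx; have [w1 [w2 [h1 h2 ->]]] := pure_span y.
  apply: (add_eqs (H3 x _ z w q hx h1) (H3 x _ z w q hx h2)).
  by rewrite !(triple_D1, triple_D2, triple_D3); zmod.
move=> x y z w q; have [w1 [w2 [h1 h2 ->]]] := pure_span x.
apply: (add_eqs (H2 _ y z w q h1) (H2 _ y z w q h2)).
by rewrite !(triple_D1, triple_D2, triple_D3); zmod.
Qed.
End StructurableSpan.

Section AkStructurable.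
Variables (F : fieldType) (L : zmodType) (M : zmodClosed L).
Variables (B : assocTorus F (subgrp M)) (k : diagForm B).
Local Notation K := (Ak k).
Local Notation X := {ffun 'I_(df_m k) -> B}.
Implicit Types (a b : B) (u v : X).

Definition inlB a : K := (a, 0).
Definition inrX u : K := (0, u).

Let mulA := at_assoc (a := B).

Lemma X_scaleA a b u : X_scale a (X_scale b u) = X_scale (a ** b) u.
Proof. by apply/ffunP => i; rewrite !ffunE mulA. Qed.
Lemma X_scale0l u : X_scale 0 u = 0.
Proof. by apply/ffunP => i; rewrite !ffunE gmul0x. Qed.

Lemma mulBB a b : inlB a ** inlB b = inlB (b ** a).
Proof. by congr (_, _); rewrite /= ?herm0l ?X_scale0 addr0. Qed.
Lemma mulBX a u : inlB a ** inrX u = inrX (X_scale a u).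
Proof. by congr (_, _); rewrite /= ?herm0l ?X_scale0 ?gmul0x addr0. Qed.
Lemma mulXB a u : inrX u ** inlB a = inrX (X_scale (star a) u).
Proof. by congr (_, _); rewrite /= ?herm0r ?X_scale0 ?gmulx0 add0r. Qed.
Lemma mulXX u v : inrX u ** inrX v = inlB (herm u v).
Proof. by congr (_, _); rewrite /= ?gmul0x ?gstar0 ?X_scale0l add0r. Qed.
Lemma star_inl a : star (inlB a) = inlB (star a). Proof. by []. Qed.
Lemma star_inr u : star (inrX u) = inrX u.
Proof. by congr (_, _); rewrite /= gstar0. Qed.

Lemma inlBD a b : inlB (a + b) = inlB a + inlB b.
Proof. by congr (_, _); rewrite /= addr0. Qed.
Lemma inlBB a b : inlB (a - b) = inlB a - inlB b.
Proof. by congr (_, _); rewrite /= subr0. Qed.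
Lemma inrXD u v : inrX (u + v) = inrX u + inrX v.
Proof. by congr (_, _); rewrite /= addr0. Qed.
Lemma inrXB u v : inrX (u - v) = inrX u - inrX v.
Proof. by congr (_, _); rewrite /= subr0. Qed.

Lemma tripleBBB a b c : triple (inlB a) (inlB b) (inlB c) =
  inlB (c ** star b ** a + a ** star b ** c - b ** star a ** c).
Proof. by rewrite /triple !star_inl !mulBB -inlBD -inlBB !mulA. Qed.
Lemma tripleBBX a b u : triple (inlB a) (inlB b) (inrX u) = inrX (X_scale (star a ** b) u).
Proof.
by rewrite /triple !star_inl mulBB !mulBX !mulXB !X_scaleA !ga_starK addrC addKr.
Qed.
Lemma tripleBXB a u c : triple (inlB a) (inrX u) (inlB c) = inrX (X_scale (star c ** a) u).
Proof. by rewrite /triple !star_inl star_inr mulBB !mulBX !mulXB !X_scaleA addrK. Qed.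
Lemma tripleXBB u b c : triple (inrX u) (inlB b) (inlB c) = inrX (X_scale (star c ** b) u).
Proof.
by rewrite /triple !star_inl star_inr mulBB !mulXB !mulBX !mulXB !X_scaleA ga_starK addrK.
Qed.
Lemma tripleXXB u v c : triple (inrX u) (inrX v) (inlB c) = inlB (c ** herm v u).
Proof.
by rewrite /triple !star_inr mulXX !mulBX !mulXX mulBB !hermZl addrC addKr.
Qed.
Lemma tripleXBX u b w : triple (inrX u) (inlB b) (inrX w) = inlB (b ** herm u w).
Proof.
by rewrite /triple star_inr star_inl !mulXB !mulXX mulBB !hermZl ga_starK addrK.
Qed.
Lemma tripleBXX a v w : triple (inlB a) (inrX v) (inrX w) = inlB (a ** herm v w).
Proof.
by rewrite /triple star_inr star_inl mulBX mulXB !mulXX mulBB !hermZl ga_starK addrK.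
Qed.
Lemma tripleXXX u v w : triple (inrX u) (inrX v) (inrX w) =
  inrX (X_scale (herm u v) w + X_scale (herm w v) u - X_scale (herm w u) v).
Proof. by rewrite /triple !star_inr !mulXX !mulBX -inrXD -inrXB. Qed.

Let tE := (tripleBBB, tripleBBX, tripleBXB, tripleXBB, tripleXXB, tripleXBX, tripleBXX, tripleXXX).

Lemma X_scaleDr a u v : X_scale a (u + v) = X_scale a u + X_scale a v.
Proof. by apply/ffunP => i; rewrite !ffunE gmulDr. Qed.
Lemma X_scaleNr a u : X_scale a (- u) = - X_scale a u.
Proof. by apply/ffunP => i; rewrite !ffunE gmulNr. Qed.
Lemma X_scaleDl a b u : X_scale (a + b) u = X_scale a u + X_scale b u.
Proof. by apply/ffunP => i; rewrite !ffunE gmulDl. Qed.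
Lemma X_scaleNl a u : X_scale (- a) u = - X_scale a u.
Proof. by apply/ffunP => i; rewrite !ffunE gmulNl. Qed.
Lemma X_scaleN1 u : - u = X_scale (- one B) u.
Proof. by rewrite X_scaleNl X_scale1. Qed.
Lemma hermNl u v : herm (- u) v = - herm u v.
Proof. by rewrite X_scaleN1 hermZl gmulNl ga_mul1x. Qed.
Lemma hermNr u v : herm u (- v) = - herm u v.
Proof. by rewrite X_scaleN1 hermZr gstarN gstar1 gmulNr ga_mulx1. Qed.
Lemma herm_star u v : star (herm u v) = herm v u.
Proof. by rewrite -hermC. Qed.

Let linE := (X_scaleDr, X_scaleNr, X_scaleDl, X_scaleNl, hermDl, hermDr, hermNl, hermNr,
  @gmulDl _ _ B, @gmulDr _ _ B, @gmulNl _ _ B, @gmulNr _ _ B,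
  @gstarD _ _ B, @gstarN _ _ B, @ga_starM _ _ B, @ga_starK _ _ B, herm_star,
  hermZl, hermZr, X_scaleA).

(** With each argument in B or X there are 32 cases. The table of triple products turns each of them
    into a consequence of the associativity of B and the sesquilinearity of [herm]. *)
Lemma Ak_structurable : structurable K.
Proof.
apply: (@structurable_pure _ _ K (fun x => (exists a, x = inlB a) \/ (exists u, x = inrX u))).
  move=> [a u]; exists (inlB a), (inrX u); split; [by left; exists a|by right; exists u|].
  by congr (_, _); rewrite /= ?addr0 ?add0r.
move=> x y z w q [[a ->]|[a ->]] [[b ->]|[b ->]] [[c ->]|[c ->]] [[d ->]|[d ->]] [[e ->]|[e ->]].
all: rewrite /str_id !tE -!(inlBB, inrXB); congr (_ _).
all: rewrite !linE ?mulA; zmod.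
Qed.
End AkStructurable.

Section ExtendGr.
Variables (F : fieldType) (L : zmodType) (M : zmodClosed L) (B : gradedInvAlg F (subgrp M)).

Lemma extend_grE l (x : B) : (extend B)`_[l] x <->
  (exists2 s : subgrp M, l = val s & B`_[s] x) \/ (l \notin M /\ x = 0).
Proof.
rewrite /=; case: (extendP B l) => [s ->|lM]; split.
- by left; exists s.
- by case=> [[s' /val_inj ->]//|[]]; rewrite (valP s).
- by right.
by case=> [[s lE]|[]//]; rewrite lE (valP s) in lM.
Qed.
End ExtendGr.

(** * A(k) is a torus *)

Section AkTorus.
Variables (F : fieldType) (L : zmodType) (M : zmodClosed L).
Variables (B : assocTorus F (subgrp M)) (k : diagForm B).
Local Notation K := (Ak k).
Local Notation X := {ffun 'I_(df_m k) -> B}.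
Local Notation rho := (@df_rho _ _ _ _ k).
Local Notation bb := (@df_b _ _ _ _ k).
Local Notation inl := (@inlB _ _ _ _ k).
Local Notation inr := (@inrX _ _ _ _ k).
Implicit Types (a b : B) (u v : X) (s : subgrp M).

Let mulA := at_assoc (a := B).
Let torB := at_torus B.

Definition at_ i b : X := [ffun j => if j == i then b else 0].

Lemma notin_rho s i : val s + rho i \notin M.
Proof.
apply: contra (df_rho_notin (d := k) i) => h.
by rewrite -(addKr (val s) (rho i)) rpredD ?rpredN //; apply: valP.
Qed.

Lemma Ak_gr_inl s a : B`_[s] a -> K`_[val s] (inl a).
Proof.
move=> ha; split=> [|i]; first by apply/extend_grE; left; exists s.
by rewrite ffunE; apply: (@ga_gr0 _ _ (extend B)).
Qed.

Lemma Ak_gr_inr s i b : B`_[s] b -> K`_[val s + rho i] (inr (at_ i b)).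
Proof.
move=> hb; split=> [|j]; first exact: (@ga_gr0 _ _ (extend B)).
rewrite ffunE; case: eqP => [->|_]; last exact: (@ga_gr0 _ _ (extend B)).
by rewrite addrK; apply/extend_grE; left; exists s.
Qed.

Lemma Ak_gr_M l (x : K) : K`_[l] x -> l \in M ->
  exists s a, [/\ l = val s, B`_[s] a & x = inl a].
Proof.
case: x => a u [/extend_grE[[s lE sa]|[/negP//]] h2] lM; exists s, a; split=> //.
congr (_, _); apply/ffunP => i; rewrite ffunE.
have /extend_grE[[s' lE' _]|[]//] := h2 i.
have := notin_rho s' i; rewrite -lE' subrK lE (valP s) //.
Qed.

Lemma Ak_gr_nM l (x : K) : K`_[l] x -> l \notin M -> exists u, x = inr u.
Proof.
case: x => a u [/extend_grE[[s lE sa]|[_ /= ->]] h2] lM; last by exists u.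
by rewrite lE (valP s) in lM.
Qed.

Lemma Ak_gr_nM_at l (x : K) : K`_[l] x -> l \notin M -> x <> 0 ->
  exists i s b, [/\ l = val s + rho i, B`_[s] b & x = inr (at_ i b)].
Proof.
move=> xl lM; have [u uE] := Ak_gr_nM xl lM; rewrite {}uE in xl * => x0.
have [_ /= h2] := xl.
have [i ui] : exists i, u i <> 0.
  apply: contrapT => h; apply: x0; congr (_, _); apply/ffunP => i; rewrite ffunE.
  by apply: contrapT => ui; apply: h; exists i.
have /extend_grE[[s lE sb]|[_ //]] := h2 i.
exists i, s, (u i); split=> //; first by rewrite -lE subrK.
congr (_, _); apply/ffunP => j; rewrite ffunE; case: eqP => [->//|/eqP ji].
have /extend_grE[[s' lE' _]|[]//] := h2 j.
have := df_rho_diff (d := k) ji; rewrite (_ : rho j - rho i = val s - val s').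
  by rewrite rpredB //; apply: valP.
by rewrite -lE -lE'; zmod.
Qed.

Lemma at_neq0 i b : b <> 0 -> inr (at_ i b) <> 0.
Proof. by move=> b0 [] /ffunP/(_ i); rewrite !ffunE eqxx. Qed.

Lemma herm_at i b c : herm (at_ i b) (at_ i c) = (b ** bb i) ** star c.
Proof.
rewrite /herm (bigD1 i) //= big1 ?addr0 => [|j /negbTE ji]; rewrite !ffunE ?eqxx //.
by rewrite ji !gmul0x.
Qed.
Lemma herm_atr u i c : herm u (at_ i c) = (u i ** bb i) ** star c.
Proof.
rewrite /herm (bigD1 i) //= big1 ?addr0 => [|j /negbTE ji]; rewrite !ffunE ?eqxx //.
by rewrite ji gstar0 gmulx0.
Qed.
Lemma X_scale_at a i b : X_scale a (at_ i b) = at_ i (a ** b).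
Proof. by apply/ffunP => j; rewrite !ffunE; case: ifP; rewrite ?gmulx0. Qed.

Lemma inl_inr (x : K) : x = inl x.1 + inr x.2.
Proof. by case: x => a u; congr (_, _); rewrite /= ?addr0 ?add0r. Qed.

Lemma bb_gr i : exists2 s : subgrp M, rho i *+ 2 = val s & B`_[s] (bb i).
Proof.
have /extend_grE[//|[_ /df_b_neq0//]] := df_b_gr (d := k) i.
Qed.

Lemma mul_eq1_cancel s a b : B`_[s] a -> a <> 0 -> a ** b = a -> b = one B.
Proof.
move=> sa a0 ab; have [c [_ _ ca _ _]] := inv_gr torB sa a0.
by rewrite -[b]ga_mul1x -ca -mulA ab.
Qed.

Lemma inr_inverse s i b : B`_[s] b -> b <> 0 -> exists s' c,
  [/\ B`_[s'] c, val s + rho i + (val s' + rho i) = 0,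
      inr (at_ i b) ** inr (at_ i c) = one K, inr (at_ i c) ** inr (at_ i b) = one K &
      forall z, inr (at_ i b) ** (inr (at_ i c) ** z) = inr (at_ i c) ** (inr (at_ i b) ** z)].
Proof.
move=> sb b0; have [t tE tb] := bb_gr i; have bi0 := df_b_neq0 (d := k) (i := i).
have bb0 := assoc_torus_mul_neq0 torB mulA sb b0 bi0.
have [d [dg bd db _ _]] := inv_gr torB (ga_gr_mul sb tb) bb0.
(* c v_i inverts b v_i when b b_i star(c) = 1, which forces c to be the star of (b b_i)^-1. *)
exists (- (s + t)), (star d).
have h1 : herm (at_ i b) (at_ i (star d)) = one B by rewrite herm_at ga_starK bd.
have h2 : herm (at_ i (star d)) (at_ i b) = one B by rewrite hermC h1 gstar1.
split.
- exact: ga_gr_star.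
- have -> : val (- (s + t)) = - (val s + val t) by [].
  by rewrite -tE mulr2n; zmod.
- by rewrite mulXX h1.
- by rewrite mulXX h2.
have e1 : (bb i ** d) ** b = one B.
  by apply: (mul_eq1_cancel sb b0); rewrite !mulA bd ga_mul1x.
have e2 : (bb i ** star b) ** star d = one B.
  by rewrite -gstar1 -db !ga_starM df_star_b.
move=> z; rewrite (inl_inr z) !gmulDr !mulXB !mulXX !hermZr h1 h2 !ga_starK !ga_mul1x.
rewrite !mulXB -!hermC !herm_atr !ga_starK !X_scale_at -!mulA.
rewrite (mulA (bb i) d) e1 (mulA (bb i) (star b)) e2.
by [].
Qed.

(** The support is closed under subtraction, because nonzero homogeneous elements are invertible and
    B is associative; as it also generates M, it is all of M. *)
Lemma coord_supp s : supp B s.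
Proof.
have [_ _ _ gen] := torB; have i0 : 'I_(df_m k) := Ordinal (df_m_gt0 k).
have o0 := gone_neq0 (df_b_neq0 (d := k) (i := i0)).
have : generated (supp B) s by rewrite gen.
move: s; apply: (@generated_min _ (supp B)) => //; split.
  by exists (one B) => //; apply: gr_one.
move=> x y [a xa a0] [b yb b0]; have [c [cy bc _ _ _]] := inv_gr torB yb b0.
exists (a ** c); first exact: ga_gr_mul.
apply: (assoc_torus_mul_neq0 torB mulA xa a0) => c0.
by apply: o0; rewrite -bc c0 gmulx0.
Qed.

Lemma Ak_torus : structurable_torus K.
Proof.
split; first exact: Ak_structurable.
- move=> l [x xl x0]; exists x => // y yl.
  have [->|/eqP y0] := eqVneq y 0; first by exists 0; rewrite scale0r.
  have [lM|lM] := boolP (l \in M).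
    have [s [a [lE sa xE]]] := Ak_gr_M xl lM; have [s' [a' [lE' sa' yE]]] := Ak_gr_M yl lM.
    have ss' : s' = s by apply: val_inj; rewrite -lE.
    have a0 : a <> 0 by move=> a0; apply: x0; rewrite xE a0.
    rewrite ss' in sa'; have [c aE] := gr_line torB sa a0 sa'.
    by exists c; rewrite yE xE aE; congr (_, _); rewrite scaler0.
  have [i [s [b [lE sb xE]]]] := Ak_gr_nM_at xl lM x0.
  have [i' [s' [b' [lE' sb' yE]]]] := Ak_gr_nM_at yl lM y0.
  (* Different basis vectors have degrees incongruent modulo M, so their multiples share no
     degree. *)
  have ii' : i' = i.
    apply/eqP/negPn/negP => ne; have := df_rho_diff (d := k) ne.
    rewrite (_ : rho i' - rho i = val s - val s'); first by rewrite rpredB //; apply: valP.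
    rewrite (_ : rho i' = l - val s'); last by rewrite lE'; zmod.
    by rewrite lE; zmod.
  have ss' : s' = s by apply: val_inj; apply: (addIr (rho i)); rewrite -lE lE' ii'.
  rewrite {}ii' {}ss' in sb' yE.
  have b0 : b <> 0.
    by move=> b0; apply: x0; rewrite xE b0; congr (_, _); apply/ffunP => j; rewrite !ffunE if_same.
  have [c bE] := gr_line torB sb b0 sb'; exists c; rewrite yE xE bE.
  congr (_, _); first by rewrite scaler0.
  by apply/ffunP => j; rewrite !ffunE; case: ifP; rewrite ?scaler0.
- move=> l x xl x0; have [lM|lM] := boolP (l \in M).
    have [s [a [lE sa xE]]] := Ak_gr_M xl lM.
    have a0 : a <> 0 by move=> a0; apply: x0; rewrite xE a0.
    have [c [_ ac ca _ _]] := inv_gr torB sa a0; exists (inl c); rewrite xE; split.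
    + by rewrite mulBB ca.
    + by rewrite mulBB ac.
    + move=> z; rewrite (inl_inr z) !gmulDr !(mulBB, mulBX) !X_scaleA -!mulA.
      by rewrite ac ca.
    move=> z; rewrite (inl_inr z) !gmulDl !(mulBB, mulXB) !X_scaleA !mulA.
    by rewrite ac ca -!ga_starM ac ca.
  have [i [s [b [lE sb xE]]]] := Ak_gr_nM_at xl lM x0.
  have b0 : b <> 0.
    by move=> b0; apply: x0; rewrite xE b0; congr (_, _); apply/ffunP => j; rewrite !ffunE if_same.
  have [s' [c [_ _ bc cb C]]] := inr_inverse i sb b0.
  exists (inr (at_ i c)); rewrite xE; split=> // z.
  by apply: gstar_inj; rewrite !(@ga_starM _ _ K) !star_inr C.
have i0 : 'I_(df_m k) := Ordinal (df_m_gt0 k).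
have o0 := gone_neq0 (df_b_neq0 (d := k) (i := i0)).
rewrite eqEsubset; split=> // l _.
have : generated ([set x | x \in M] `|` range rho) l by rewrite df_generated.
move: l; apply: generated_min; first exact: generated_subgroup.
move=> l [/= lM|[i _ <-]]; apply: sub_generated.
  have [a sa a0] := coord_supp (Sub l lM); exists (inl a); first exact: (Ak_gr_inl sa).
  by case.
exists (inr (at_ i (one B))); last exact: at_neq0.
by have := Ak_gr_inr i (@gr_one _ _ B); rewrite add0r.
Qed.
End AkTorus.

(** * The involution in terms of degrees *)

Section StarOfC2P.
Variables (F : fieldType) (L : zmodType) (B : gradedInvAlg F L).

Lemma quat_elt_star l : star (quat_elt F l) =
  if oddz (l 0 0) && oddz (l 0 1) then - quat_elt F l else quat_elt F l.
Proof.
rewrite /quat_elt; case: (oddz _); case: (oddz _) => /=; congr (_, _, _, _);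
  by rewrite ?oppr0.
Qed.

(** The involution of P(r) is trivial and each component of C_*(2) is spanned by one monomial, so on
    homogeneous pure tensors the sign depends only on the degree in Z^2. *)
Lemma C2_P_star : isograded_to_C2_P B ->
  exists r (th : {additive L -> 'rV[int]_2 * 'rV[int]_r}), bijective th /\
  forall l (x : B), B`_[l] x ->
    star x = if oddz ((th l).1 0 0) && oddz ((th l).1 0 1) then - x else x.
Proof.
move=> [r [T [[t [[tb _] _ _ tS tG]] [phi [th [[lin bphi _ _ phiS] bth gr]]]]]].
exists r, th; split=> // l x xl; apply: (bij_inj bphi); rewrite phiS.
have phiN y : phi (- y) = - phi y.
  have phi0 : phi 0 = 0 by have := lin (-1) 0 0; rewrite scaler0 addr0 scaleN1r addNr.
  by rewrite -scaleN1r -[_ *: y]addr0 lin phi0 addr0 scaleN1r.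
have : T`_[th l] (phi x) by rewrite -gr; exists x.
case: (th l) => l1 m; rewrite tG => -[s Hs phx].
have tN (a : C2alg F) (b : Palg F r) : t (- a) b = - t a b.
  by have := bilinearZ tb (-1) 1 a b; rewrite scaleN1r scale1r mulr1 scaleN1r.
have st (p : C2alg F * Palg F r) : p \in s -> star (t p.1 p.2) =
    if oddz (l1 0 0) && oddz (l1 0 1) then - t p.1 p.2 else t p.1 p.2.
  move=> /Hs[/quat_line[c pE] _].
  have -> : star (t p.1 p.2) = t (star p.1) p.2 by rewrite tS.
  by rewrite pE gstarZ quat_elt_star; case: ifP => // _; rewrite scalerN tN.
rewrite (fun_if phi) phiN phx gstar_sum; case: ifP => odd_l.
  by rewrite -sumrN; apply: eq_big_seq => p /st ->; rewrite odd_l.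
by apply: eq_big_seq => p /st ->; rewrite odd_l.
Qed.
End StarOfC2P.

(** * The incidence geometry of A(k) *)

Section AkClassIIIa.
Variables (F : fieldType) (L : zmodType) (M : zmodClosed L).
Variables (B : assocTorus F (subgrp M)) (k : diagForm B).
Hypothesis charF_neq2 : 2%N \notin [pchar F].
Variables (r : nat) (th : {additive subgrp M -> 'rV[int]_2 * 'rV[int]_r}).
Variable th' : 'rV[int]_2 * 'rV[int]_r -> subgrp M.
Hypothesis th'K : cancel th' th.
Local Notation p0 s := (oddz ((th s).1 0 0)).
Local Notation p1 s := (oddz ((th s).1 0 1)).
Hypothesis starB : forall s (x : B), B`_[s] x ->
  star x = if p0 s && p1 s then - x else x.
Local Notation K := (Ak k).
Local Notation Lm := (Lambda_minus K).
Local Notation inl := (@inlB _ _ _ _ k).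
Local Notation inr := (@inrX _ _ _ _ k).
Implicit Types (a b : B) (s : subgrp M) (l : L).

Let torB := at_torus B.
Let sLm : is_subgroup Lm := generated_subgroup _.

Lemma p0B s t : p0 (s - t) = p0 s (+) p0 t.
Proof. by rewrite raddfB !mxE oddzD oddzN. Qed.
Lemma p1B s t : p1 (s - t) = p1 s (+) p1 t.
Proof. by rewrite raddfB !mxE oddzD oddzN. Qed.

(** [s11] will be a skew degree, and [s10] represents the nontrivial coset of [Lambda_minus] in M,
    the future centre. *)
Definition s11 : subgrp M := th' (delta_mx 0 0 + delta_mx 0 1, 0).
Definition s10 : subgrp M := th' (delta_mx 0 0, 0).
Lemma p_s11 : p0 s11 && p1 s11. Proof. by rewrite th'K !mxE. Qed.
Lemma p_s10 : p0 s10 /\ p1 s10 = false. Proof. by rewrite th'K !mxE. Qed.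

Lemma Ak_supp_minus l : supp_minus K l <-> exists s, l = val s /\ p0 s && p1 s.
Proof.
split=> [[x [xl sx x0]]|[s [-> ps]]]; last first.
  have [a sa a0] := coord_supp k s; exists (inl a); split; first exact: Ak_gr_inl.
    by rewrite star_inl (starB sa) ps; congr (_, _); rewrite oppr0.
  by case.
have [lM|lM] := boolP (l \in M); last first.
  have [u uE] := Ak_gr_nM xl lM; case: x0; apply: (opp_fix0 charF_neq2).
  by rewrite -sx uE star_inr.
have [s [a [lE sa aE]]] := Ak_gr_M xl lM; exists s; split=> //.
apply: contrapT => /negP ps; case: x0; apply: (opp_fix0 charF_neq2).
by rewrite -sx aE star_inl (starB sa) (negbTE ps).
Qed.

Lemma Ak_Lm l : Lm l <-> exists s, l = val s /\ p0 s = p1 s.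
Proof.
split.
  pose H := [set l | exists s, l = val s /\ p0 s = p1 s].
  apply: (@generated_min _ _ H) => [|m /Ak_supp_minus[s [-> /andP[h0 h1]]]]; last first.
    by exists s; rewrite h0 h1.
  split=> [|_ _ [s [-> ps]] [t [-> pt]]]; first by exists 0; split=> //; rewrite raddf0 !mxE.
  by exists (s - t); rewrite p0B p1B ps pt.
move=> [s [-> ps]]; have gen t : p0 t && p1 t -> Lm (val t).
  by move=> pt; apply: sub_generated; apply/Ak_supp_minus; exists t.
have [h|h] := boolP (p0 s); first by apply: gen; rewrite h -ps.
(* A degree with both coordinates even is the sum of two with both odd, s - s11 and s11. *)
rewrite -(subrK s11 s); apply: (subgroupD sLm); apply: gen; last exact: p_s11.
by have /andP[h0 h1] := p_s11; rewrite p0B p1B h0 h1 -ps (negbTE h).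
Qed.

Lemma Ak_Lm_val s : Lm (val s) <-> p0 s = p1 s.
Proof. by rewrite Ak_Lm; split=> [[t [/val_inj <-]]//|ps]; exists s. Qed.

Lemma Ak_Lm_M l : Lm l -> l \in M.
Proof. by move=> /Ak_Lm[s [-> _]]; apply: valP. Qed.

Local Notation sg := (val s10).

Lemma sgN_Lm : ~ Lm sg.
Proof. by rewrite Ak_Lm_val; have [-> ->] := p_s10. Qed.

Lemma M_coset s : ~ Lm (val s) -> Lm (val s - sg).
Proof.
have -> : val s - sg = val (s - s10) by [].
rewrite !Ak_Lm_val p0B p1B; have [-> ->] := p_s10.
by case: (p0 s); case: (p1 s).
Qed.

Lemma coset_eq l m : Lm (l - m) -> coset K l = coset K m.
Proof.
move=> h; rewrite eqEsubset; split=> n /= nl.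
  by rewrite /coset /= -(subrK l n) -addrA; apply: (subgroupD sLm nl h).
by rewrite /coset /= -(subrK m n) -addrA; apply: (subgroupD sLm nl (subgroupC sLm h)).
Qed.

Lemma Ak_class_III : class_III K.
Proof.
have [x1 x1g x10] := coord_supp k s10.
have X1 := Ak_gr_inl k x1g; have X10 : inl x1 <> 0 by case.
have nE (w : K) : K`_[sg] w -> w <> 0 -> ~ partE w.
  by move=> wg w0 /graded_part_proj/(_ _ sgN_Lm); rewrite proj_id.
split.
- by exists (val s11); apply/Ak_supp_minus; exists s11; split=> //; apply: p_s11.
- by move=> e; apply: (nE _ X1 X10); rewrite e.
pose i : 'I_(df_m k) := Ordinal (df_m_gt0 k).
have bi0 := df_b_neq0 (d := k) (i := i); have o0 := gone_neq0 bi0.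
have og := @gr_one _ _ B.
have [s' [c [cg deg bc _ _]]] := inr_inverse i og o0.
have iW s b : B`_[s] b -> partW (inr (at_ i b)).
  move=> bg; apply: (graded_part_hom (X := ~` Lm) _ (Ak_gr_inr i bg)) => /Ak_Lm_M.
  by apply/negP/notin_rho.
(* With c v_i inverse to v_i, the product of v_i and (star(x1) c) v_i is k(v_i, c v_i) x1 = x1,
   whose degree sg is outside [Lambda_minus]. *)
exists (inr (at_ i (one B))), (inr (at_ i (star x1 ** c))); split; first exact: iW og.
  by apply: (iW (s10 + s')); apply: ga_gr_mul => //; apply: ga_gr_star.
move: bc; rewrite -X_scale_at !mulXX hermZr ga_starK => -[->].
by rewrite ga_mul1x; apply: nE.
Qed.

Lemma Ak_star_with_centre : star_with_centre K (coset K sg).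
Proof.
have [x1 x1g x10] := coord_supp k s10.
have X1 := Ak_gr_inl k x1g; have X10 : inl x1 <> 0 by case.
have sgP : (supp K `\` Lm) sg by split; [exists (inl x1)|exact: sgN_Lm].
split; first by exists sg.
- move=> q [a [[x xa x0] aL] ->] aneq.
  have aM : a \notin M.
    apply/negP => aM; apply: aneq; apply: coset_eq.
    exact: (@M_coset (Sub a aM)).
  have [i [s [b [aE bg xE]]]] := Ak_gr_nM_at xa aM x0.
  have b0 : b <> 0.
    by move=> b0; apply: x0; rewrite xE b0; congr (_, _); apply/ffunP => j; rewrite !ffunE if_same.
  have [s' [c [cg deg bc _ _]]] := inr_inverse i bg b0.
  have [y1 [y1g xy yx _ _]] := inv_gr torB x1g x10.
  have o0 := gone_neq0 x10.
  (* Here c v_i inverts x = b v_i, and the factor star(y1) makes x z = y1 = x1^-1. Hence x1 (x z) =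
     1, and the cosets of sg, a and cc form a line. *)
  have zg := Ak_gr_inr i (ga_gr_mul (ga_gr_star y1g) cg).
  set z := inr _ in zg; set cc := _ + _ in zg.
  have yz : x ** z = inl y1.
    move: bc; rewrite xE /z -X_scale_at !mulXX hermZr ga_starK => -[->].
    by rewrite ga_mul1x.
  have xyz : inl x1 ** inl y1 = one K by rewrite mulBB yx.
  have y10 : y1 <> 0 by move=> h; apply: o0; rewrite -xy h gmulx0.
  have z0 : z <> 0 by move=> h; apply: y10; move: yz; rewrite h gmulx0 => -[].
  have ccM : cc \notin M by apply: notin_rho.
  have ccL : ~ Lm cc by move=> /Ak_Lm_M; apply/negP.
  have K10 : one K <> 0 by case.
  exists (coset K cc); first by exists cc => //; split=> //; exists z.
  exists sg, a, cc; split=> //; first by split=> //; split=> //; [exists x|exists z].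
  exists (inl x1), x, z, 0, (inl y1), (one K), 0; split=> //; split=> //.
    split; [exact: graded_part0| |by rewrite add0r].
    apply: (graded_part_hom (X := ~` Lm) _ (Ak_gr_inl k y1g)) => /(subgroupN sLm).
    by rewrite (_ : val (- s10) = - sg) ?opprK //; apply: sgN_Lm.
  split; [|exact: graded_part0|by rewrite addr0].
  by apply: (graded_part_hom (X := Lm) _ (@gr_one _ _ K)); apply: sLm.1.
move=> q t u [a [b [c [[[aS aL] [bS bL] [cS cL]] hd pe]]]].
have [abcL [x [y [z [xa yb zc xyz]]]]] := h_diam_prod aL hd.
have H l : ~ Lm l -> l \in M -> coset K sg = coset K l.
  by move=> lL lM; apply/esym/coset_eq; apply: (@M_coset (Sub l lM)).
rewrite (perm_mem pe) !inE.
(* A point represented in M is the centre. Three points outside M would give x, y, z in X, so that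
   yz lies in B and x(yz) in X; its degree lies in [Lambda_minus], hence in M, and the product would
   be 0. *)
have [aM|aM] := boolP (a \in M); first by rewrite (H a) // eqxx.
have [bM|bM] := boolP (b \in M); first by rewrite (H b) // eqxx orbT.
have [cM|cM] := boolP (c \in M); first by rewrite (H c) // eqxx !orbT.
have [u1 xE] := Ak_gr_nM xa aM; have [u2 yE] := Ak_gr_nM yb bM; have [u3 zE] := Ak_gr_nM zc cM.
have := ga_gr_mul xa (ga_gr_mul yb zc); rewrite addrA => /Ak_gr_M /(_ (Ak_Lm_M abcL)).
rewrite xE yE zE mulXX mulXB => -[s [d [_ _ [_ e]]]].
by case: xyz; rewrite xE yE zE mulXX mulXB e.
Qed.
End AkClassIIIa.

Theorem Ak_is_class_IIIa (F : fieldType) (L : zmodType) (M : zmodClosed L)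
    (B : assocTorus F (subgrp M)) (k : diagForm B) :
  2%N \notin [pchar F] -> isograded_to_C2_P B ->
  structurable_torus (Ak k) /\ class_IIIa (Ak k).
Proof.
move=> char2 /C2_P_star[r [th [[th' _ th'K] starB]]]; split; first exact: Ak_torus.
split; first exact: (Ak_class_III k char2 th'K starB).
by exists (coset (Ak k) (val (s10 th'))); apply: (Ak_star_with_centre k char2 th'K starB).
Qed.

Theorem theorem9p1 (F : fieldType)
    (charF_neq2 : 2%N \notin [pchar F]) (charF_neq3 : 3%N \notin [pchar F])
    (Lambda : zmodType) (LambdaP : free_abelian_of_finite_rank Lambda) :
  (forall (M : zmodClosed Lambda) (B : assocTorus F (subgrp M))
      (k : diagForm B),
    (forall l : Lambda, l *+ 2 \in M) -> isograded_to_C2_P B ->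
    structurable_torus (Ak k) /\ class_IIIa (Ak k))
  /\
  (forall A : gradedInvAlg F Lambda, structurable_torus A -> class_IIIa A ->
    exists (M : zmodClosed Lambda) (B : assocTorus F (subgrp M))
      (k : diagForm B),
    [/\ forall l : Lambda, l *+ 2 \in M, isograded_to_C2_P B &
        graded_isomorphic A (Ak k)]).
Proof.
split=> [M B k _|A]; first exact: Ak_is_class_IIIa.
exact: class_IIIa_is_Ak.
Qed.
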